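(* Let $\Bbbk$ be an infinite field, $S=\Bbbk[x_1,\ldots,x_n]$ with the standard grading, and $\mathfrak m=(x_1,\ldots,x_n)$. Let $\mathbb M$ be the $\mathbb Q$-vector space of $(n+1)\times\mathbb Z$ matrices with rational entries and only finitely many non-zero entries, with rows indexed by $i=0,\ldots,n$ and columns indexed by $j\in\mathbb Z$. Let $$\mathcal C^{\mathrm{seq}}=\mathbb Q_{\ge0}\cdot\{\Delta[H^\bullet_{\mathfrak m}(M)]\mid M\text{ is a finitely generated sequentially Cohen-Macaulay }\mathbb Z\text{-graded }S\text{-module}\}.$$ Let $A=(a_{i,j})\in\mathbb M$. Then $A\in\mathcal C^{\mathrm{seq}}$ if and only if $a_{i,j}\ge0$ for all integers $0\le i\le n$ and $j\in\mathbb Z$.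
   Context: Sequentially Cohen-Macaulay: a finitely generated graded $S$-module $M$ is sequentially Cohen-Macaulay if there is a filtration $0=M_0\subseteq M_1\subseteq\cdots\subseteq M_r=M$ by graded submodules such that each quotient $M_{i+1}/M_i$ is Cohen-Macaulay and $\dim(M_{i+1}/M_i)>\dim(M_i/M_{i-1})$ for $i=1,\dots,r-1$. Equivalently, for every $i$, $\operatorname{Ext}^i_S(M,S)$ is either zero or Cohen-Macaulay of dimension $n-i$. The operator $\Delta$: for a $\mathbb Z$-graded $\Bbbk$-vector space $N=\bigoplus_j N_j$ with all $\dim_{\Bbbk}N_j<\infty$, define row vectors $\Delta^t(N)$ indexed by $j\in\mathbb Z$ by $\Delta^0(N)_j=\dim_{\Bbbk}(N_j)$ and $\Delta^t(N)_j=\Delta^{t-1}(N)_j-\Delta^{t-1}(N)_{j+1}$ for $t>0$. For a finitely generated $\mathbb Z$-graded $S$-module $M$, $\Delta[H^\bullet_{\mathfrak m}(M)]$ is the $(n+1)\times\mathbb Z$ matrix whose row of index $i$ is $\Delta^i(H^i_{\mathfrak m}(M))$, $0\le i\le n$. This matrix has only finitely many non-zero entries, i.e. it lies in $\mathbb M$. The notation $\mathbb Q_{\ge0}\cdot X$ denotes the set of finite non-negative rational linear combinations of elements of $X$. *)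

(* Defs.v *)
From HB Require Import structures.
From mathcomp Require Import all_boot all_order all_algebra.
From mathcomp Require Import zify ring.
From mathcomp Require Export mpoly.
From mathcomp Require Export boolp classical_sets functions cardinality.

Set Implicit Arguments.
Unset Strict Implicit.
Unset Printing Implicit Defensive.

Import Order.TTheory GRing.Theory Num.Theory.

Local Open Scope classical_set_scope.
Local Open Scope ring_scope.
Local Open Scope quotient_scope.

Section Submodules.
Variables (R : comNzRingType) (M : lmodType R).

Record submodule := Submodule {
  submod_pred :> {pred M};
  submodule_closed : submod_closed submod_pred }.

HB.instance Definition _ (U : submodule) :=
  GRing.isSubmodClosed.Build R M (submod_pred U)
    (GRing.submod_closed_semi (submodule_closed U)).

Definition submod (U : submodule) : Type := {x : M | x \in submod_pred U}.

HB.instance Definition _ (U : submodule) := SubChoice.on (submod U).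
HB.instance Definition _ (U : submodule) :=
  [SubChoice_isSubLmodule of submod U by <:].

Definition quotmod (U : submodule) : Type := Quotient.quot (submod_pred U).

HB.instance Definition _ (U : submodule) := GRing.Zmodule.on (quotmod U).
HB.instance Definition _ (U : submodule) :=
  EqQuotient.on (quotmod U).

Section Scale.
Variable U : submodule.
Implicit Types (a b : R) (x y : M) (u v : quotmod U).

Definition quotmod_scale a u : quotmod U := \pi_(quotmod U) (a *: repr u).

Lemma pi_quotmod_eq x y :
  (\pi_(quotmod U) x == \pi_(quotmod U) y) = (x - y \in submod_pred U).
Proof. by rewrite Quotient.idealrBE. Qed.

Lemma quotmod_scaleE a x :
  quotmod_scale a (\pi_(quotmod U) x) = \pi_(quotmod U) (a *: x).
Proof.
apply/eqP; rewrite pi_quotmod_eq -scalerBr rpredZ //.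
by rewrite -pi_quotmod_eq reprK.
Qed.

Lemma pi_quotmodD x y :
  \pi_(quotmod U) (x + y) = \pi_(quotmod U) x + \pi_(quotmod U) y.
Proof. exact: Quotient.pi_add. Qed.

Lemma quotmod_scaleA a b u :
  quotmod_scale a (quotmod_scale b u) = quotmod_scale (a * b) u.
Proof.
by elim/quotW: u => x; rewrite (quotmod_scaleE b) !(quotmod_scaleE _ x)
  quotmod_scaleE scalerA.
Qed.

Lemma quotmod_scale1 : left_id 1 quotmod_scale.
Proof. by elim/quotW=> x; rewrite (quotmod_scaleE _ x) scale1r. Qed.

Lemma quotmod_scaleDr : right_distributive quotmod_scale +%R.
Proof.
move=> a; elim/quotW=> x; elim/quotW=> y.
rewrite -pi_quotmodD (quotmod_scaleE _ x) (quotmod_scaleE _ y).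
by rewrite quotmod_scaleE scalerDr pi_quotmodD.
Qed.

Lemma quotmod_scaleDl u : {morph quotmod_scale^~ u : a b / a + b}.
Proof.
by elim/quotW: u => x a b; rewrite !(quotmod_scaleE _ x) scalerDl pi_quotmodD.
Qed.
End Scale.

HB.instance Definition _ (U : submodule) :=
  GRing.Zmodule_isLmodule.Build R (quotmod U)
    (@quotmod_scaleA U) (@quotmod_scale1 U) (@quotmod_scaleDr U)
    (@quotmod_scaleDl U).

End Submodules.

Section Subquotient.
Variables (R : comNzRingType) (M : lmodType R) (V U : submodule M).

Lemma restr_closed :
  submod_closed [pred x : submod V | val x \in submod_pred U].
Proof.
split=> [|a x y]; rewrite !inE ?raddf0 ?rpred0 // => Ux Uy.
by rewrite linearP rpredD // rpredZ.
Qed.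

Definition restr_submod : submodule (submod V) := Submodule restr_closed.

(* V / (U \cap V), that is, V / U when U is contained in V *)
Definition subquot : lmodType R := quotmod restr_submod.
End Subquotient.

Section Localization.
Variables (R : comNzRingType) (M : lmodType R) (f : R).
Implicit Types (p q : M * nat) (r : R) (x y z : M) (a b c : nat).

(* the pair (x, a) stands for the fraction x / f ^ a *)
Definition loc_rel p q : bool :=
  `[< exists t, f ^+ (t + q.2) *: p.1 = f ^+ (t + p.2) *: q.1 >].

Lemma loc_expZ a b x : f ^+ a *: (f ^+ b *: x) = f ^+ (a + b) *: x.
Proof. by rewrite scalerA -exprD. Qed.

Lemma loc_rel_equiv : equiv_class_of loc_rel.
Proof.
split=> [p|p q|q p r].
- by apply/asboolP; exists 0%N.
- by apply/asboolP/asboolP => -[t e]; exists t.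
- move=> /asboolP[s e1] /asboolP[t e2]; apply/asboolP.
  exists (s + t + q.2)%N.
  have -> : (s + t + q.2 + r.2 = (t + r.2) + (s + q.2))%N by lia.
  have -> : (s + t + q.2 + p.2 = (s + p.2) + (t + q.2))%N by lia.
  rewrite -(loc_expZ (t + r.2)) e1 -(loc_expZ (s + p.2)) -e2 !loc_expZ.
  by rewrite addnC.
Qed.

Canonical loc_equiv := EquivRelPack loc_rel_equiv.
Canonical loc_encModRel := defaultEncModRel loc_rel.

Definition loc : Type := {eq_quot loc_rel}.
HB.instance Definition _ := Choice.on loc.
HB.instance Definition _ := EqQuotient.on loc.

Implicit Types (u v w : loc).

Definition frac x a : loc := \pi_loc (x, a).

Lemma fracP x a y b :
  frac x a = frac y b <-> exists t, f ^+ (t + b) *: x = f ^+ (t + a) *: y.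
Proof.
rewrite /frac; split=> [/eqP|e]; first by rewrite eqmodE => /asboolP.
by apply/eqP; rewrite eqmodE; apply/asboolP.
Qed.

Lemma locW (P : loc -> Prop) : (forall x a, P (frac x a)) -> forall u, P u.
Proof. by move=> h; elim/quotW => -[x a]; apply: h. Qed.

Definition loc_num u : M := (repr u).1.
Definition loc_exp u : nat := (repr u).2.

Lemma frac_num u : frac (loc_num u) (loc_exp u) = u.
Proof. by rewrite /frac -surjective_pairing reprK. Qed.

Lemma loc_numP x a : exists t,
  f ^+ (t + a) *: loc_num (frac x a) = f ^+ (t + loc_exp (frac x a)) *: x.
Proof. by apply/fracP; rewrite frac_num. Qed.

Definition loc_zero := frac 0 0.
Definition loc_opp u := frac (- loc_num u) (loc_exp u).
Definition loc_add u v :=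
  frac (f ^+ loc_exp v *: loc_num u + f ^+ loc_exp u *: loc_num v)
       (loc_exp u + loc_exp v).
Definition loc_scale r u := frac (r *: loc_num u) (loc_exp u).

Lemma loc_oppE x a : loc_opp (frac x a) = frac (- x) a.
Proof. by have [t e] := loc_numP x a; apply/fracP; exists t; rewrite !scalerN e. Qed.

Lemma loc_scaleE r x a : loc_scale r (frac x a) = frac (r *: x) a.
Proof.
have [t e] := loc_numP x a; apply/fracP; exists t.
by rewrite !(scalerA _ r) ![_ * r]mulrC -!scalerA e.
Qed.

Lemma loc_addE x a y b :
  loc_add (frac x a) (frac y b) = frac (f ^+ b *: x + f ^+ a *: y) (a + b).
Proof.
have [s ex] := loc_numP x a; have [t ey] := loc_numP y b.
rewrite /loc_add; move: ex ey.
move: (loc_num _) (loc_exp _) (loc_num _) (loc_exp _) => y' b' x' a' ex ey.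
apply/fracP; exists (s + t)%N; rewrite !scalerDr !loc_expZ; congr (_ + _).
  have -> : (s + t + (a + b) + b' = (t + b + b') + (s + a))%N by lia.
  by rewrite -loc_expZ ex loc_expZ; congr (_ ^+ _ *: _); lia.
have -> : (s + t + (a + b) + a' = (s + a + a') + (t + b))%N by lia.
by rewrite -loc_expZ ey loc_expZ; congr (_ ^+ _ *: _); lia.
Qed.

Lemma loc_addA : associative loc_add.
Proof.
elim/locW=> x a; elim/locW=> y b; elim/locW=> z c.
rewrite (loc_addE y b z c) (loc_addE x a y b) !loc_addE addnA.
by rewrite !scalerDr !loc_expZ addrA (addnC c b) (addnC c a).
Qed.

Lemma loc_addC : commutative loc_add.
Proof.
by elim/locW=> x a; elim/locW=> y b; rewrite !loc_addE addrC addnC.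
Qed.

Lemma loc_add0 : left_id loc_zero loc_add.
Proof.
by elim/locW=> x a; rewrite /loc_zero loc_addE scaler0 add0r scale1r.
Qed.

Lemma loc_addN : left_inverse loc_zero loc_opp loc_add.
Proof.
elim/locW=> x a; rewrite loc_oppE loc_addE scalerN addNr.
by apply/fracP; exists 0%N; rewrite !scaler0.
Qed.

HB.instance Definition _ :=
  GRing.isZmodule.Build loc loc_addA loc_addC loc_add0 loc_addN.

Lemma loc_scaleA r r' u : loc_scale r (loc_scale r' u) = loc_scale (r * r') u.
Proof.
by elim/locW: u => x a; rewrite (loc_scaleE r') !(loc_scaleE _ x)
  loc_scaleE scalerA.
Qed.

Lemma loc_scale1 : left_id 1 loc_scale.
Proof. by elim/locW=> x a; rewrite loc_scaleE scale1r. Qed.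

Lemma loc_scaleDr : right_distributive loc_scale +%R.
Proof.
move=> r; elim/locW=> x a; elim/locW=> y b.
rewrite -[LHS]/(loc_scale r (loc_add _ _)) -[RHS]/(loc_add _ _).
rewrite loc_addE !loc_scaleE loc_addE scalerDr !scalerA.
by rewrite ![r * _]mulrC.
Qed.

Lemma loc_scaleDl u : {morph loc_scale^~ u : r r' / r + r'}.
Proof.
elim/locW: u => x a r r'; rewrite !loc_scaleE -[RHS]/(loc_add _ _) loc_addE.
apply/fracP; exists 0%N; rewrite -scalerDr -scalerDl loc_expZ.
by congr (_ ^+ _ *: _); lia.
Qed.

HB.instance Definition _ :=
  GRing.Zmodule_isLmodule.Build R loc loc_scaleA loc_scale1 loc_scaleDr
    loc_scaleDl.

Lemma fracD x a y b :
  frac x a + frac y b = frac (f ^+ b *: x + f ^+ a *: y) (a + b).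
Proof. exact: loc_addE. Qed.

Lemma fracZ r x a : r *: frac x a = frac (r *: x) a.
Proof. exact: loc_scaleE. Qed.

End Localization.

Section LocalizationMap.
Variables (R : comNzRingType) (M : lmodType R) (f g h : R).

(* the canonical map M_f -> M_h, x / f ^ a |-> g ^ a x / h ^ a, for h = f * g *)
Definition loc_map (u : loc M f) : loc M h :=
  frac h (g ^+ loc_exp u *: loc_num u) (loc_exp u).

Hypothesis hE : h = f * g.

Lemma loc_mapE x a : loc_map (frac f x a) = frac h (g ^+ a *: x) a.
Proof.
have [t e] := loc_numP f x a; apply/fracP; exists t; move: e.
move: (loc_num _) (loc_exp _) => x' a' e.
rewrite hE !exprMn !exprD !scalerA.
rewrite (_ : _ * _ * _ = g ^+ t * g ^+ a * g ^+ a' * f ^+ (t + a)); last first.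
  by rewrite exprD; ring.
rewrite -scalerA e scalerA; congr (_ *: _); rewrite exprD; ring.
Qed.

Lemma loc_map_is_linear : linear loc_map.
Proof.
move=> r; elim/locW=> x a; elim/locW=> y b.
rewrite fracZ fracD !loc_mapE fracZ fracD; apply/fracP; exists 0%N.
congr (_ *: _); rewrite !scalerDr !scalerA hE !exprMn exprD.
by congr (_ *: _ + _ *: _); ring.
Qed.
End LocalizationMap.

Section Product.
Variables (R : comNzRingType) (I : Type) (N : I -> lmodType R).

Definition dprod : Type := forall i, N i.
Implicit Types (c d e : dprod) (r : R).

HB.instance Definition _ := gen_eqMixin dprod.
HB.instance Definition _ := gen_choiceMixin dprod.

Lemma dprodP c d : (forall i, c i = d i) -> c = d.
Proof. exact: functional_extensionality_dep. Qed.

Definition dprod_zero : dprod := fun i => 0.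
Definition dprod_opp c : dprod := fun i => - c i.
Definition dprod_add c d : dprod := fun i => c i + d i.
Definition dprod_scale r c : dprod := fun i => r *: c i.

Lemma dprod_addA : associative dprod_add.
Proof. by move=> c d e; apply: dprodP => i; apply: addrA. Qed.
Lemma dprod_addC : commutative dprod_add.
Proof. by move=> c d; apply: dprodP => i; apply: addrC. Qed.
Lemma dprod_add0 : left_id dprod_zero dprod_add.
Proof. by move=> c; apply: dprodP => i; apply: add0r. Qed.
Lemma dprod_addN : left_inverse dprod_zero dprod_opp dprod_add.
Proof. by move=> c; apply: dprodP => i; apply: addNr. Qed.

HB.instance Definition _ :=
  GRing.isZmodule.Build dprod dprod_addA dprod_addC dprod_add0 dprod_addN.

Lemma dprod_scaleA r r' c :
  dprod_scale r (dprod_scale r' c) = dprod_scale (r * r') c.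
Proof. by apply: dprodP => i; apply: scalerA. Qed.
Lemma dprod_scale1 : left_id 1 dprod_scale.
Proof. by move=> c; apply: dprodP => i; apply: scale1r. Qed.
Lemma dprod_scaleDr : right_distributive dprod_scale +%R.
Proof. by move=> r c d; apply: dprodP => i; apply: scalerDr. Qed.
Lemma dprod_scaleDl c : {morph dprod_scale^~ c : r r' / r + r'}.
Proof. by move=> r r'; apply: dprodP => i; apply: scalerDl. Qed.

HB.instance Definition _ :=
  GRing.Zmodule_isLmodule.Build R dprod dprod_scaleA dprod_scale1
    dprod_scaleDr dprod_scaleDl.

Lemma dprodDZE r c d i : (r *: c + d) i = r *: c i + d i.
Proof. by []. Qed.

End Product.

Section CechComplex.
Variables (k : fieldType) (n : nat) (M : lmodType {mpoly k[n]}).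

Definition xprod (F : {set 'I_n}) : {mpoly k[n]} := \prod_(i in F) 'X_i.

(* The whole Cech complex of M on x_1, ..., x_n, i.e., the direct sum of the
   localizations of M at all squarefree monomials; its component of
   cohomological degree p consists of the c supported on the F of size p. *)
Definition cech : lmodType {mpoly k[n]} :=
  dprod (fun F : {set 'I_n} => loc M (xprod F)).

Definition cech_diff (c : cech) : cech := fun G : {set 'I_n} =>
  \sum_(i in G) (-1) ^+ #|[set j in G | (j < i)%N]| *:
    loc_map 'X_i (xprod G) (c (G :\ i)).

Definition cech_supp (p : nat) (c : cech) : Prop :=
  forall F : {set 'I_n}, #|F| <> p -> c F = 0.

Lemma cech_diff_is_linear : linear cech_diff.
Proof.
move=> r c d; apply: dprodP => G; rewrite dprodDZE /cech_diff.
rewrite scaler_sumr -big_split; apply: eq_bigr => i iG /=.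
have xG : xprod G = xprod (G :\ i) * 'X_i.
  by rewrite /xprod mulrC (big_setD1 i).
have -> : loc_map 'X_i (xprod G) ((r *: c + d) (G :\ i)) =
    r *: loc_map 'X_i (xprod G) (c (G :\ i)) +
    loc_map 'X_i (xprod G) (d (G :\ i)).
  exact: (loc_map_is_linear xG).
by rewrite scalerDr (scalerA _ r) (scalerA r) [r * _]mulrC.
Qed.

Definition is_cocycle p (c : cech) : Prop :=
  cech_supp p c /\ cech_diff c = 0.

(* for p = 0 the support condition forces b = 0 *)
Definition is_coboundary p (c : cech) : Prop :=
  exists b : cech,
    (forall F : {set 'I_n}, #|F|.+1 <> p -> b F = 0) /\ c = cech_diff b.

HB.instance Definition _ :=
  GRing.isLinear.Build {mpoly k[n]} cech cech _ cech_diff cech_diff_is_linear.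

Lemma cocycle_closed p : submod_closed [pred c | `[< is_cocycle p c >]].
Proof.
split=> [|r c d]; first by apply/asboolP; split; [|rewrite linear0].
move=> /asboolP[sc dc] /asboolP[sd dd]; apply/asboolP; split.
  by move=> F Fp; rewrite dprodDZE sc // sd // scaler0 addr0.
by rewrite (cech_diff_is_linear r c d) dc dd scaler0 addr0.
Qed.

Lemma coboundary_closed p : submod_closed [pred c | `[< is_coboundary p c >]].
Proof.
split=> [|r c d].
  by apply/asboolP; exists 0; split; [|rewrite linear0].
move=> /asboolP[b [sb ->]] /asboolP[b' [sb' ->]]; apply/asboolP.
exists (r *: b + b'); split; last by rewrite (cech_diff_is_linear r b b').
by move=> F Fp; rewrite dprodDZE sb // sb' // scaler0 addr0.
Qed.

Definition cocycles p : submodule cech := Submodule (cocycle_closed p).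
Definition coboundaries p : submodule cech := Submodule (coboundary_closed p).

(* local cohomology H^p_m(M) at m = (x_1, ..., x_n), as Cech cohomology *)
Definition loc_cohomology p : lmodType {mpoly k[n]} :=
  subquot (cocycles p) (coboundaries p).

End CechComplex.

(* The dimension over k of a k-subspace V of an S-module, where k acts through
   constant polynomials (0 by convention if V has no finite basis). *)
Section VectorDimension.
Variables (k : fieldType) (n : nat) (N : lmodType {mpoly k[n]}).

Definition is_kbasis (V : set N) d (b : 'I_d -> N) : Prop :=
  [/\ forall t, V (b t),
      forall c : 'I_d -> k, \sum_t (c t)%:MP *: b t = 0 -> forall t, c t = 0
    & forall v, V v -> exists c : 'I_d -> k, v = \sum_t (c t)%:MP *: b t].

Definition kdim (V : set N) : nat :=
  xget 0%N [set d | exists b : 'I_d -> N, is_kbasis V b].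

End VectorDimension.

Record gradedModule (k : fieldType) (n : nat) := GradedModule {
  gr_mod :> lmodType {mpoly k[n]};
  gr_comp : int -> set gr_mod;
  gr_comp0 : forall j, gr_comp j 0;
  gr_compD : forall j x y, gr_comp j x -> gr_comp j y -> gr_comp j (x + y);
  gr_compZ : forall (e : nat) j (f : {mpoly k[n]}) x,
    f \is e.-homog -> gr_comp j x -> gr_comp (j + e%:Z) (f *: x);
  gr_decomp : forall x, exists (s : seq int) (c : int -> gr_mod),
    [/\ uniq s, forall j, gr_comp j (c j) & x = \sum_(j <- s) c j];
  gr_indep : forall (s : seq int) (c : int -> gr_mod), uniq s ->
    (forall j, gr_comp j (c j)) -> \sum_(j <- s) c j = 0 ->
    forall j, j \in s -> c j = 0 }.

Section GradedLocalCohomology.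
Variables (k : fieldType) (n : nat) (M : gradedModule k n).

(* x / x_F ^ a has degree deg x - a |F| *)
Definition cech_deg (j : int) (c : cech M) : Prop :=
  forall F : {set 'I_n}, exists x a,
    gr_comp (j + (a * #|F|)%:Z) x /\ c F = frac (xprod k F) x a.

Definition loc_cohomology_comp p (j : int) : set (loc_cohomology M p) :=
  [set u | exists z : submod (cocycles M p),
     cech_deg j (val z) /\
     u = \pi_(quotmod (restr_submod (cocycles M p) (coboundaries M p))) z].

End GradedLocalCohomology.

Section CohenMacaulay.
Variables (R : comNzRingType) (N : lmodType R).

Definition fin_gen : Prop :=
  exists r (g : 'I_r -> N), forall x, exists c : 'I_r -> R,
    x = \sum_i c i *: g i.

Definition annihilator : set R := [set f | forall x : N, f *: x = 0].

Definition prime_chain d (P : 'I_d.+1 -> prime_idealr R) : Prop :=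
  (forall i, annihilator `<=` [set f | f \in P i]) /\
  (forall i j : 'I_d.+1, (i < j)%N ->
     [set f | f \in P i] `<` [set f | f \in P j]).

(* Krull dimension of R / Ann N; the zero module has no dimension *)
Definition has_dim (d : nat) : Prop :=
  (exists P : 'I_d.+1 -> prime_idealr R, prime_chain P) /\
  (forall e (P : 'I_e.+1 -> prime_idealr R), prime_chain P -> (e <= d)%N).

(* the submodule (s) N *)
Definition seq_mul (s : seq R) : set N :=
  [set x | exists y : 'I_(size s) -> N, x = \sum_(i < size s) s`_i *: y i].

Definition regular_seq (s : seq R) : Prop :=
  (forall i, (i < size s)%N -> forall x : N,
     seq_mul (take i s) (s`_i *: x) -> seq_mul (take i s) x) /\
  (exists x : N, ~ seq_mul s x).

(* depth with respect to the ideal I: maximal length of a regular sequence *)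
Definition has_depth (I : set R) (d : nat) : Prop :=
  (exists s, [/\ size s = d, forall f, f \in s -> I f & regular_seq s]) /\
  (forall s, (forall f, f \in s -> I f) -> regular_seq s -> (size s <= d)%N).

End CohenMacaulay.

Definition max_ideal (k : fieldType) (n : nat) : set {mpoly k[n]} :=
  [set f | exists g : 'I_n -> {mpoly k[n]}, f = \sum_i g i * 'X_i].

(* For finitely generated graded modules; in particular the module is nonzero *)
Definition cohen_macaulay (k : fieldType) (n : nat) (N : lmodType {mpoly k[n]})
    : Prop :=
  exists d, has_dim N d /\ has_depth N (@max_ideal k n) d.

Definition dim_lt (R : comNzRingType) (N N' : lmodType R) : Prop :=
  exists d d', [/\ has_dim N d, has_dim N' d' & (d < d')%N].

Definition graded_submod (k : fieldType) (n : nat) (M : gradedModule k n)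
    (U : submodule M) : Prop :=
  forall x, x \in submod_pred U -> exists (s : seq int) (c : int -> M),
    [/\ uniq s, forall j, gr_comp j (c j) /\ c j \in submod_pred U
      & x = \sum_(j <- s) c j].

Definition seq_cohen_macaulay (k : fieldType) (n : nat) (M : gradedModule k n)
    : Prop :=
  exists r (U : nat -> submodule M),
    [/\ (forall x, x \in submod_pred (U 0%N) <-> x = 0) /\
          (forall x, x \in submod_pred (U r)),
        forall i, (i < r)%N -> {subset submod_pred (U i) <= submod_pred (U i.+1)},
        forall i, (i <= r)%N -> graded_submod (U i),
        forall i, (i < r)%N -> cohen_macaulay (subquot (U i.+1) (U i))
      & forall i, (i.+1 < r)%N ->
          dim_lt (subquot (U i.+1) (U i)) (subquot (U i.+2) (U i.+1))].

Fixpoint Delta (t : nat) (h : int -> rat) (j : int) : rat :=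
  if t is t'.+1 then Delta t' h j - Delta t' h (j + 1) else h j.

Notation cohomology_table n := ('I_n.+1 -> int -> rat).

Definition finite_table n (A : cohomology_table n) : Prop :=
  finite_set [set p : 'I_n.+1 * int | A p.1 p.2 <> 0].

Definition Delta_table (k : fieldType) (n : nat) (M : gradedModule k n)
    : cohomology_table n :=
  fun i j => Delta i (fun l => (kdim (@loc_cohomology_comp k n M i l))%:R) j.

Definition rat_cone n (X : set (cohomology_table n)) : set (cohomology_table n) :=
  [set A | exists r (q : 'I_r -> rat) (B : 'I_r -> cohomology_table n),
     [/\ forall t, 0 <= q t, forall t, X (B t)
       & forall i j, A i j = \sum_t q t * B t i j]].

Definition Cseq (k : fieldType) (n : nat) : set (cohomology_table n) :=
  rat_cone [set B | exists M : gradedModule k n,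
    [/\ fin_gen M, seq_cohen_macaulay M & B = Delta_table M]].

(* Main.v *)
Require Import Defs.
From HB Require Import structures.
From mathcomp Require Import all_boot all_order all_algebra.
From mathcomp Require Import zify ring.
From mathcomp Require Import classical_sets cardinality.

Set Implicit Arguments.
Unset Strict Implicit.
Unset Printing Implicit Defensive.

(* [frac] is to mean the fractions of a localization, not those of a field. *)
Import Defs.
Import Order.TTheory GRing.Theory Num.Theory.

Local Open Scope classical_set_scope.
Local Open Scope ring_scope.
Local Open Scope quotient_scope.

(** The idea.  Local cohomology is taken from the Cech complex, of which two
    properties are used: a power of each variable kills each class
    ([cech_torsion_var]), and short exact sequences of modules give long exact
    sequences ([middle_exact], [connecting_exact], [connecting_coboundary],
    [connecting_image]).  The latter are stated on cocycles, for graded pieces and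
    for the whole complex alike.

    Tables are non-negative.  Let [M] be filtered with Cohen-Macaulay quotients of
    increasing dimensions.  By the long exact sequence each cohomology module of
    [M] is that of a single quotient, or zero ([seq_cohen_macaulay_nonneg]).  So
    let [C] be Cohen-Macaulay of dimension [d].  The field being infinite, some
    linear form is a nonzerodivisor on [C] if [d > 0] ([linear_regular]).  Let [C']
    be the quotient of [C] by it.  Where the cohomology of [C'] vanishes one degree
    below, multiplication by the form is injective on that of [C], but it is also
    nilpotent on each class; hence by induction only [H^d(C)] survives, and

      [0 -> H^(d-1)(C')_(j+1) -> H^d(C)_j -> H^d(C)_(j+1) -> 0]

    is exact.  Thus one difference of the Hilbert function of [H^d(C)] is that of
    [H^(d-1)(C')], and after [d] steps the Hilbert function of a module of finite
    length appears ([cm_chain_cohomology]).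

    Such a chain of quotients is recorded by [cm_chain].  That it exists for a
    Cohen-Macaulay module ([cohen_macaulay_chain]) is shown without the general
    theory of depth and dimension.  A regular sequence of length [d], of arbitrary
    elements of the maximal ideal, makes [H^p] vanish for [p < d]
    ([regular_seq_vanishes]).  This vanishing descends to [C'] with [d - 1] for [d],
    and excludes a socle as long as [d > 0], which is what a linear nonzerodivisor
    needs.  Chains of primes grow by one when passing from [C'] back to [C]
    ([prime_chain_quotient]), so the module reached after [d] steps has none of
    length one; being graded, it is then killed by powers of the variables
    ([finite_length_torsion]).

    Every non-negative table occurs.  The polynomial ring in the first [i]
    variables, shifted, is Cohen-Macaulay, and dividing by its variables one by one
    is a chain ending in the residue field.  So its table has a single nonzero
    entry, which is [1], in row [i] and in a column governed by the shift
    ([unit_table]); non-negative finite tables are combinations of these.  The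
    dimension of the ring is bounded by Lombardi's elementary argument
    ([prime_chain_bound]), its depth by the nonvanishing of [H^i]. *)

(** * Noetherian modules *)

Section Span.
Variables (R : comNzRingType) (M : lmodType R).
Implicit Types (s : seq M) (U : set M).

Definition is_subm U : Prop :=
  U 0 /\ forall a x y, U x -> U y -> U (a *: x + y).

Fixpoint lspan s : set M :=
  if s is g :: s' then [set x | exists a, lspan s' (x - a *: g)] else [set 0].

Definition noetherian : Prop :=
  forall U, is_subm U -> exists s, (forall g, g \in s -> U g) /\ U `<=` lspan s.

Lemma submD U x y : is_subm U -> U x -> U y -> U (x + y).
Proof. by move=> [_ h] Ux Uy; rewrite -[x]scale1r; apply: h. Qed.

Lemma submZ U a x : is_subm U -> U x -> U (a *: x).
Proof. by move=> [h0 h] Ux; rewrite -[_ *: _]addr0; apply: h. Qed.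

Lemma submB U x y : is_subm U -> U x -> U y -> U (x - y).
Proof. by move=> hU Ux Uy; rewrite -scaleN1r; apply: submD => //; exact: submZ. Qed.

Lemma subm_sum U (I : Type) (r : seq I) (P : pred I) (F : I -> M) :
  is_subm U -> (forall i, P i -> U (F i)) -> U (\sum_(i <- r | P i) F i).
Proof.
by move=> hU h; apply: (big_ind U) => [|x y|//]; [case: hU | apply: submD].
Qed.

Lemma lspan_subm s : is_subm (lspan s).
Proof.
elim: s => [|g s IHs] /=; first by split=> // a x y /= -> ->; rewrite scaler0 addr0.
split=> [|a x y [b hb] [c hc]]; first by exists 0; rewrite scale0r subr0; case: IHs.
exists (a * b + c); have := IHs.2 a _ _ hb hc; congr (lspan s _).
by rewrite scalerBr scalerDl scalerA opprD addrACA.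
Qed.

Lemma sub_lspan U s : is_subm U -> (forall g, g \in s -> U g) -> lspan s `<=` U.
Proof.
move=> hU; elim: s => [|g s IHs] hs x /=; first by move=> ->; case: hU.
move=> [a ha]; rewrite -[x](subrK (a *: g)); apply: submD => //.
  by apply: IHs ha => h hh; apply: hs; rewrite inE hh orbT.
by apply: submZ => //; apply: hs; rewrite inE eqxx.
Qed.

Lemma mem_lspan s g : g \in s -> lspan s g.
Proof.
elim: s => // h s IHs; rewrite inE => /predU1P[->|/IHs hg] /=.
  by exists 1; rewrite scale1r subrr; case: (lspan_subm s).
by exists 0; rewrite scale0r subr0.
Qed.

Lemma lspan_ord r (g : 'I_r -> M) x :
  lspan [seq g i | i <- enum 'I_r] x -> exists c : 'I_r -> R, x = \sum_i c i *: g i.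
Proof.
move=> h; pose U : set M := [set x | exists c : 'I_r -> R, x = \sum_i c i *: g i].
suff /sub_lspan : is_subm U.
  apply; last exact: h; move=> _ /mapP[i _ ->]; exists (fun j => (j == i)%:R).
  rewrite (bigD1 i) //= eqxx scale1r big1 ?addr0 // => j /negbTE ->.
  by rewrite scale0r.
split=> [|a _ _ [b ->] [c ->]].
  by exists (fun=> 0); rewrite big1 // => i _; rewrite scale0r.
exists (fun i => a * b i + c i); rewrite scaler_sumr -big_split.
by apply: eq_bigr => i _ /=; rewrite scalerDl scalerA.
Qed.

(** The union of the spans of the initial segments is finitely generated, hence
    equal to one of them. The ascending chain condition is used in this form. *)
Lemma noetherian_seq (y : nat -> M) :
  noetherian -> exists m, lspan (mkseq y m) (y m).
Proof.
have mono a b : (a <= b)%N -> lspan (mkseq y a) `<=` lspan (mkseq y b).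
  move=> ab; apply: (sub_lspan (lspan_subm _)) => _ /mapP[i hi ->].
  apply: mem_lspan; apply: map_f.
  by move: hi; rewrite !mem_iota /= !add0n => /leq_trans; apply.
move=> hM; pose U : set M := [set x | exists m, lspan (mkseq y m) x].
have hU : is_subm U.
  split=> [|a x z [b hb] [c hc]]; first by exists 0%N.
  exists (maxn b c); apply: (lspan_subm _).2.
    exact: mono (leq_maxl _ _) _ hb.
  exact: mono (leq_maxr _ _) _ hc.
have [s [hs sU]] := hM U hU.
suff [m hm] : exists m, lspan s `<=` lspan (mkseq y m).
  exists m; apply/hm/sU; exists m.+1; apply/mem_lspan/map_f.
  by rewrite mem_iota /=.
have [m hm] : exists m, forall g, g \in s -> lspan (mkseq y m) g.
  elim: s hs {sU} => [|g s IHs] hs; first by exists 0%N.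
  have [|m hm] := IHs; first by move=> h hh; apply: hs; rewrite inE hh orbT.
  have [b hb] := hs g (mem_head _ _).
  exists (maxn b m) => h; rewrite inE => /predU1P[->|/hm].
    exact: mono (leq_maxl _ _) _ hb.
  exact: mono (leq_maxr _ _) _.
by exists m; apply: sub_lspan hm; apply: lspan_subm.
Qed.

(** By dependent choice: a family without maximal member would contain a
    strictly increasing sequence. *)
Lemma noetherian_max (T : Type) (Q : set T) (F : T -> set M) (t0 : T) :
    noetherian -> (forall t, Q t -> is_subm (F t)) -> Q t0 ->
  exists t, Q t /\ forall t', Q t' -> F t `<=` F t' -> F t' `<=` F t.
Proof.
move=> hM hF Q0; apply: contrapT => hn.
have step (u : {t | Q t}) : exists v : {t | Q t},
    F (sval u) `<=` F (sval v) /\ exists x, F (sval v) x /\ ~ F (sval u) x.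
  case: u => t Qt /=; apply: contrapT => hu; apply: hn; exists t; split=> //.
  move=> t' Qt' tt' x hx; apply: contrapT => nx; apply: hu.
  by exists (exist _ t' Qt') => /=; split=> //; exists x.
have [nxt hnxt] := choice step.
pose u := fix u m := if m is m'.+1 then nxt (u m') else exist _ t0 Q0.
have [y hy] := choice (fun m => (hnxt (u m)).2).
have [m hm] := noetherian_seq y hM.
apply: (hy m).2; apply: (sub_lspan _ _) hm => [|_ /mapP[i + ->]].
  exact: hF (svalP (u m)).
rewrite mem_iota add0n => /= im.
have mono a b : (a <= b)%N -> F (sval (u a)) `<=` F (sval (u b)).
  move=> ab; rewrite -(subnK ab); elim: (b - a)%N => // c IHc.
  by apply: subset_trans IHc _; have [] := hnxt (u (c + a)%N).
exact: mono im _ (hy i).1.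
Qed.

End Span.

Section FinGenNoetherian.
Variables (R : comNzRingType).
Hypothesis noethR : noetherian R^o.

(** Induction on the number of generators: the leading coefficients at the
    first generator form an ideal. *)
Lemma noetherian_span (M : lmodType R) (s : seq M) (U : set M) :
  is_subm U -> U `<=` lspan s ->
  exists t, (forall g, g \in t -> U g) /\ U `<=` lspan t.
Proof.
move=> hU; elim: s U hU => [|g s IHs] U hU Us.
  by exists [::]; split.
(* The coefficients at [g] of elements of [U]. *)
pose I : set R^o := [set a | exists2 u, U u & lspan s (u - a *: g)].
have hI : is_subm I.
  split; first by exists 0; [case: hU | rewrite scale0r subr0; case: (lspan_subm s)].
  move=> a x y [u Uu hu] [v Uv hv]; exists (a *: u + v); first exact: hU.2.
  have := (lspan_subm s).2 a _ _ hu hv; congr (lspan s _).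
  by rewrite scalerBr scalerDl opprD addrACA scalerA.
have [sI [hsI Is]] := noethR hI.
pose U' : set M := U `&` lspan s.
have hU' : is_subm U'.
  split; first by split; [case: hU | case: (lspan_subm s)].
  by move=> a x y [? ?] [? ?]; split; [apply: hU.2 | apply: (lspan_subm s).2].
have [t' [ht' U't']] := IHs U' hU' (fun x => @proj2 _ _).
have [t'' [ht'' t''P]] : exists t, (forall h, h \in t -> U h) /\
    forall a, lspan sI a -> exists2 u, lspan t u & lspan s (u - a *: g).
  elim: sI hsI {Is} => [|b sI IH] hb.
    exists [::]; split=> // a ->; exists 0 => //.
    by rewrite scale0r subr0; case: (lspan_subm s).
  have [|t [ht tP]] := IH; first by move=> h hh; apply: hb; rewrite inE hh orbT.
  have [u Uu hu] := hb b (mem_head _ _).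
  exists (u :: t); split=> [h|a [c /tP[v hv hv']]].
    by rewrite inE => /predU1P[->|/ht].
  exists (v + c *: u); first by exists c; rewrite addrK.
  have := (lspan_subm s).2 c _ _ hu hv'; congr (lspan s _).
  by rewrite scalerBr scalerA scalerBl opprB addrCA -addrA addKr addrA.
exists (t'' ++ t'); split=> [h|x Ux].
  by rewrite mem_cat => /orP[/ht''|/ht' []].
have [a ha] := Us _ Ux.
have [|u hu hu'] := t''P a; first by apply: Is; exists x.
have cat1 h : h \in t'' -> lspan (t'' ++ t') h.
  by move=> ht; apply: mem_lspan; rewrite mem_cat ht.
have cat2 h : h \in t' -> lspan (t'' ++ t') h.
  by move=> ht; apply: mem_lspan; rewrite mem_cat ht orbT.
rewrite -[x](subrK u); apply: submD (lspan_subm _) _ _.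
  apply: (sub_lspan (lspan_subm _) cat2); apply: U't'; split.
    by apply: submB => //; apply: sub_lspan ht'' _ hu.
  have := submB (lspan_subm s) ha hu'; congr (lspan s _).
  by rewrite opprB addrA subrK.
exact: (sub_lspan (lspan_subm _) cat1).
Qed.

Lemma fin_gen_noetherian (M : lmodType R) : fin_gen M -> noetherian M.
Proof.
move=> [r [g hg]] U hU.
apply: (@noetherian_span M [seq g i | i <- enum 'I_r]) => // x _.
have [c ->] := hg x; apply: subm_sum (lspan_subm _) _ => i _.
by apply: submZ (lspan_subm _) _; apply/mem_lspan/map_f; rewrite mem_enum.
Qed.

End FinGenNoetherian.

Lemma noetherian_fin_gen (R : comNzRingType) (M : lmodType R) :
  noetherian M -> fin_gen M.
Proof.
move=> hM; have [|s [_ hs]] := hM setT; first by split.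
exists (size s), (tnth (in_tuple s)) => x; apply: lspan_ord.
have := hs x I; congr (lspan _ x); apply: (@eq_from_nth _ 0).
  by rewrite size_map size_enum_ord.
move=> i hi; rewrite (nth_map (Ordinal hi)) ?size_enum_ord //.
by rewrite (tnth_nth 0) /= nth_enum_ord.
Qed.

Section NoetherianMorphism.
Variables (R : comNzRingType) (M N : lmodType R) (f : {linear M -> N}).

Lemma noetherian_surj : (forall y, exists x, y = f x) -> noetherian M -> noetherian N.
Proof.
move=> fs hM U hU; pose V : set M := [set x | U (f x)].
have [|s [sV Vs]] := hM V.
  split=> [|a x y Vx Vy]; first by rewrite /V /= linear0; case: hU.
  by rewrite /V /= linearP; apply: hU.2.
exists (map f s); split=> [_ /mapP[x /sV hx ->] //|y].
have [x -> /Vs] := fs y; elim: s x {sV Vs} => [|g s IHs] x /=.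
  by move=> ->; rewrite linear0.
by move=> [a /IHs]; rewrite linearB linearZ; exists a.
Qed.

Lemma noetherian_inj : injective f -> noetherian N -> noetherian M.
Proof.
move=> fi hN U hU; pose V : set N := f @` U.
(* Generators of the image lift, because they lie in it. *)
have [|s [sV Vs]] := hN V.
  split=> [|a _ _ [x Ux <-] [y Uy <-]].
    by exists 0; [case: hU | rewrite linear0].
  by exists (a *: x + y); [apply: hU.2 | rewrite linearP].
have [t [tU tP]] : exists t, (forall g, g \in t -> U g) /\
    forall x, lspan s (f x) -> lspan t x.
  elim: s sV {Vs} => [|h s IHs] sV.
    by exists [::]; split=> // x /= hx; apply: fi; rewrite hx linear0.
  have [|t [tU tP]] := IHs; first by move=> g hg; apply: sV; rewrite inE hg orbT.
  have [g Ug gh] := sV h (mem_head _ _).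
  exists (g :: t); split=> [e|x [a ha]].
    by rewrite inE => /predU1P[->|/tU].
  by exists a; apply: tP; rewrite linearB linearZ /= gh.
by exists t; split=> // x Ux; apply/tP/Vs; exists x.
Qed.

End NoetherianMorphism.

(** * Hilbert's basis theorem *)

(** Take repeatedly an index, beyond the previous one, where [g] is minimal
    among all later indices. *)
Lemma nat_monotone_subseq (g : nat -> nat) : exists f : nat -> nat,
  (forall i j, (i < j)%N -> (f i < f j)%N) /\
  (forall i j, (i <= j)%N -> (g (f i) <= g (f j))%N).
Proof.
have minP N : exists i, (N <= i)%N /\ forall j, (N <= j)%N -> (g i <= g j)%N.
  have ex : exists v, `[< exists2 i, (N <= i)%N & g i = v >].
    by exists (g N); apply/asboolP; exists N.
  have [v /asboolP[i Ni gi] vmin] := find_ex_minn ex; exists i; split=> // j Nj.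
  by rewrite gi; apply: vmin; apply/asboolP; exists j.
have [m hm] := choice minP.
pose f := fix f i := if i is i'.+1 then m (f i').+1 else m 0%N.
have fS i : (f i < f i.+1)%N by have [] := hm (f i).+1.
exists f; split=> [i j|i j].
  by elim: j => // j IHj; rewrite ltnS leq_eqVlt => /predU1P[->//|/IHj/ltn_trans]; apply.
have fP i' : forall l, (f i' <= l)%N -> (g (f i') <= g l)%N.
  case: i' => [|i'] l hl /=; first by apply: (hm 0%N).2.
  by apply: (hm (f i').+1).2; apply: leq_trans hl; apply: (hm (f i').+1).1.
move=> ij; apply: fP; rewrite -(subnK ij); elim: (j - i)%N => // c IHc.
by apply: leq_trans IHc (ltnW (fS _)).
Qed.

(** Dickson's lemma, by passing to a monotone subsequence one coordinate at a
    time. *)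
Lemma dickson n (f : nat -> 'X_{1..n}) :
  exists i j, (i < j)%N /\ (f i <= f j)%MM.
Proof.
suff /(_ n (leqnn n))[h [hi hm]] : forall r, (r <= n)%N -> exists h : nat -> nat,
    (forall i j, (i < j)%N -> (h i < h j)%N) /\
    forall c : 'I_n, (c < r)%N ->
      forall i j, (i <= j)%N -> (f (h i) c <= f (h j) c)%N.
  exists (h 0%N), (h 1%N); split; first exact: hi.
  by apply/mnm_lepP => c; apply: hm.
elim=> [|r IHr] rn; first by exists id.
have [h [hi hm]] := IHr (ltnW rn).
have [e [ei em]] := nat_monotone_subseq (fun i => f (h i) (Ordinal rn)).
exists (h \o e); split=> [i j ij /=|c cr i j ij /=]; first exact/hi/ei.
move: cr; rewrite ltnS leq_eqVlt => /predU1P[cr|cr].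
  by have -> : c = Ordinal rn by [apply: val_inj]; apply: em.
apply: hm => //; rewrite -(subnK ij); elim: (j - i)%N => // l IHl.
by apply: leq_trans IHl (ltnW (ei _ _ _)).
Qed.

Section Hilbert.
Variables (k : fieldType) (n : nat).
Local Notation S := {mpoly k[n]}.

(** If an ideal were not finitely generated, one could keep choosing in it an
    element of smallest leading monomial outside the lspan of the previous ones;
    by Dickson's lemma one of these leading monomials divides a later one, and
    cancelling it contradicts minimality. *)
Lemma mpoly_noetherian : noetherian (S^o : lmodType S).
Proof.
move=> I hI; apply: contrapT => hn.
have step (s : seq S^o) : exists f : S^o, (forall g, g \in s -> I g) ->
    [/\ I f, ~ lspan s f & forall g : S^o, I g -> ~ lspan s g -> (mlead f <= mlead g)%O].
  have [hs|hs] := pselect (forall g, g \in s -> I g); last by exists 0.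
  have [f0 If0 hf0] : exists2 f : S^o, I f & ~ lspan s f.
    apply: contrapT => h; apply: hn; exists s; split=> // f If.
    by apply: contrapT => nf; apply: h; exists f.
  elim/(@mleadrect n k): f0 If0 hf0 => f IH If hf.
  have [[g [Ig hg lt]]|h] := pselect (exists g : S^o,
      [/\ I g, ~ lspan s g & (mlead g < mlead f)%O]); first exact: (IH g).
  exists f => _; split=> // g Ig hg; rewrite leNgt; apply/negP => lt.
  by apply: h; exists g.
have [nxt hnxt] := choice step.
pose u := fix u m := if m is m'.+1 then rcons (u m') (nxt (u m')) else [::].
have uI m g : g \in u m -> I g.
  elim: m g => //= m IHm g; rewrite mem_rcons inE => /predU1P[->|/IHm//].
  by have [] := hnxt (u m) IHm.
pose f m := nxt (u m).
have fP m := hnxt (u m) (uI m).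
have fu i j : (i < j)%N -> f i \in u j.
  elim: j => // j IHj; rewrite ltnS leq_eqVlt /= mem_rcons inE => /predU1P[->|/IHj ->].
    by rewrite eqxx.
  by rewrite orbT.
have f0 m : f m != 0.
  by apply/eqP => h; case: (fP m) => _ + _; rewrite -/(f m) h; case; case: (lspan_subm (u m)).
have [i [j [ij le]]] := dickson (fun m => mlead (f m)).
have [If nf fmin] := fP j; rewrite -/(f j) in If nf fmin.
(* The monomial multiple of [f i] with the leading term of [f j]. *)
pose a : S := ((f j)@_(mlead (f j)) / (f i)@_(mlead (f i))) *: 'X_[mlead (f j) - mlead (f i)].
pose g : S^o := f j - a * f i.
have sp : lspan (u j) (a *: f i) by apply: submZ (lspan_subm _) _; exact/mem_lspan/fu.
have ng : ~ lspan (u j) g.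
  move=> h; apply: nf; rewrite -[f j](subrK (a *: f i)).
  by apply: submD (lspan_subm _) h sp.
have Ig : I g by apply: submB => //; apply: submZ => //; apply: (uI j); exact: fu.
have g0 : g != 0 by apply/eqP => h; apply: ng; rewrite h; case: (lspan_subm (u j)).
have ai : mlead (a * f i) = mlead (f j).
  rewrite /a -scalerAl mleadZ; last by rewrite mulf_neq0 ?invr_eq0 // mleadc_eq0.
  rewrite mleadM ?f0 // ?mleadXm ?submK // -mleadc_eq0 mleadXm mcoeffX eqxx.
  exact: oner_neq0.
have le1 : (mlead g <= mlead (f j))%O.
  by apply: le_trans (mleadB_le _ _) _; rewrite ai joinxx.
have c0 : g@_(mlead (f j)) = 0.
  have e : ('X_[mlead (f j) - mlead (f i)] * f i : S)@_(mlead (f j)) = (f i)@_(mlead (f i)).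
    rewrite mulrC -[X in _ = X](mcoeffMX _ (mlead (f j) - mlead (f i))).
    by rewrite (submK le).
  by rewrite mcoeffB /a -scalerAl mcoeffZ e divrK ?unitfE ?mleadc_eq0 // subrr.
have := fmin g Ig ng; rewrite leNgt => /negP; apply.
rewrite lt_neqAle le1 andbT; apply/eqP => e.
by move: g0; rewrite -mleadc_eq0 e c0 eqxx.
Qed.

End Hilbert.

(** * Prime ideals *)

(** Packages a set with the properties of a prime ideal as a structure, the sets
    at hand being given by arbitrary propositions. *)
Lemma prime_ideal_of (R : comNzRingType) (U : set R) :
    is_subm (U : set R^o) -> ~ U 1 -> (forall u v, U (u * v) -> U u \/ U v) ->
  exists P : prime_idealr R, forall x, (x \in P) <-> U x.
Proof.
move=> hU h1 hp; pose S : R -> bool := fun x => `[< U x >].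
have c1 : idealr_closed S.
  split=> [||a x y]; rewrite !unfold_in /S; first by apply/asboolP; case: hU.
    by apply/negP => /asboolP.
  by move=> /asboolP Ux /asboolP Uy; apply/asboolP; apply: (hU.2 a x y).
have c2 : prime_idealr_closed S.
  by move=> u v /asboolP /hp[h|h]; apply/orP; [left|right]; apply/asboolP.
pose c1' := isIdealr.Build R S c1.
pose c2' := isPrimeIdealrClosed.Build R S c2.
pose P : prime_idealr R := HB.pack S c1' c2'.
by exists P => x; split=> /asboolP.
Qed.

(** An ideal maximal among those avoiding a multiplicative set is prime. *)
Lemma prime_avoiding (R : comNzRingType) (I T : set R) :
    noetherian R^o -> is_subm (I : set R^o) ->
    T 1 -> (forall x y, T x -> T y -> T (x * y)) -> (forall x, I x -> ~ T x) ->
  exists P : prime_idealr R, (forall x, I x -> x \in P) /\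
    (forall x, x \in P -> ~ T x).
Proof.
move=> hR hI T1 TM IT.
pose Q (U : set R^o) := [/\ is_subm U, I `<=` U & forall x, U x -> ~ T x].
have [||U [[hU IU UT] Umax]] := @noetherian_max _ R^o (set R^o) Q id I hR.
- by move=> U [].
- by split.
(* By maximality, enlarging [U] by an element outside makes it meet [T]. *)
have cov u : ~ U u -> exists a p, U p /\ T (p + a * u).
  move=> nu; pose V : set R^o := [set x | exists2 a, exists2 p, U p & x = p + a * u & True].
  have hV : is_subm V.
    split; first by exists 0 => //; exists 0; [case: hU | rewrite mul0r addr0].
    move=> c _ _ [a [p Up ->] _] [b [q Uq ->] _]; exists (c * a + b) => //.
    by exists (c *: p + q); [apply: hU.2 | rewrite /GRing.scale /=; ring].
  have UV : U `<=` V by move=> x Ux; exists 0 => //; exists x; rewrite // mul0r addr0.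
  apply: contrapT => h; apply: nu; apply: (Umax V); last 1 first.
  - by exists 1 => //; exists 0; [case: hU | rewrite mul1r add0r].
  - split=> //; first exact: subset_trans IU UV.
    by move=> x [a [p Up ->] _] Tx; apply: h; exists a, p.
  - exact: UV.
have [|u v Uuv|P hP] := prime_ideal_of hU.
- by move=> U1; apply: (UT 1).
- have [?|nu] := pselect (U u); first by left.
  have [?|nv] := pselect (U v); first by right.
  have [a [p [Up Tp]]] := cov u nu; have [b [q [Uq Tq]]] := cov v nv.
  case: (UT _ _ (TM _ _ Tp Tq)).
  have -> : (p + a * u) * (q + b * v) = (q + b * v) * p + (a * u) * q + (a * b) * (u * v).
    ring.
  apply: submD => //; last exact: (submZ (a * b) hU Uuv).
  apply: submD => //; first exact: (submZ _ hU Up).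
  exact: (submZ _ hU Uq).
by exists P; split=> x; [move/IU/hP | move/hP/UT].
Qed.

(** * Linear nonzerodivisors over an infinite field *)

Section LinearRegular.
Variables (k : fieldType) (n : nat) (C : lmodType {mpoly k[n]}).
Local Notation S := {mpoly k[n]}.

Definition linform (a : 'I_n -> k) : S := \sum_i (a i)%:MP * 'X_i.

Definition moment (t : k) : S := linform (fun i => t ^+ i).

(** By Vandermonde, [n] distinct points of the moment curve are linearly
    independent, so that their linear forms span all variables. *)
Lemma moment_span (y : C) (s : seq k) : uniq s -> size s = n ->
  (forall t, t \in s -> moment t *: y = 0) -> forall i, 'X_i *: y = 0.
Proof.
move=> us ss hy i; pose a : 'rV[k]_n := \row_(j < n) s`_j.
have detV : Vandermonde n a \in unitmx.
  rewrite unitmxE det_Vandermonde unitfE; apply/prodf_neq0 => j _.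
  apply/prodf_neq0 => l lt; rewrite !mxE subr_eq0 nth_uniq ?ss //.
  by rewrite eq_sym neq_ltn lt.
pose B := invmx (Vandermonde n a).
have -> : 'X_i = \sum_j (B j i)%:MP * moment (s`_j) :> S.
  have e (l : 'I_n) : \sum_j B j i * s`_j ^+ l = (l == i)%:R :> k.
    have /matrixP/(_ l i) := mulmxV detV; rewrite !mxE => <-.
    by apply: eq_bigr => j _; rewrite !mxE mulrC.
  transitivity (\sum_(l < n) (\sum_j B j i * s`_j ^+ l)%:MP * 'X_l : S).
    rewrite (bigD1 i) //= e eqxx mul1r big1 ?addr0 // => l /negbTE li.
    by rewrite e li mul0r.
  under eq_bigr do rewrite rmorph_sum mulr_suml; rewrite exchange_big /=.
  apply: eq_bigr => j _; rewrite /moment /linform mulr_sumr.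
  by apply: eq_bigr => l _; rewrite rmorphM /= mulrA.
rewrite scaler_suml big1 // => j _; rewrite -scalerA hy ?scaler0 //.
by rewrite mem_nth // ss.
Qed.

(** If every form on the moment curve kills a nonzero element, choose for each
    form such an element with maximal, hence prime, annihilator. A nonzero
    element is killed by fewer than [n] of the forms, so one finds a sequence of
    these elements such that no form belonging to one kills an earlier one. By
    maximality, no annihilator is then contained in a later one, and as the
    later one is prime, a product separates an element from all its
    predecessors. So no element is in the span of its predecessors, against the
    chain condition. *)
Lemma linear_regular : infinite_set [set: k] -> noetherian C ->
    (exists x : C, x != 0) ->
    (forall x : C, (forall i, 'X_i *: x = 0) -> x = 0) ->
  exists a, forall x : C, linform a *: x = 0 -> x = 0.
Proof.
move=> hk hC [x0 x0n0] soc; apply: contrapT => hn.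
have bad t : exists2 x : C, x != 0 & moment t *: x = 0.
  apply: contrapT => h; apply: hn; exists (fun i => t ^+ i) => x hx.
  by apply: contrapT => /eqP nx; apply: h; exists x.
pose ann (x : C) : set S^o := [set f : S | f *: x = 0].
have ann_subm x : is_subm (ann x).
  split; first by rewrite /ann /= scale0r.
  move=> a f g; rewrite /ann /= => hf hg.
  by rewrite scalerDl -scalerA hf hg scaler0 addr0.
have bad' t : exists x : C, [/\ x != 0, moment t *: x = 0,
    forall f g : S, (f * g) *: x = 0 -> f *: x = 0 \/ g *: x = 0 &
    forall z : C, z != 0 -> moment t *: z = 0 -> ann x `<=` ann z -> ann z `<=` ann x].
  have [x xn hx] := bad t.
  have [||y [[yn hy] ymax]] := @noetherian_max _ S^o C
      [set x | x != 0 /\ moment t *: x = 0] ann x (@mpoly_noetherian k n).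
  - by move=> ? _.
  - by split.
  exists y; split=> // [f g fg|z zn hz]; last by apply: ymax.
  have [gy|/eqP gy] := pselect (g *: y = 0); first by right.
  left; apply: (ymax (g *: y)).
  - by split=> //; rewrite scalerA mulrC -scalerA hy scaler0.
  - by move=> h hh; rewrite /ann /= scalerA mulrC -scalerA hh scaler0.
  - by rewrite /ann /= scalerA.
have [y hy] := choice bad'.
(* Each [y u] excludes fewer than [n] parameters. *)
have few (s : seq k) : exists t, forall u, u \in s -> moment t *: y u != 0.
  apply: contrapT => h.
  have {}h t : exists2 u, u \in s & moment t *: y u = 0.
    apply: contrapT => h'; apply: h; exists t => u us; apply/eqP => e; apply: h'.
    by exists u.
  have {}h t : exists u, u \in s /\ moment t *: y u = 0.
    by have [u us hu] := h t; exists u.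
  have [f hf] := choice h.
  have fib u : (forall r : seq k, uniq r -> (forall t, t \in r -> f t = u) -> (size r < n)%N).
    move=> r ur hr; rewrite ltnNge; apply/negP => nr.
    have [yn _ _ _] := hy u; move/eqP: yn; apply; apply: soc.
    apply: (@moment_span (y u) (take n r)).
    - exact: take_uniq.
    - by rewrite size_takel.
    - by move=> t /mem_take /hr <-; case: (hf t).
  have big (r : seq k) : uniq r -> (size r <= size s * n)%N.
    move=> ur; have -> : size r = (\sum_(u <- undup s) count (fun t => f t == u) r)%N.
      under eq_bigr do rewrite -sum1_count big_mkcond.
      rewrite exchange_big /= -sum1_size; apply: eq_bigr => t _.
      have ft : f t \in undup s by rewrite mem_undup; case: (hf t).
      rewrite (bigD1_seq (f t)) ?undup_uniq //= eqxx big1 // => u /negbTE.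
      by rewrite eq_sym => ->.
    apply: (@leq_trans (\sum_(u <- undup s) n)%N).
      apply: leq_sum => u _; rewrite -size_filter; apply/ltnW/(fib u).
        exact: filter_uniq.
      by move=> t; rewrite mem_filter => /andP[/eqP].
    by rewrite big_const_seq count_predT iter_addn_0 mulnC leq_mul2r size_undup orbT.
  have grow m : exists2 r : seq k, uniq r & size r = m.
    elim: m => [|m [r ur sr]]; first by exists [::].
    have [t nt] : exists t, t \notin r.
      apply: contrapT => hh; apply: hk; apply: sub_finite_set (finite_seq r).
      by move=> t _ /=; apply: contrapT => /negP nt; apply: hh; exists t.
    by exists (t :: r); rewrite /= ?nt // sr.
  by have [r /big + sr] := grow (size s * n).+1; rewrite sr ltnn.
have [nxt hnxt] := choice few.
pose u := fix u m := if m is m'.+1 then rcons (u m') (nxt (u m')) else [::].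
pose t m := nxt (u m).
have tu i j : (i < j)%N -> t i \in u j.
  elim: j => // j IHj; rewrite ltnS leq_eqVlt /= mem_rcons inE => /predU1P[->|/IHj ->].
    by rewrite eqxx.
  by rewrite orbT.
have [m] := noetherian_seq (y \o t) hC.
have [ynm hm ypr _] := hy (t m) => sp.
(* Otherwise the annihilator of [y (t i)] would equal the larger one of [y (t
   m)], by maximality, but the form of [t m] is only in the latter. *)
have sep i : (i < m)%N -> exists g : S, g *: y (t i) = 0 /\ g *: y (t m) <> 0.
  move=> im; apply: contrapT => h; have [_ hi _ ymax] := hy (t i).
  have sub : ann (y (t i)) `<=` ann (y (t m)).
    by move=> g hg; apply: contrapT => ng; apply: h; exists g.
  have := ymax _ ynm (sub _ hi) sub (moment (t m)) hm; rewrite /ann /= => /eqP.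
  by apply/negP/(hnxt (u m))/tu.
have {}sep i : exists g : S, (i < m)%N -> g *: y (t i) = 0 /\ g *: y (t m) <> 0.
  by case: (boolP (i < m)%N) => [/sep[g hg]|_]; [exists g | exists 0].
have [g hg] := choice sep.
have : (\prod_(i < m) g i) *: y (t m) <> 0.
  apply: (big_ind (fun f : S => f *: y (t m) <> 0)) => [|f h nf nh|i _].
  - by rewrite scale1r; apply/eqP.
  - by case/ypr.
  - by have [] := hg i (ltn_ord i).
apply; pose U : set C := [set x | (\prod_(i < m) g i) *: x = 0].
suff UP : lspan (mkseq (y \o t) m) `<=` U by exact: (UP _ sp).
apply: sub_lspan => [|_ /mapP[i + ->]].
  split; first by rewrite /U /= scaler0.
  move=> a x z; rewrite /U /= => hx hz.
  by rewrite scalerDr scalerA mulrC -scalerA hx hz scaler0 addr0.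
rewrite mem_iota => /= im; rewrite /U /=.
rewrite (bigD1 (Ordinal im)) //= mulrC -scalerA.
by have [-> _] := hg i im; rewrite scaler0.
Qed.

End LinearRegular.

(** * The Cech complex *)

Section LinearSum.
Variables (R : comNzRingType) (M N : lmodType R) (f : M -> N).
Hypothesis fl : linear f.

Lemma lin_D x y : f (x + y) = f x + f y.
Proof. by rewrite -{1}[x]scale1r fl scale1r. Qed.

Lemma lin_0 : f 0 = 0.
Proof. by apply: (@addrI _ (f 0)); rewrite -lin_D !addr0. Qed.

Lemma lin_Z a x : f (a *: x) = a *: f x.
Proof. by rewrite -[_ *: x]addr0 fl lin_0 addr0. Qed.

Lemma lin_sum (I : Type) (r : seq I) (P : pred I) (F : I -> M) :
  f (\sum_(i <- r | P i) F i) = \sum_(i <- r | P i) f (F i).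
Proof. by apply: (big_morph f lin_D lin_0). Qed.

End LinearSum.

Section LocFun.
Variables (R : comNzRingType) (M N : lmodType R) (h : R) (f : {linear M -> N}).

Definition loc_fun (u : loc M h) : loc N h := frac h (f (loc_num u)) (loc_exp u).

Lemma loc_funE x a : loc_fun (frac h x a) = frac h (f x) a.
Proof.
have [t e] := loc_numP h x a; apply/fracP; exists t.
by rewrite -(linearZZ f) e (linearZZ f).
Qed.

Lemma loc_fun_is_linear : linear loc_fun.
Proof.
move=> r; elim/locW=> x a; elim/locW=> y b.
rewrite fracZ fracD !loc_funE fracZ fracD; apply/fracP; exists 0%N.
by rewrite linearD !(linearZZ f).
Qed.

Lemma frac_eq0 (x : M) a : frac h x a = 0 <-> exists t, h ^+ t *: x = 0.
Proof.
have -> : (0 : loc M h) = frac h 0 0 by [].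
split=> [/fracP[t]|[t e]]; rewrite ?addn0 ?scaler0; first by exists t.
by apply/fracP; exists t; rewrite addn0 e scaler0.
Qed.

Lemma frac_shift t (x : M) a : frac h (h ^+ t *: x) (t + a) = frac h x a.
Proof. by apply/fracP; exists 0%N; rewrite !add0n loc_expZ addnC. Qed.

Lemma loc_fun_inj : injective f -> injective loc_fun.
Proof.
move=> fi; elim/locW=> x a; elim/locW=> y b; rewrite !loc_funE => /fracP[t].
by rewrite -!(linearZZ f) => /fi e; apply/fracP; exists t.
Qed.
End LocFun.

Section Diff.
Variables (k : fieldType) (n : nat) (M : lmodType {mpoly k[n]}).
Local Notation S := {mpoly k[n]}.
Implicit Types (F G : {set 'I_n}) (c b : cech M) (i l : 'I_n).

Lemma xprodD1 G i : i \in G -> xprod k G = xprod k (G :\ i) * 'X_i.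
Proof. by move=> iG; rewrite /xprod mulrC (big_setD1 i). Qed.

Lemma res_linear G i : i \in G ->
  linear (loc_map 'X_i (xprod k G) : loc M (xprod k (G :\ i)) -> _).
Proof. by move=> iG; apply/loc_map_is_linear/xprodD1. Qed.

Lemma loc_map_comp (f g g' h h' : S) (u : loc M f) :
  h = f * g -> h' = h * g' -> loc_map g' h' (loc_map g h u) = loc_map (g * g') h' u.
Proof.
move=> e e'; have e'' : h' = f * (g * g') by rewrite e' e mulrA.
elim/locW: u => x a; rewrite (loc_mapE e) (loc_mapE e') (loc_mapE e'').
by rewrite scalerA exprMn mulrC.
Qed.

Definition csign i G : S := (-1) ^+ #|[set j in G | (j < i)%N]|.

Lemma csign_D1 i l G : i \in G -> (i < l)%N -> csign l G = - csign l (G :\ i).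
Proof.
move=> iG il; rewrite /csign (cardsD1 i) !inE iG il /= exprS mulN1r.
by congr (- _ ^+ #|pred_of_set _|); apply/setP => j; rewrite !inE andbA.
Qed.

Lemma csign_D1' i l G : (l <= i)%N -> csign l G = csign l (G :\ i).
Proof.
move=> li; congr (_ ^+ #|pred_of_set _|); apply/setP => j; rewrite !inE.
case: eqVneq => [->|//] /=; rewrite ltnNge li andbF //.
Qed.

Lemma csign2 i l G : i \in G -> l \in G -> i != l ->
  csign i G * csign l (G :\ i) = - (csign l G * csign i (G :\ l)).
Proof.
move=> iG lG; rewrite neq_ltn => /orP[il|li].
  by rewrite (csign_D1 iG il) mulNr opprK (csign_D1' _ (ltnW il)) mulrC.
by rewrite (csign_D1 lG li) mulNr (csign_D1' G (ltnW li)) mulrC.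
Qed.

Lemma cechZE r c F : (r *: c) F = r *: c F.
Proof. by []. Qed.

(** The terms for the two orders of adjoining a pair of indices cancel. They are
    paired explicitly, since an involution without fixed points would not
    suffice in characteristic two. *)
Lemma cech_diffK c : cech_diff (cech_diff c) = 0.
Proof.
apply: dprodP => G; rewrite {1}/cech_diff.
pose T i l := (csign i G * csign l (G :\ i)) *:
  loc_map ('X_l * 'X_i) (xprod k G) (c (G :\ i :\ l)).
have TN i l : i \in G -> l \in G -> i != l -> T i l = - T l i.
  move=> iG lG il; rewrite /T csign2 // scaleNr; congr (- (_ *: _)).
  by rewrite [X in loc_map X]mulrC !finset.setDDl [[set i]%SET :|: _]finset.setUC.
transitivity (\sum_(i in G) \sum_(l in G :\ i) T i l).
  apply: eq_bigr => i iG; rewrite /cech_diff (lin_sum (res_linear iG)) scaler_sumr.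
  apply: eq_bigr => l lG; rewrite (lin_Z (res_linear iG)) scalerA; congr (_ *: _).
  by apply: loc_map_comp; apply: xprodD1.
have -> : \sum_(i in G) \sum_(l in G :\ i) T i l =
   \sum_(i in G) \sum_(l in G | (i < l)%N) T i l
   + \sum_(i in G) \sum_(l in G | (l < i)%N) T i l.
  rewrite -big_split; apply: eq_bigr => i iG /=.
  rewrite (bigID (fun l : 'I_n => (i < l)%N)) /=; congr (_ + _); apply: eq_bigl => l.
    rewrite !inE; case il: (i < l)%N; rewrite ?andbF // !andbT.
    by have -> : l != i by rewrite neq_ltn il orbT.
  by rewrite !inE -leqNgt (ltn_neqAle l i) andbA [(l \in G) && _]andbC.
rewrite [X in _ + X](exchange_big_dep (fun i : 'I_n => i \in G)) /=; last by move=> i l _ /andP[].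
rewrite -big_split big1 // => i iG /=.
rewrite [X in _ + X](eq_bigr (fun l => - T i l)); last first.
  by move=> l /and3P[lG _ il]; rewrite TN // neq_ltn il orbT.
rewrite sumrN; apply/eqP; rewrite subr_eq0; apply/eqP; apply: eq_bigl => l.
by rewrite iG.
Qed.

(** The degrees are given by a predicate, so that [supp (fun m => m.+1 = p)] are
    the cochains of degree [p - 1], and only zero for [p = 0]. *)
Definition supp (Q : nat -> Prop) c : Prop := forall F, ~ Q #|F| -> c F = 0.

Lemma supp_diff p b : supp (fun m => m.+1 = p) b -> supp (fun m => m = p) (cech_diff b).
Proof.
move=> sb G Gp; rewrite /cech_diff big1 // => i iG; rewrite sb.
  by rewrite (lin_0 (res_linear iG)) scaler0.
by move=> e; apply: Gp; rewrite (cardsD1 i) iG add1n.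
Qed.

Lemma suppP Q r c d : supp Q c -> supp Q d -> supp Q (r *: c + d).
Proof. by move=> sc sd F FQ; rewrite dprodDZE sc // sd // scaler0 addr0. Qed.

(** The Cech complex becomes contractible after inverting [x_i]; clearing
    denominators in the contracting homotopy shows that a power of [x_i] kills
    the class of any given cocycle. *)
Lemma cech_torsion_var p c i : is_cocycle p c ->
  exists N, is_coboundary p ('X_i ^+ N *: c).
Proof.
move=> [sc dc].
(* A common bound for the exponents of the denominators. *)
pose N := (\max_(F : {set 'I_n}) loc_exp (c F))%N.
have leN F : (loc_exp (c F) <= N)%N by apply: (leq_bigmax F).
(* The contracting homotopy [c (i |: F)], with the powers of [x_i] in the
   denominator cleared. *)
pose b : cech M := fun F => if (i \notin F) && (#|F|.+1 == p) then
  (csign i (i |: F) * 'X_i ^+ (N - loc_exp (c (i |: F)))) *: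
     frac (xprod k F) (loc_num (c (i |: F))) (loc_exp (c (i |: F))) else 0.
have sb : supp (fun m => m.+1 = p) b.
  by move=> F /eqP/negbTE Fp; rewrite /b Fp andbF.
have bres F G : i \notin F -> G = i |: F ->
    csign i G *: loc_map 'X_i (xprod k G) (b F) = 'X_i ^+ N *: c G.
  move=> iF eG; have iG : i \in G by rewrite eG finset.setU11.
  have eF : F = G :\ i by rewrite eG finset.setU1K.
  have cG : #|G| = #|F|.+1 by rewrite eG cardsU1 iF.
  rewrite /b iF /= -eG; subst F.
  have [Fp|/eqP Fp] := eqVneq #|G :\ i|.+1 p; last first.
    by rewrite (lin_0 (res_linear iG)) sc ?cG // !scaler0.
  rewrite (lin_Z (res_linear iG)) (loc_mapE (xprodD1 iG)) scalerA mulrA.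
  rewrite -[csign _ _ * _]expr2 sqrr_sign mul1r -fracZ scalerA -exprD subnK //.
  by rewrite frac_num.
pose e := 'X_i ^+ N *: c - cech_diff b.
(* On sets containing [i] only one term of the differential survives. *)
have eG0 G : i \in G -> e G = 0.
  move=> iG; rewrite /e -[_ *: c - _]addrC -scaleN1r dprodDZE scaleN1r.
  rewrite [X in - X + _](bigD1 i) //= -/(csign i G) (bres (G :\ i)) ?finset.setD11 ?(finset.setD1K iG) //.
  rewrite big1 ?addr0 ?addNr // => l /andP[lG li].
  have -> : b (G :\ l) = 0 by rewrite /b !inE eq_sym li iG.
  by rewrite (lin_0 (res_linear lG)) scaler0.
have de : cech_diff e = 0.
  by rewrite /e linearB linearZ /= dc cech_diffK scaler0 subrr.
(* On the other sets, [e] being a cocycle that vanishes on sets containing [i]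
   means that it vanishes after inverting [x_i]. *)
have eF0 F : exists t, 'X_i ^+ t *: e F = 0.
  have [iF|iF] := boolP (i \in F); first by exists 0%N; rewrite eG0 ?scaler0.
  pose G := i |: F; have iG : i \in G by rewrite finset.setU11.
  have eF : F = G :\ i by rewrite finset.setU1K.
  have : csign i G *: loc_map 'X_i (xprod k G) (e (G :\ i)) = 0.
    have : cech_diff e G = 0 by rewrite de.
    rewrite /cech_diff (bigD1 i) //= big1 ?addr0 // => l /andP[lG li].
    by rewrite eG0 ?(lin_0 (res_linear lG)) ?scaler0 // finset.in_setD1 eq_sym li iG.
  move=> /(congr1 (fun u => csign i G *: u)).
  rewrite scaler0 scalerA -[csign _ _ * _]expr2 sqrr_sign scale1r -eF.
  move: (e F) => u; elim/locW: u => x a.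
  have xG : xprod k G = xprod k F * 'X_i by rewrite eF; apply: xprodD1.
  rewrite (loc_mapE xG) => /frac_eq0[t].
  rewrite xG exprMn -scalerA loc_expZ => h.
  by exists (t + a)%N; rewrite fracZ; apply/frac_eq0; exists t.
have [T hT] := choice eF0.
pose m := (\max_F T F)%N.
have em : 'X_i ^+ m *: e = 0.
  apply: dprodP => F; rewrite cechZE.
  have le : (T F <= m)%N by apply: (leq_bigmax F).
  by rewrite -(subnK le) exprD -scalerA hT scaler0.
exists (m + N)%N, ('X_i ^+ m *: b); split; first by move=> F Fp; rewrite cechZE sb // scaler0.
apply/eqP; rewrite linearZ exprD -scalerA -subr_eq0 -scalerBr; exact/eqP.
Qed.

End Diff.

(** * Torsion and functoriality *)

Section Torsion.
Variables (k : fieldType) (n : nat) (M : lmodType {mpoly k[n]}).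
Local Notation S := {mpoly k[n]}.

Lemma coboundaryZD p r (c d : cech M) :
  is_coboundary p c -> is_coboundary p d -> is_coboundary p (r *: c + d).
Proof.
move=> hc hd; apply/asboolP; apply: (coboundary_closed M p).2; exact/asboolP.
Qed.

Lemma coboundary0 p : is_coboundary p (0 : cech M).
Proof. by exists 0; rewrite linear0. Qed.

Lemma coboundaryD p (c d : cech M) :
  is_coboundary p c -> is_coboundary p d -> is_coboundary p (c + d).
Proof. by move=> hc hd; rewrite -[c]scale1r; apply: coboundaryZD. Qed.

Lemma coboundaryZ p r (c : cech M) : is_coboundary p c -> is_coboundary p (r *: c).
Proof. by move=> hc; rewrite -[_ *: c]addr0; apply: coboundaryZD (coboundary0 _). Qed.

Lemma coboundaryB p (c d : cech M) :
  is_coboundary p c -> is_coboundary p d -> is_coboundary p (c - d).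
Proof. by move=> hc hd; rewrite addrC -scaleN1r; apply: coboundaryZD. Qed.

(** The elements with a power killing the class are closed under sums, by the
    binomial theorem. *)
Lemma cech_torsion p (c : cech M) (f : S) : max_ideal f -> is_cocycle p c ->
  exists N, is_coboundary p (f ^+ N *: c).
Proof.
move=> [g ->] hc.
apply: (big_ind (fun f : S => exists N, is_coboundary p (f ^+ N *: c))).
- by exists 1%N; rewrite expr1 scale0r; apply: coboundary0.
- move=> x y [a ha] [b hb]; exists (a + b)%N; rewrite exprDn scaler_suml.
  apply: (big_ind (is_coboundary p)) => [||i _].
  + exact: coboundary0.
  + by move=> u v; apply: coboundaryD.
  rewrite -mulr_natl -scalerA; apply: coboundaryZ.
  have [ib|bi] := leqP i b.
    have -> : (a + b - i = a + (b - i))%N by lia.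
    by rewrite exprD -mulrA mulrC -scalerA; apply: coboundaryZ.
  have -> : y ^+ i = y ^+ (i - b) * y ^+ b by rewrite -exprD subnK // ltnW.
  by rewrite mulrA -scalerA; apply: coboundaryZ.
- move=> i _; have [N hN] := cech_torsion_var i hc; exists N.
  by rewrite exprMn -scalerA; apply: coboundaryZ.
Qed.

End Torsion.

Section CechFun.
Variables (k : fieldType) (n : nat) (M N : lmodType {mpoly k[n]}).
Variable (f : {linear M -> N}).

Definition cech_fun (c : cech M) : cech N := fun F => loc_fun f (c F).

Lemma cech_fun_is_linear : linear cech_fun.
Proof. by move=> r c d; apply: dprodP => F; apply: loc_fun_is_linear. Qed.

HB.instance Definition _ :=
  GRing.isLinear.Build {mpoly k[n]} (cech M) (cech N) _ cech_fun cech_fun_is_linear.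

Lemma cech_fun_diff c : cech_fun (cech_diff c) = cech_diff (cech_fun c).
Proof.
apply: dprodP => G; rewrite /cech_fun /cech_diff.
rewrite (lin_sum (@loc_fun_is_linear _ _ _ _ f)); apply: eq_bigr => i iG.
rewrite (lin_Z (@loc_fun_is_linear _ _ _ _ f)); congr (_ *: _).
move: (c _) => u; elim/locW: u => x a.
by rewrite (loc_mapE (xprodD1 k iG)) !loc_funE (loc_mapE (xprodD1 k iG)) linearZZ.
Qed.

Lemma cech_fun_inj : injective f -> injective cech_fun.
Proof.
move=> fi c d e; apply: dprodP => F; apply: (loc_fun_inj fi).
exact: (congr1 (fun c : cech N => c F) e).
Qed.

Lemma supp_fun Q c : supp Q c -> supp Q (cech_fun c).
Proof.
by move=> sc F FQ; rewrite /cech_fun sc // (lin_0 (@loc_fun_is_linear _ _ _ _ f)).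
Qed.

Lemma cocycle_fun p c : is_cocycle p c -> is_cocycle p (cech_fun c).
Proof.
by move=> [sc dc]; split; [exact: (supp_fun (Q := fun m => m = p)) | rewrite -cech_fun_diff dc linear0].
Qed.

Lemma coboundary_fun p c : is_coboundary p c -> is_coboundary p (cech_fun c).
Proof.
move=> [b [sb ->]]; exists (cech_fun b); rewrite cech_fun_diff; split=> //.
exact: (supp_fun (Q := fun m => m.+1 = p)).
Qed.

End CechFun.

(** * The long exact sequence *)

Section Degrees.
Variables (k : fieldType) (n : nat).
Local Notation S := {mpoly k[n]}.

(** Gradings and the trivial family of all of [M] are treated alike, so that the
    long exact sequence below serves both for homogeneous and for arbitrary
    cochains. *)
Definition pregrading (M : lmodType S) (P : int -> set M) : Prop :=
  [/\ forall j, P j 0, forall j x y, P j x -> P j y -> P j (x + y)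
    & forall (e : nat) j (f : S) x, f \is e.-homog -> P j x -> P (j + e%:Z) (f *: x)].

Definition ldeg (M : lmodType S) (P : int -> set M) (F : {set 'I_n}) (j : int)
    (u : loc M (xprod k F)) : Prop :=
  exists x a, P (j + (a * #|F|)%:Z) x /\ u = frac (xprod k F) x a.

Definition cdeg (M : lmodType S) (P : int -> set M) (j : int) (c : cech M) : Prop :=
  forall F, ldeg P j (c F).

Lemma mvar_homog (i : 'I_n) : ('X_i : S) \is 1.-homog.
Proof. by rewrite dhomogX; apply/eqP/mdeg1. Qed.

Lemma xprod_homog (F : {set 'I_n}) : xprod k F \is #|F|.-homog.
Proof.
rewrite /xprod -sum1_card; elim/big_rec2: _ => [|i e f _ hf]; first exact: dhomog1.
exact: dhomogM (mvar_homog i) hf.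
Qed.

Lemma sign_homog m : ((-1) ^+ m : S) \is 0.-homog.
Proof.
have h : (-1 : S) \is 0.-homog by rewrite dhomogN; apply: dhomog1.
by have := dhomogMn m h; rewrite mul0n.
Qed.

Section OneModule.
Variables (M : lmodType S) (P : int -> set M).
Hypothesis hP : pregrading P.
Implicit Types (F G : {set 'I_n}) (j : int).

Lemma ldeg0 F j : ldeg P j (0 : loc M (xprod k F)).
Proof. by exists 0, 0%N; split=> //; case: hP. Qed.

Lemma ldegD F j (u v : loc M (xprod k F)) : ldeg P j u -> ldeg P j v -> ldeg P j (u + v).
Proof.
case: hP => _ hD hZ [x [a [hx ->]]] [y [b [hy ->]]].
exists (xprod k F ^+ b *: x + xprod k F ^+ a *: y), (a + b)%N; split; last exact: fracD.
have hX m : xprod k F ^+ m \is (#|F| * m).-homog by apply/dhomogMn/xprod_homog.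
have := hD _ _ _ (hZ _ _ _ _ (hX b) hx).
rewrite (_ : _ + _ = j + ((a + b) * #|F|)%:Z); last by lia.
by apply; have := hZ _ _ _ _ (hX a) hy; congr (P _ _); lia.
Qed.

Lemma ldegZ F j (e : nat) (f : S) (u : loc M (xprod k F)) :
  f \is e.-homog -> ldeg P j u -> ldeg P (j + e%:Z) (f *: u).
Proof.
case: hP => _ _ hZ hf [x [a [hx ->]]]; exists (f *: x), a; rewrite fracZ; split=> //.
by have := hZ _ _ _ _ hf hx; congr (P _ _); lia.
Qed.

Lemma ldeg_map G j i (u : loc M (xprod k (G :\ i))) : i \in G ->
  ldeg P j u -> ldeg P j (loc_map 'X_i (xprod k G) u).
Proof.
case: hP => _ _ hZ iG [x [a [hx ->]]]; rewrite (loc_mapE (xprodD1 k iG)).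
exists ('X_i ^+ a *: x), a; split=> //.
have hX : ('X_i ^+ a : S) \is (1 * a).-homog.
  by apply/dhomogMn/mvar_homog.
have := hZ _ _ _ _ hX hx; congr (P _ _).
by rewrite (cardsD1 i G) iG; lia.
Qed.

Lemma cdeg0 j : cdeg P j 0.
Proof. by move=> F; apply: ldeg0. Qed.

Lemma cdegD j (c d : cech M) : cdeg P j c -> cdeg P j d -> cdeg P j (c + d).
Proof. by move=> hc hd F; apply: ldegD. Qed.

Lemma cdegZ j e f (c : cech M) : f \is e.-homog -> cdeg P j c -> cdeg P (j + e%:Z) (f *: c).
Proof. by move=> hf hc F; apply: ldegZ. Qed.

Lemma cdegB j (c d : cech M) : cdeg P j c -> cdeg P j d -> cdeg P j (c - d).
Proof.
move=> hc hd; apply: cdegD => //; rewrite -scaleN1r -[j]addr0.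
by apply: (@cdegZ j 0) => //; rewrite dhomogN; apply: dhomog1.
Qed.

Lemma cdeg_diff j (c : cech M) : cdeg P j c -> cdeg P j (cech_diff c).
Proof.
move=> hc G; rewrite /cech_diff; apply: (big_ind (ldeg P j)) => [||i iG].
- exact: ldeg0.
- by move=> u v; apply: ldegD.
by rewrite -[j]addr0; apply: (@ldegZ G j 0%N) => //; [apply: sign_homog | apply: ldeg_map].
Qed.

End OneModule.

(** This makes exactness available degree by degree, although coboundaries are
    defined by arbitrary cochains. *)
Definition strict (M : lmodType S) (P : int -> set M) : Prop :=
  forall p j (c : cech M), cdeg P j c -> is_coboundary p c ->
    exists b, [/\ supp (fun m => m.+1 = p) b, cdeg P j b & c = cech_diff b].

Definition hcocycle (M : lmodType S) (P : int -> set M) p j (c : cech M) : Prop :=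
  is_cocycle p c /\ cdeg P j c.

Definition ungraded (M : lmodType S) (j : int) : set M := setT.

Lemma ungraded_pregrading M : pregrading (@ungraded M).
Proof. by []. Qed.

Lemma ungraded_cdeg M j (c : cech M) : cdeg (@ungraded M) j c.
Proof. by move=> F; exists (loc_num (c F)), (loc_exp (c F)); rewrite frac_num. Qed.

Lemma ungraded_strict M : strict (@ungraded M).
Proof. by move=> p j c _ [b [sb ->]]; exists b; split=> //; apply: ungraded_cdeg. Qed.

End Degrees.

Section LongExact.
Variables (k : fieldType) (n : nat).
Local Notation S := {mpoly k[n]}.

(** Short exact sequences [0 -> A(-e) -> B -> C -> 0] compatible with degrees. *)
Definition short_exact (A B C : lmodType S) (PA : int -> set A) (PB : int -> set B)
    (PC : int -> set C) (e : int) (f : {linear A -> B}) (g : {linear B -> C}) : Prop :=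
  [/\ injective f, forall y, g y = 0 <-> exists x, f x = y,
      forall j x, PB (j + e) (f x) <-> PA j x,
      forall j y, PB j y -> PC j (g y)
    & forall j z, PC j z -> exists2 y, PB j y & g y = z].

Variables (A B C : lmodType S) (PA : int -> set A) (PB : int -> set B).
Variables (PC : int -> set C) (e : int) (f : {linear A -> B}) (g : {linear B -> C}).
Hypotheses (pA : pregrading PA) (pB : pregrading PB) (pC : pregrading PC).
Hypotheses (sA : strict PA) (sB : strict PB) (sC : strict PC).
Hypothesis ex : short_exact PA PB PC e f g.

Lemma cdeg_f j a : cdeg PA j a -> cdeg PB (j + e) (cech_fun f a).
Proof.
case: ex => _ _ fP _ _ ha F; have [x [m [hx ax]]] := ha F.
change (ldeg PB (j + e) (loc_fun f (a F))); rewrite ax loc_funE; exists (f x), m; split=> //.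
by move/fP: hx; congr (PB _ _); lia.
Qed.

Lemma cdeg_g j b : cdeg PB j b -> cdeg PC j (cech_fun g b).
Proof.
case: ex => _ _ _ gP _ hb F; have [x [m [hx bx]]] := hb F.
change (ldeg PC j (loc_fun g (b F))); rewrite bx.
by rewrite loc_funE; exists (g x), m; split=> //; apply: gP.
Qed.

Lemma cech_gf a : cech_fun g (cech_fun f a) = 0.
Proof.
case: ex => _ gf _ _ _; apply: dprodP => F; change (loc_fun g (loc_fun f (a F)) = 0).
move: (a F) => u; elim/locW: u => x m; rewrite !loc_funE.
by apply/frac_eq0; exists 0%N; rewrite scale1r; apply/gf; exists x.
Qed.

Lemma cech_lift Q j w : supp Q w -> cdeg PC j w ->
  exists b, [/\ supp Q b, cdeg PB j b & cech_fun g b = w].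
Proof.
case: ex => _ _ _ _ gs sw hw.
have h F : exists u : loc B (xprod k F), [/\ ~ Q #|F| -> u = 0, ldeg PB j u & loc_fun g u = w F].
  have [q|q] := pselect (Q #|F|).
    have [z [m [hz ->]]] := hw F; have [y hy gy] := gs _ _ hz.
    exists (frac _ y m); split=> //; first by exists y, m.
    by rewrite loc_funE gy.
  exists 0; split=> //; first exact: ldeg0.
  by rewrite sw // (lin_0 (@loc_fun_is_linear _ _ _ _ g)).
have {h} h F : {u : loc B (xprod k F) | [/\ ~ Q #|F| -> u = 0, ldeg PB j u & loc_fun g u = w F]}.
  exact: cid.
exists (fun F => sval (h F)); split=> [F FQ|F|]; first by case: (svalP (h F)) => [->].
  by case: (svalP (h F)).
by apply: dprodP => F; rewrite /cech_fun; case: (svalP (h F)).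
Qed.

Lemma cech_ker Q j b : supp Q b -> cdeg PB (j + e) b -> cech_fun g b = 0 ->
  exists a, [/\ supp Q a, cdeg PA j a & cech_fun f a = b].
Proof.
case: ex => fi gf fP _ _ sb hb gb.
have h F : {u : loc A (xprod k F) | [/\ ~ Q #|F| -> u = 0, ldeg PA j u & loc_fun f u = b F]}.
  apply: cid; have [q|q] := pselect (Q #|F|); last first.
    exists 0; split=> //; first exact: ldeg0.
    by rewrite sb // (lin_0 (@loc_fun_is_linear _ _ _ _ f)).
  have [y [m [hy by']]] := hb F.
  have : cech_fun g b F = 0 by rewrite gb.
  rewrite /cech_fun by' loc_funE => /frac_eq0[t]; rewrite -linearZZ => /gf[x fx].
  exists (frac _ x (t + m)); split=> //; last by rewrite loc_funE fx frac_shift.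
  exists x, (t + m)%N; split=> //; apply/fP; rewrite fx.
  have hX : xprod k F ^+ t \is (#|F| * t).-homog by apply/dhomogMn/xprod_homog.
  by case: pB => _ _ /(_ _ _ _ _ hX hy); congr (PB _ _); lia.
exists (fun F => sval (h F)); split=> [F FQ|F|]; first by case: (svalP (h F)) => [->].
  by case: (svalP (h F)).
by apply: dprodP => F; rewrite /cech_fun; case: (svalP (h F)).
Qed.

(** Exactness at [H^p(B)]. *)
Lemma middle_exact p j c : hcocycle PB p (j + e) c -> is_coboundary p (cech_fun g c) ->
  exists2 a, hcocycle PA p j a & is_coboundary p (c - cech_fun f a).
Proof.
move=> [[sc dc] hc] hg.
have [w [sw hw gw]] := sC (cdeg_g hc) hg.
have [b [sb hb gb]] := cech_lift sw hw.
have [||| a [sa ha fa]] := @cech_ker (fun m => m = p) j (c - cech_diff b).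
- by rewrite addrC -scaleN1r; apply: suppP => //; apply: supp_diff.
- exact/cdegB/cdeg_diff.
- by rewrite linearB /= cech_fun_diff gb gw subrr.
exists a; last by exists b; rewrite fa subKr; split.
split=> //; split=> //; apply: (cech_fun_inj (f := f)); first by case: ex.
by rewrite cech_fun_diff fa linear0 linearB /= dc cech_diffK subrr.
Qed.

(** The connecting homomorphism as a relation between cocycles, [b] being the
    cochain of the snake lemma. *)
Definition connecting p j (w : cech C) (a : cech A) : Prop :=
  exists b, [/\ supp (fun m => m = p) b, cdeg PB (j + e) b,
    cech_fun g b = w & cech_diff b = cech_fun f a].

Lemma connecting_total p j w : hcocycle PC p (j + e) w ->
  exists2 a, hcocycle PA p.+1 j a & connecting p j w a.
Proof.
move=> [[sw dw] hw]; have [b [sb hb gb]] := cech_lift (Q := fun m => m = p) sw hw.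
have [||| a [sa ha fa]] := @cech_ker (fun m => m = p.+1) j (cech_diff b).
- by apply: supp_diff => F Fp; apply: sb => e'; apply: Fp; rewrite e'.
- exact: cdeg_diff.
- by rewrite cech_fun_diff gb.
exists a; last by exists b.
split=> //; split=> //; apply: (cech_fun_inj (f := f)); first by case: ex.
by rewrite cech_fun_diff fa linear0 cech_diffK.
Qed.

(** Exactness at [H^(p+1)(A)]. *)
Lemma connecting_exact p j a : hcocycle PA p.+1 j a -> is_coboundary p.+1 (cech_fun f a) ->
  exists2 w, hcocycle PC p (j + e) w & connecting p j w a.
Proof.
move=> [[sa da] ha] hf; have [b [sb hb fb]] := sB (cdeg_f ha) hf.
have sb' : supp (fun m => m = p) b by move=> F Fp; apply: sb => -[].
exists (cech_fun g b); last by exists b.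
split; last exact: cdeg_g.
by split; [exact: (supp_fun g (Q := fun m => m = p)) | rewrite -cech_fun_diff -fb cech_gf].
Qed.

(** Half of the exactness at [H^p(C)]: what the connecting homomorphism kills
    comes from [B]. *)
Lemma connecting_coboundary p j w a : cdeg PA j a -> connecting p j w a ->
  is_coboundary p.+1 a ->
  exists2 b, hcocycle PB p (j + e) b & cech_fun g b = w.
Proof.
move=> ha [b [sb hb gb db]] /(sA ha)[a' [sa ha' aa]].
exists (b - cech_fun f a'); last by rewrite linearB /= cech_gf subr0.
split; last by apply: cdegB => //; apply: cdeg_f.
split; last by rewrite linearB /= db aa cech_fun_diff subrr.
have sa' : supp (fun m => m = p) a' by move=> F Fp; apply: sa => -[].
rewrite addrC -scaleN1r.
exact: (suppP (Q := fun m => m = p) _ (supp_fun f sa') sb).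
Qed.

(** The other half, together with the independence of the connecting
    homomorphism from the choice of a lift. *)
Lemma connecting_image p j w a b : hcocycle PC p (j + e) w -> connecting p j w a ->
  hcocycle PB p (j + e) b -> is_coboundary p (w - cech_fun g b) -> is_coboundary p.+1 a.
Proof.
move=> [_ hw] [b0 [sb0 hb0 gb0 db0]] [[sb db] hb] hwb.
have dwb : cdeg PC (j + e) (w - cech_fun g b) by apply: cdegB => //; apply: cdeg_g.
have [w' [sw' hw' ww']] := sC dwb hwb.
have [b' [sb' hb' gb']] := cech_lift sw' hw'.
have [||| a' [sa' ha' fa']] := @cech_ker (fun m => m = p) j (b0 - b - cech_diff b').
- rewrite -addrA -opprD addrC -scaleN1r; apply: suppP => //.
  by rewrite -[b]scale1r; apply: suppP => //; apply: supp_diff.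
- by apply: cdegB => //; [apply: cdegB | apply: cdeg_diff].
- by rewrite !linearB /= cech_fun_diff gb' -ww' gb0 subrr.
exists a'; split; first by move=> F Fp; apply: sa' => e'; apply: Fp; rewrite e'.
apply: (cech_fun_inj (f := f)); first by case: ex.
by rewrite -db0 cech_fun_diff fa' !linearB /= db cech_diffK !subr0.
Qed.

End LongExact.

(** * Homogeneous components *)

Section Components.
Variables (k : fieldType) (n : nat) (M : gradedModule k n).
Local Notation S := {mpoly k[n]}.
Implicit Types (x y : M) (j l : int) (s : seq int).

Lemma gr_compB j x y : gr_comp j x -> gr_comp j y -> gr_comp j (x - y).
Proof.
move=> hx hy; apply: gr_compD => //; rewrite -scaleN1r -[j]addr0.
by apply: (@gr_compZ _ _ M 0); rewrite // dhomogN; apply: dhomog1.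
Qed.

Lemma gr_comp_if j (b : bool) x : gr_comp j x -> gr_comp j (if b then x else 0).
Proof. by case: b => // _; apply: gr_comp0. Qed.

Definition decomp x : {sc : seq int * (int -> M) |
  [/\ uniq sc.1, forall j, gr_comp j (sc.2 j) & x = \sum_(j <- sc.1) sc.2 j]}.
Proof. by apply: cid; have [s [c h]] := gr_decomp x; exists (s, c). Qed.

Definition degs x : seq int := (sval (decomp x)).1.

(** The homogeneous component of degree [j]. *)
Definition hcomp j x : M := if j \in degs x then (sval (decomp x)).2 j else 0.

Lemma hcomp_comp j x : gr_comp j (hcomp j x).
Proof. by apply: gr_comp_if; case: (svalP (decomp x)). Qed.

Lemma hcomp_out j x : j \notin degs x -> hcomp j x = 0.
Proof. by rewrite /hcomp => /negbTE ->. Qed.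

Lemma big_seq_if (V : zmodType) s u (c : int -> V) : uniq s -> uniq u -> {subset s <= u} ->
  \sum_(j <- u) (if j \in s then c j else 0) = \sum_(j <- s) c j.
Proof.
move=> us uu su; rewrite -big_mkcond /= -big_filter; apply: perm_big.
apply: uniq_perm => // [|j]; first exact: filter_uniq.
by rewrite mem_filter andb_idr // => /su.
Qed.

Lemma hcomp_sum u x : uniq u -> {subset degs x <= u} -> x = \sum_(j <- u) hcomp j x.
Proof.
move=> uu su; case: (svalP (decomp x)) => us _ {1}->.
by rewrite -(big_seq_if _ us uu su).
Qed.

Lemma hcomp_unique x s (c : int -> M) : uniq s -> (forall j, gr_comp j (c j)) ->
  x = \sum_(j <- s) c j -> forall j, hcomp j x = if j \in s then c j else 0.
Proof.
move=> us hc xs j; pose u := undup (degs x ++ s).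
have uu : uniq u by apply: undup_uniq.
have xu : {subset degs x <= u} by move=> l hl; rewrite mem_undup mem_cat hl.
have su : {subset s <= u} by move=> l hl; rewrite mem_undup mem_cat hl orbT.
have [ju|ju] := boolP (j \in u); last first.
  rewrite hcomp_out; last by apply: contra ju => /xu.
  by case: ifPn => // /su; rewrite (negbTE ju).
apply/eqP; rewrite -subr_eq0; apply/eqP.
apply: (gr_indep (s := u) (c := fun l => hcomp l x - (if l \in s then c l else 0))) => //.
  by move=> l; apply: gr_compB; [apply: hcomp_comp | apply: gr_comp_if].
by rewrite sumrB -hcomp_sum // big_seq_if // -xs subrr.
Qed.

Lemma hcomp_id j l x : gr_comp j x -> hcomp l x = if l == j then x else 0.
Proof.
move=> hx; rewrite (@hcomp_unique x [:: j] (fun l => if l == j then x else 0)) //.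
- by rewrite inE; case: eqP.
- by move=> i; case: eqP => [->|_] //; apply: gr_comp0.
- by rewrite big_seq1 eqxx.
Qed.

Lemma hcompD j x y : hcomp j (x + y) = hcomp j x + hcomp j y.
Proof.
pose u := undup (degs x ++ degs y).
have xu : {subset degs x <= u} by move=> l hl; rewrite mem_undup mem_cat hl.
have yu : {subset degs y <= u} by move=> l hl; rewrite mem_undup mem_cat hl orbT.
rewrite (@hcomp_unique (x + y) u (fun l => hcomp l x + hcomp l y)) ?undup_uniq //.
- case: ifPn => // ju; rewrite !hcomp_out ?addr0 //.
    by apply: contra ju => /yu.
  by apply: contra ju => /xu.
- by move=> l; apply: gr_compD; apply: hcomp_comp.
- by rewrite big_split /= -!hcomp_sum ?undup_uniq.
Qed.

Lemma hcomp_is_zmod_morphism j : zmod_morphism (hcomp j).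
Proof.
have h0 : hcomp j 0 = 0 by rewrite (hcomp_id j (gr_comp0 M j)) if_same.
move=> x y; rewrite hcompD; congr (_ + _); apply/eqP.
by rewrite -subr_eq0 opprK -hcompD addNr h0.
Qed.

HB.instance Definition _ j := GRing.isZmodMorphism.Build M M (hcomp j)
  (@hcomp_is_zmod_morphism j).

Lemma hcompZ (e : nat) j (f : S) x : f \is e.-homog -> hcomp (j + e%:Z) (f *: x) = f *: hcomp j x.
Proof.
move=> hf; pose u := [seq l + e%:Z | l <- undup (degs x)].
have ui : injective (fun l : int => l + e%:Z) by apply: addIr.
rewrite (@hcomp_unique _ u (fun l => f *: hcomp (l - e%:Z) x)).
- rewrite addrK /u (mem_map ui) mem_undup; case: ifPn => // /hcomp_out ->.
  by rewrite scaler0.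
- by rewrite map_inj_uniq ?undup_uniq.
- move=> l; rewrite -[l in gr_comp l](subrK e%:Z); apply: gr_compZ => //.
  exact: hcomp_comp.
rewrite big_map -scaler_sumr; congr (_ *: _).
rewrite {1}(@hcomp_sum (undup (degs x)) x) ?undup_uniq //; last by move=> l; rewrite mem_undup.
by apply: eq_bigr => l _; rewrite addrK.
Qed.

Lemma gr_pregrading : pregrading (@gr_comp k n M).
Proof.
by split; [apply: gr_comp0 | apply: gr_compD | move=> *; apply: gr_compZ].
Qed.

Section Projection.
Variables (F : {set 'I_n}) (j : int).

(** The component of degree [j] of a fraction; projecting cochains in this way
    proves [gr_strict]. *)
Definition lproj (u : loc M (xprod k F)) : loc M (xprod k F) :=
  frac (xprod k F) (hcomp (j + (loc_exp u * #|F|)%:Z) (loc_num u)) (loc_exp u).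

Lemma lprojE x a : lproj (frac (xprod k F) x a) =
  frac (xprod k F) (hcomp (j + (a * #|F|)%:Z) x) a.
Proof.
have [t e] := loc_numP (xprod k F) x a; rewrite /lproj; apply/fracP; exists t.
move: (loc_num _) (loc_exp _) e => x' a' e.
have hX m : xprod k F ^+ m \is (#|F| * m).-homog by apply/dhomogMn/xprod_homog.
rewrite -!(hcompZ _ _ (hX _)).
by move: (congr1 (hcomp (j + ((t + a + a') * #|F|)%:Z)) e) => {}e; etransitivity;
  [|etransitivity; [exact: e|]]; congr (hcomp _ _); lia.
Qed.

Lemma lproj_zmod_morphism : zmod_morphism lproj.
Proof.
have hX m : xprod k F ^+ m \is (#|F| * m).-homog by apply/dhomogMn/xprod_homog.
have lprojN u : lproj (- u) = - lproj u.
  elim/locW: u => x a; rewrite lprojE -[- frac _ _ _]/(loc_opp _) loc_oppE lprojE.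
  by rewrite -[RHS]/(loc_opp _) loc_oppE raddfN.
move=> u v; rewrite -lprojN; move: (- v) => {}v.
elim/locW: u => x a; elim/locW: v => y b; rewrite fracD !lprojE fracD raddfD /=.
rewrite -!(hcompZ _ _ (hX _)).
have -> : j + (a * #|F|)%:Z + (#|F| * b)%:Z = j + ((a + b) * #|F|)%:Z by lia.
by have -> : j + (b * #|F|)%:Z + (#|F| * a)%:Z = j + ((a + b) * #|F|)%:Z by lia.
Qed.

HB.instance Definition _ := GRing.isZmodMorphism.Build _ _ lproj lproj_zmod_morphism.

Lemma lproj_ldeg u : ldeg (@gr_comp k n M) j (lproj u).
Proof.
by exists (hcomp (j + (loc_exp u * #|F|)%:Z) (loc_num u)), (loc_exp u); split=> //; apply: hcomp_comp.
Qed.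

Lemma lproj_id u : ldeg (@gr_comp k n M) j u -> lproj u = u.
Proof. by move=> [x [a [hx ->]]]; rewrite lprojE (hcomp_id _ hx) eqxx. Qed.

Lemma lproj_sign m u : lproj ((-1) ^+ m *: u) = (-1) ^+ m *: lproj u.
Proof.
by rewrite -signr_odd; case: (odd m); rewrite ?scale1r // !scaleN1r raddfN.
Qed.

End Projection.

Lemma lproj_map (G : {set 'I_n}) i j (u : loc M (xprod k (G :\ i))) : i \in G ->
  lproj j (loc_map 'X_i (xprod k G) u) = loc_map 'X_i (xprod k G) (lproj j u).
Proof.
move=> iG; elim/locW: u => x a; rewrite lprojE !(loc_mapE (xprodD1 k iG)) lprojE.
have hX : ('X_i ^+ a : S) \is (1 * a).-homog by apply/dhomogMn/mvar_homog.
rewrite -(hcompZ _ _ hX); congr (frac _ (hcomp _ _) _).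
by rewrite (cardsD1 i G) iG; lia.
Qed.

Lemma gr_strict : strict (@gr_comp k n M).
Proof.
move=> p j c hc [b [sb cb]].
exists (fun F => lproj j (b F)); split=> [F Fp|F|].
- by rewrite sb // raddf0.
- exact: lproj_ldeg.
apply: dprodP => G; rewrite -[LHS](lproj_id (hc G)) cb /cech_diff raddf_sum /=.
by apply: eq_bigr => i iG; rewrite lproj_sign lproj_map.
Qed.

End Components.

(** * Graded submodules and quotients *)

Section QuotientMap.
Variables (R : comNzRingType) (M : lmodType R) (U : submodule M).

Definition qpi (x : M) : quotmod U := \pi_(quotmod U) x.

Lemma qpi_is_linear : linear qpi.
Proof. by move=> a x y; rewrite /qpi pi_quotmodD -quotmod_scaleE. Qed.

HB.instance Definition _ := GRing.isLinear.Build R M (quotmod U) _ qpi qpi_is_linear.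

Lemma qpi_eq0 x : qpi x = 0 <-> x \in submod_pred U.
Proof.
have {1}-> : x = x - 0 by rewrite subr0.
rewrite linearB /= [qpi 0]linear0 subr0 -[in X in _ <-> X](subr0 x) -pi_quotmod_eq.
rewrite -/(qpi x) -/(qpi 0) [qpi 0]linear0.
by split=> [->|/eqP].
Qed.

Lemma qpi_surj u : exists x, qpi x = u.
Proof. by exists (repr u); rewrite /qpi reprK. Qed.

End QuotientMap.

Section GradedSub.
Variables (k : fieldType) (n : nat) (M : gradedModule k n) (U : submodule M).
Hypothesis hU : graded_submod U.
Implicit Types (j : int).

Lemma hcomp_sub j x : x \in submod_pred U -> hcomp j x \in submod_pred U.
Proof.
move=> /hU[s [c [us hc xs]]]; rewrite (hcomp_unique us _ xs) => [|l]; last by case: (hc l).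
by case: ifP => _; [case: (hc j) | rewrite rpred0].
Qed.

Definition gsub_comp j : set (submod U) := [set x | gr_comp j (val x)].

Lemma gsub_comp0 j : gsub_comp j 0.
Proof. by rewrite /gsub_comp /mkset raddf0; apply: gr_comp0. Qed.

Lemma gsub_compD j x y : gsub_comp j x -> gsub_comp j y -> gsub_comp j (x + y).
Proof. by rewrite /gsub_comp /mkset raddfD; apply: gr_compD. Qed.

Lemma gsub_compZ (e : nat) j (f : {mpoly k[n]}) x :
  f \is e.-homog -> gsub_comp j x -> gsub_comp (j + e%:Z) (f *: x).
Proof. by rewrite /gsub_comp /mkset linearZ; apply: gr_compZ. Qed.

Lemma gsub_decomp x : exists (s : seq int) (c : int -> submod U),
  [/\ uniq s, forall j, gsub_comp j (c j) & x = \sum_(j <- s) c j].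
Proof.
pose c j : submod U := exist _ (hcomp j (val x)) (hcomp_sub j (svalP x)).
exists (undup (degs (val x))), c; split; first exact: undup_uniq.
  by move=> j; apply: hcomp_comp.
apply: val_inj; rewrite raddf_sum /= {1}(@hcomp_sum _ _ _ (undup (degs (val x))) (val x)) ?undup_uniq //.
by move=> l; rewrite mem_undup.
Qed.

Lemma gsub_indep (s : seq int) (c : int -> submod U) : uniq s ->
  (forall j, gsub_comp j (c j)) -> \sum_(j <- s) c j = 0 ->
  forall j, j \in s -> c j = 0.
Proof.
move=> us hc /(congr1 val); rewrite raddf_sum raddf0 => h j js.
apply: val_inj; rewrite raddf0.
exact: (gr_indep (c := fun l => val (c l)) us hc h js).
Qed.

Definition gsub : gradedModule k n := @GradedModule k n (submod U) gsub_comp gsub_comp0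
  gsub_compD gsub_compZ gsub_decomp gsub_indep.

Definition gquot_comp j : set (quotmod U) := [set u | exists2 x, gr_comp j x & qpi U x = u].

Lemma gquot_comp0 j : gquot_comp j 0.
Proof. by exists 0; [apply: gr_comp0 | rewrite linear0]. Qed.

Lemma gquot_compD j x y : gquot_comp j x -> gquot_comp j y -> gquot_comp j (x + y).
Proof.
move=> [u hu <-] [v hv <-]; exists (u + v); last by rewrite linearD.
exact: gr_compD.
Qed.

Lemma gquot_compZ (e : nat) j (f : {mpoly k[n]}) x :
  f \is e.-homog -> gquot_comp j x -> gquot_comp (j + e%:Z) (f *: x).
Proof.
move=> hf [u hu <-]; exists (f *: u); last by rewrite linearZZ.
exact: gr_compZ.
Qed.

Lemma gquot_decomp u : exists (s : seq int) (c : int -> quotmod U),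
  [/\ uniq s, forall j, gquot_comp j (c j) & u = \sum_(j <- s) c j].
Proof.
have [x <-] := qpi_surj u.
exists (undup (degs x)), (fun j => qpi U (hcomp j x)); split; first exact: undup_uniq.
  by move=> j; exists (hcomp j x) => //; apply: hcomp_comp.
rewrite -raddf_sum -hcomp_sum ?undup_uniq // => l; by rewrite mem_undup.
Qed.

Lemma gquot_indep (s : seq int) (c : int -> quotmod U) : uniq s ->
  (forall j, gquot_comp j (c j)) -> \sum_(j <- s) c j = 0 ->
  forall j, j \in s -> c j = 0.
Proof.
move=> us hc h j js.
have {}hc l : exists x, gr_comp l x /\ qpi U x = c l by have [x] := hc l; exists x.
have [x hx] := choice hc.
have xU : \sum_(l <- s) x l \in submod_pred U.
  apply/qpi_eq0; rewrite raddf_sum -[RHS]h; apply: eq_bigr => l _.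
  by case: (hx l).
case: (hx j) => _ <-; apply/qpi_eq0.
have := hcomp_sub j xU; rewrite (hcomp_unique us _ erefl) ?js // => l.
by case: (hx l).
Qed.

Definition gquot : gradedModule k n := @GradedModule k n (quotmod U) gquot_comp gquot_comp0
  gquot_compD gquot_compZ gquot_decomp gquot_indep.

End GradedSub.

(** * Dimensions of subquotients *)

Section RelativeDimension.
Variables (k : fieldType) (n : nat).
Local Notation S := {mpoly k[n]}.

Section OneModule.
Variable N : lmodType S.
Implicit Types (V Z B : set N) (d : nat).

Definition is_ksub V : Prop :=
  V 0 /\ forall (c : k) x y, V x -> V y -> V (c%:MP *: x + y).

Definition add_line B z : set N := [set x | exists c : k, B (x - c%:MP *: z)].

(** The space [Z / B] has dimension [d]: there is a flag of [d] one-dimensional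
    steps from [B] to a space containing [Z]. *)
Fixpoint reldim Z d B : Prop :=
  if d is d'.+1 then exists z, [/\ Z z, ~ B z & reldim Z d' (add_line B z)] else Z `<=` B.

Lemma ksubD V x y : is_ksub V -> V x -> V y -> V (x + y).
Proof. by move=> [_ h] Vx Vy; have := h 1 x y Vx Vy; rewrite mpolyC1 scale1r. Qed.

Lemma ksubZ V c x : is_ksub V -> V x -> V (c%:MP *: x).
Proof. by move=> [h0 h] Vx; rewrite -[_ *: x]addr0; apply: h. Qed.

Lemma ksubB V x y : is_ksub V -> V x -> V y -> V (x - y).
Proof.
move=> hV Vx Vy; apply: ksubD => //.
by have := ksubZ (-1) hV Vy; rewrite mpolyCN mpolyC1 scaleN1r.
Qed.

Lemma ksub_sum V (I : Type) (r : seq I) (F : I -> N) :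
  is_ksub V -> (forall i, V (F i)) -> V (\sum_(i <- r) F i).
Proof.
by move=> hV hF; apply: (big_ind V) => [|x y|//]; [case: hV | apply: ksubD].
Qed.

Lemma add_line_ksub B z : is_ksub B -> is_ksub (add_line B z).
Proof.
move=> hB; split; first by exists 0; rewrite mpolyC0 scale0r subr0; case: hB.
move=> c x y [a ha] [b hb]; exists (c * a + b).
have := hB.2 c _ _ ha hb; congr (B _).
by rewrite mpolyCD mpolyCM scalerBr scalerA scalerDl opprD addrACA.
Qed.

Lemma sub_add_line B z : is_ksub B -> B `<=` add_line B z.
Proof. by move=> hB x Bx; exists 0; rewrite mpolyC0 scale0r subr0. Qed.

Lemma add_line_id B z : is_ksub B -> B z -> add_line B z = B.
Proof.
move=> hB Bz; apply/seteqP; split; last exact: sub_add_line.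
by move=> x [c hc]; rewrite -[x](subrK (c%:MP *: z)); apply: ksubD => //; exact: ksubZ.
Qed.

Fixpoint kspan (s : seq N) B : set N := if s is g :: s' then kspan s' (add_line B g) else B.

Lemma reldim_exists Z B (s : seq N) : is_ksub B -> (forall g, g \in s -> Z g) ->
  Z `<=` kspan s B -> exists d, reldim Z d B.
Proof.
elim: s B => [|g s IHs] B hB hs Zs; first by exists 0%N.
have hs' h : h \in s -> Z h by move=> hh; apply: hs; rewrite inE hh orbT.
have [Bg|Bg] := pselect (B g).
  by apply: IHs => //; rewrite -(add_line_id hB Bg).
have [d hd] := IHs _ (add_line_ksub g hB) hs' Zs.
by exists d.+1, g; split=> //; apply: hs; apply: mem_head.
Qed.

Lemma reldim_basis Z d B : is_ksub B -> reldim Z d B -> exists b : 'I_d -> N,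
  [/\ forall t, Z (b t), forall c : 'I_d -> k, B (\sum_t (c t)%:MP *: b t) -> forall t, c t = 0
    & forall z, Z z -> exists c : 'I_d -> k, B (z - \sum_t (c t)%:MP *: b t)].
Proof.
elim: d B => [|d IHd] B hB /=.
  move=> ZB; exists (fun=> 0); split=> [[]//|_ _ []//|z /ZB Bz].
  by exists (fun=> 0); rewrite big_ord0 subr0.
move=> [z [Zz Bz /(IHd _ (add_line_ksub z hB))[b [Zb bi bs]]]].
exists (fun t => if unlift ord0 t is Some t' then b t' else z).
have sumE (c : 'I_d.+1 -> k) : \sum_t (c t)%:MP *: (if unlift ord0 t is Some t' then b t' else z)
    = (c ord0)%:MP *: z + \sum_t (c (lift ord0 t))%:MP *: b t.
  rewrite big_ord_recl unlift_none; congr (_ + _); apply: eq_bigr => t _.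
  by rewrite liftK.
split=> [t|c|x /bs[c [e he]]]; first by case: unliftP.
  rewrite sumE => hc.
  have c0 : forall t, c (lift ord0 t) = 0.
    by apply: bi; exists (- c ord0); rewrite mpolyCN scaleNr opprK addrC.
  have {}hc : B ((c ord0)%:MP *: z).
    by rewrite big1 ?addr0 // in hc => t _; rewrite c0 mpolyC0 scale0r.
  have c00 : c ord0 = 0.
    apply: contrapT => /eqP nc; apply: Bz; have := ksubZ (c ord0)^-1 hB hc.
    by rewrite scalerA -mpolyCM mulVf // mpolyC1 scale1r.
  by move=> t; case: (unliftP ord0 t) => [t' ->|->].
exists (fun t => if unlift ord0 t is Some t' then c t' else e).
rewrite sumE unlift_none.
rewrite (eq_bigr (fun t => (c t)%:MP *: b t)) => [|t _]; last by rewrite liftK.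
by rewrite opprD addrA addrAC.
Qed.

(** The two matrices of coordinates multiply to the identity, so that ranks give
    the inequality. *)
Lemma kbasis_unique V d d' (b : 'I_d -> N) (b' : 'I_d' -> N) :
  is_kbasis V b -> is_kbasis V b' -> (d <= d')%N.
Proof.
move=> [Vb bi bs] [Vb' bi' bs'].
have [A hA] := choice (fun t => bs' _ (Vb t)).
have [A' hA'] := choice (fun t => bs _ (Vb' t)).
pose P := \matrix_(i, j) A i j; pose Q := \matrix_(i, j) A' i j.
suff PQ : P *m Q = 1%:M.
  rewrite -(mxrank1 k d) -PQ; apply: leq_trans (mxrankM_maxl _ _) (rank_leq_col _).
apply/matrixP => i j; rewrite !mxE; apply/eqP; rewrite -subr_eq0; apply/eqP.
apply: (bi (fun j => \sum_l P i l * Q l j - (i == j)%:R)).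
under eq_bigr do rewrite mpolyCB scalerBl; rewrite sumrB.
apply/eqP; rewrite subr_eq0; apply/eqP.
transitivity (b i); last first.
  rewrite (bigD1 i) //= eqxx mpolyC1 scale1r big1 ?addr0 // => l /negbTE.
  by rewrite eq_sym => ->; rewrite mpolyC0 scale0r.
rewrite [RHS]hA; under [RHS]eq_bigr do rewrite hA' scaler_sumr.
rewrite exchange_big; apply: eq_bigr => l _ /=.
rewrite raddf_sum scaler_suml; apply: eq_bigr => m _.
by rewrite scalerA -mpolyCM !mxE.
Qed.

Lemma kdimE V d (b : 'I_d -> N) : is_kbasis V b -> kdim V = d.
Proof.
move=> hb; rewrite /kdim; case: xgetP => [m _ [b' hb']|/(_ d)]; last by case; exists b.
by apply/eqP; rewrite eqn_leq (kbasis_unique hb hb') (kbasis_unique hb' hb).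
Qed.

End OneModule.

(** Isomorphisms of subquotients given by linear relations, such as connecting
    homomorphisms before any choice is made. *)
Lemma reldim_rel (N0 N1 : lmodType S) (R : N0 -> N1 -> Prop) (Z0 B0 : set N0)
    (Z1 B1 : set N1) d :
  is_ksub Z0 -> is_ksub Z1 ->
  (forall (c : k) w w' a a', R w a -> R w' a' -> R (c%:MP *: w + w') (c%:MP *: a + a')) ->
  (forall w, Z0 w -> exists2 a, Z1 a & R w a) ->
  (forall a, Z1 a -> exists2 w, Z0 w & R w a) ->
  (forall w a, Z0 w -> Z1 a -> R w a -> B0 w <-> B1 a) ->
  reldim Z0 d B0 -> reldim Z1 d B1.
Proof.
move=> hZ0 hZ1 Rl R0 R1; elim: d B0 B1 => [|d IHd] B0 B1 RB /=.
  move=> ZB a /[dup] Za /R1[w Zw Rwa]; apply/(RB _ _ Zw Za Rwa); exact: ZB.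
move=> [z [Zz Bz hd]]; have [a Za Rza] := R0 _ Zz; exists a; split=> //.
  by move/(RB _ _ Zz Za Rza).
apply: IHd hd => w b Zw Zb Rwb.
have NC (N : lmodType S) (c : k) (x y : N) : x - c%:MP *: y = (- c)%:MP *: y + x.
  by rewrite mpolyCN scaleNr addrC.
split=> -[c]; rewrite NC => hc; exists c; rewrite NC;
  apply/(RB _ _ _ _ (Rl (- c) _ _ _ _ Rza Rwb)) => //.
- exact: hZ0.2.
- exact: hZ1.2.
- exact: hZ0.2.
- exact: hZ1.2.
Qed.

(** By induction on the flag in the kernel [K] of [Z1 -> Z2 / B2]: the sequence
    [0 -> K / B1 -> Z1 / B1 -> Z2 / B2 -> 0] stays exact when [B1] is enlarged
    inside [K]. *)
Lemma reldim_exact (N1 N2 : lmodType S) (f : {linear N1 -> N2}) (Z1 B1 : set N1)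
    (Z2 B2 : set N2) a b :
  is_ksub Z1 -> is_ksub B1 -> is_ksub Z2 -> is_ksub B2 ->
  (forall x, Z1 x -> Z2 (f x)) -> (forall x, B1 x -> B2 (f x)) ->
  (forall y, Z2 y -> exists2 x, Z1 x & B2 (y - f x)) ->
  reldim (Z1 `&` [set x | B2 (f x)]) a B1 -> reldim Z2 b B2 -> reldim Z1 (a + b) B1.
Proof.
move=> hZ1 hB1 hZ2 hB2 fZ fB fs; elim: a B1 hB1 fB => [|a IHa] B1 hB1 fB /=; last first.
  move=> [z [[Zz Bz] nz hz]] h2; exists z; split=> //; apply: IHa => //.
    exact: add_line_ksub.
  move=> x [c /fB]; rewrite linearB linearZZ => h.
  by rewrite -[f x](subrK (c%:MP *: f z)); apply: ksubD => //; exact: ksubZ.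
move=> KB; apply: (reldim_rel (R := fun w x => B2 (w - f x))) => //.
- move=> c w w' x x' h h'; have := hB2.2 c _ _ h h'; congr (B2 _).
  by rewrite (linearD f) (linearZZ f) scalerBr opprD addrACA.
- by move=> x Zx; exists (f x); [apply: fZ | rewrite subrr; case: hB2].
move=> w x Zw Zx h; split=> [Bw|/fB Bx].
  apply: KB; split=> //; rewrite /mkset -[f x](subKr w); exact: ksubB.
by rewrite -[w](subrK (f x)); apply: ksubD.
Qed.

End RelativeDimension.

Section CohomologyDimension.
Variables (k : fieldType) (n : nat) (M : gradedModule k n).
Local Notation S := {mpoly k[n]}.

Lemma mpolyC_homog (c : k) : (c%:MP : S) \is 0.-homog.
Proof. by rewrite -[c%:MP]mulr1 mul_mpolyC; apply/dhomogZ/dhomog1. Qed.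

Lemma coboundary_ksub (N : lmodType S) p : is_ksub [set c : cech N | is_coboundary p c].
Proof.
by split=> [|c x y]; [apply: coboundary0 | apply: coboundaryZD].
Qed.

Lemma hcocycle_ksub (N : lmodType S) P p j : pregrading P -> is_ksub (hcocycle (M := N) P p j).
Proof.
move=> hP; split=> [|c x y [cx dx] [cy dy]].
  by split; [split; [|rewrite linear0] | apply: cdeg0].
split; last first.
  apply: cdegD => //; rewrite -[j]addr0; apply: (@cdegZ _ _ _ _ hP j 0) => //.
  exact: mpolyC_homog.
by have /asboolP := (cocycle_closed N p).2 c%:MP x y (asboolT cx) (asboolT cy).
Qed.

Definition cohom_dim p j d : Prop :=
  reldim (hcocycle (@gr_comp k n M) p j) d [set c | is_coboundary p c].

(** In the quotient module the classes of homogeneous cocycles are taken modulo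
    all coboundaries, as they are in [cohom_dim]. *)
Lemma cohom_dim_kdim p j d : cohom_dim p j d -> kdim (@loc_cohomology_comp k n M p j) = d.
Proof.
move=> /(reldim_basis (@coboundary_ksub _ p))[b [Zb bi bs]].
pose L := restr_submod (cocycles M p) (coboundaries M p).
pose e t : submod (cocycles M p) := exist _ (b t) (asboolT (Zb t).1).
have LE (z : submod (cocycles M p)) : qpi L z = 0 <-> is_coboundary p (val z).
  by rewrite qpi_eq0; split=> [|h]; [move/asboolP | apply/asboolP].
have sumE (c : 'I_d -> k) : \sum_t (c t)%:MP *: qpi L (e t) = qpi L (\sum_t (c t)%:MP *: e t).
  by rewrite (lin_sum (@qpi_is_linear _ _ L)); apply: eq_bigr => t _; rewrite (lin_Z (@qpi_is_linear _ _ L)).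
have valE (c : 'I_d -> k) : val (\sum_t (c t)%:MP *: e t) = \sum_t (c t)%:MP *: b t.
  rewrite raddf_sum; apply: eq_bigr => t _.
  by rewrite [LHS]linearZ.
apply: (@kdimE _ _ _ _ _ (fun t => qpi L (e t))); split.
- by move=> t; exists (e t); split=> //; case: (Zb t).
- by move=> c; rewrite sumE => /LE; rewrite valE; apply: bi.
move=> _ [z [hz ->]]; have [|c hc] := bs (val z).
  by split=> //; have := svalP z; move/asboolP.
exists c; rewrite sumE; apply/eqP; rewrite -subr_eq0; apply/eqP.
by rewrite -[\pi _]/(qpi L z) -linearB; apply/LE; rewrite raddfB /= valE.
Qed.

End CohomologyDimension.

(** * Cohomology and regular elements *)

Section Vanishing.
Variables (k : fieldType) (n : nat).
Local Notation S := {mpoly k[n]}.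

Definition cohom_vanishes (C : lmodType S) p : Prop :=
  forall c : cech C, is_cocycle p c -> is_coboundary p c.

Lemma cech_fun_scale (C : lmodType S) (f : S) (c : cech C) :
  cech_fun ( *:%R f : {linear C -> C}) c = f *: c.
Proof.
apply: dprodP => F; change (loc_fun ( *:%R f : {linear C -> C}) (c F) = f *: c F).
by move: (c F) => u; elim/locW: u => x a; rewrite loc_funE fracZ.
Qed.

Lemma cech_scale_inj (C : lmodType S) (f : S) : injective ( *:%R f : C -> C) ->
  injective ( *:%R f : cech C -> cech C).
Proof.
move=> fi c d e; apply: (@cech_fun_inj _ _ _ _ ( *:%R f : {linear C -> C})) => //.
Qed.

Definition quotient_by (C C' : lmodType S) (f : S) (g : {linear C -> C'}) : Prop :=
  [/\ injective ( *:%R f : C -> C), forall y, g y = 0 <-> exists x, f *: x = y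
    & forall z, exists y, g y = z].

Section Step.
Variables (C C' : lmodType S) (f : S) (g : {linear C -> C'}).
Hypothesis hq : quotient_by f g.
Hypothesis mf : max_ideal f.

Lemma quotient_exact : short_exact (@ungraded k n C) (@ungraded k n C) (@ungraded k n C')
  0 ( *:%R f : {linear C -> C}) g.
Proof. by case: hq => h1 h2 h3; split=> // j z _; have [y] := h3 z; exists y. Qed.

Lemma hcocycle_ungraded (N : lmodType S) p (c : cech N) j : is_cocycle p c -> hcocycle (@ungraded k n N) p j c.
Proof. by move=> hc; split=> //; apply: ungraded_cdeg. Qed.

(** A cocycle of degree zero is killed by a power of [f], and [f] acts
    injectively on cochains. *)
Lemma vanishes0_of_regular : cohom_vanishes C 0.
Proof.
move=> c hc; have [N [b [sb /eqP]]] := cech_torsion mf hc.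
have -> : b = 0 by apply: dprodP => F; apply: sb.
rewrite linear0 => /eqP h; suff -> : c = 0 by apply: coboundary0.
case: hq => fi _ _; elim: N h => [|N IHN]; first by rewrite scale1r.
rewrite exprS -scalerA => h; apply: IHN; apply: (cech_scale_inj fi).
by rewrite h scaler0.
Qed.

(** Multiplication by [f] is injective on the next cohomology module, and also
    nilpotent on each of its elements. *)
Lemma vanishes_succ p : cohom_vanishes C' p -> cohom_vanishes C p.+1.
Proof.
move=> hp c hc; have [N] := cech_torsion mf hc; elim: N => [|N IHN].
  by rewrite scale1r.
rewrite exprS -scalerA => h; apply: IHN.
set c' := f ^+ N *: c; have hc' : is_cocycle p.+1 c'.
  case: hc => sc dc; split; last by rewrite (lin_Z (@cech_diff_is_linear k n C)) dc scaler0.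
  by move=> F Fp; rewrite /c' cechZE sc // scaler0.
have tP N' := @ungraded_pregrading k n N'; have tS N' := @ungraded_strict k n N'.
have fc : is_coboundary p.+1 (cech_fun ( *:%R f : {linear C -> C}) c').
  by rewrite cech_fun_scale.
have [w [hw _] hcon] := connecting_exact (tS C) quotient_exact (hcocycle_ungraded 0 hc') fc.
apply: (connecting_image (tP C) (tP C) (tP C') (tS C') quotient_exact
  (hcocycle_ungraded _ hw) hcon (b := 0)).
  by apply: hcocycle_ungraded; split; [|rewrite linear0].
by rewrite linear0 subr0; apply: hp.
Qed.

(** The connecting homomorphism injects the cohomology of the quotient into
    [H^(p+1)(C)], up to what comes from [H^p(C)]. *)
Lemma vanishes_quotient p : cohom_vanishes C p -> cohom_vanishes C p.+1 -> cohom_vanishes C' p.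
Proof.
have tP N' := @ungraded_pregrading k n N'; have tS N' := @ungraded_strict k n N'.
move=> h0 h1 w hw.
have [a ha hcon] := connecting_total (tP C) (tP C) quotient_exact (hcocycle_ungraded (0 + 0) hw).
have [b [hb _] <-] := connecting_coboundary (tP C) (tS C) quotient_exact ha.2 hcon (h1 _ ha.1).
exact/coboundary_fun/h0.
Qed.

End Step.

Lemma seq_mul_cons (C C' : lmodType S) (f : S) (g : {linear C -> C'}) s x :
  quotient_by f g -> seq_mul (f :: s) x <-> seq_mul s (g x).
Proof.
move=> [fi gf gs]; split=> [[y ->]|[y' hy]].
  rewrite big_ord_recl /= linearD /= (_ : g (f *: _) = 0) ?add0r; last by apply/gf; exists (y ord0).
  exists (fun i => g (y (lift ord0 i))); rewrite linear_sum.
  by apply: eq_bigr => i _; rewrite linearZZ.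
have [y yy] := choice gs.
have : g (x - \sum_(i < size s) s`_i *: y (y' i)) = 0.
  rewrite linearB /= hy linear_sum; apply/eqP; rewrite subr_eq0; apply/eqP.
  by apply: eq_bigr => i _; rewrite linearZZ yy.
move/gf => [z hz]; exists (fun i => if unlift ord0 i is Some i' then y (y' i') else z).
rewrite big_ord_recl unlift_none /= (eq_bigr (fun i : 'I_(size s) => s`_i *: y (y' i))).
  by rewrite hz subrK.
by move=> i _; rewrite liftK.
Qed.

Lemma regular_seq_cons (C C' : lmodType S) (f : S) (g : {linear C -> C'}) s :
  quotient_by f g -> regular_seq C (f :: s) <-> regular_seq C' s.
Proof.
move=> hq; case: (hq) => fi gf gs; split.
  move=> [hreg [x hx]]; split; last by exists (g x) => /(seq_mul_cons _ _ hq).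
  move=> i si y'; have [y <-] := gs y'; rewrite -linearZZ => /(seq_mul_cons _ _ hq) h.
  by apply/(seq_mul_cons _ _ hq); apply: (hreg i.+1).
move=> [hreg [x' hx]]; split; last first.
  by have [x xx] := gs x'; exists x => /(seq_mul_cons _ _ hq); rewrite xx.
move=> [|i] si y /=; last first.
  move/(seq_mul_cons _ _ hq); rewrite linearZZ => h; apply/(seq_mul_cons _ _ hq).
  exact: hreg h.
rewrite /= => -[z]; rewrite big_ord0 => h; exists z; rewrite big_ord0.
by apply: fi; rewrite h scaler0.
Qed.

Lemma quotient_exists (C : lmodType S) (f : S) : injective ( *:%R f : C -> C) ->
  exists (C' : lmodType S) (g : {linear C -> C'}), quotient_by f g.
Proof.
move=> fi; have hU : submod_closed [pred y : C | `[< exists x, f *: x = y >]].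
  split=> [|a u v]; first by apply/asboolP; exists 0; rewrite scaler0.
  move=> /asboolP[x <-] /asboolP[y <-]; apply/asboolP; exists (a *: x + y).
  by rewrite scalerDr !scalerA mulrC.
exists (quotmod (Submodule hU)), (qpi (Submodule hU)); split=> //.
  by move=> y; rewrite qpi_eq0; split=> [/asboolP|h]; [|apply/asboolP].
by move=> z; apply: qpi_surj.
Qed.

Lemma regular_inj (C : lmodType S) f s : regular_seq C (f :: s) -> injective ( *:%R f : C -> C).
Proof.
move=> [/(_ 0%N isT)/= h _] x y /eqP; rewrite -subr_eq0 -scalerBr => /eqP e.
have [|z] := h (x - y); first by exists (fun=> 0); rewrite big_ord0.
by rewrite big_ord0 => /eqP; rewrite subr_eq0 => /eqP.
Qed.

(** Each regular element raises by one the bound below which the cohomology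
    vanishes. *)
Lemma regular_seq_vanishes (C : lmodType S) s p : (forall f, f \in s -> max_ideal f) ->
  regular_seq C s -> (p < size s)%N -> cohom_vanishes C p.
Proof.
elim: s C p => // f s IHs C p hs hr ps.
have [C' [g hq]] := quotient_exists (regular_inj hr).
have mf : max_ideal f by apply: hs; apply: mem_head.
case: p ps => [|p] ps; first exact: vanishes0_of_regular hq mf.
apply: (vanishes_succ hq mf); apply: IHs => //; last exact/(regular_seq_cons _ hq).
by move=> h hh; apply: hs; rewrite inE hh orbT.
Qed.

End Vanishing.

(** * Iterated differences *)

Section Delta.

Lemma Delta_ext t h h' : (forall j, h j = h' j) -> forall j, Delta t h j = Delta t h' j.
Proof. by move=> e; elim: t => [|t IHt] j //=; rewrite !IHt. Qed.

(** The last difference may be taken first; chains of quotients provide the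
    differences from the inside. *)
Lemma Delta_succ t h j : Delta t.+1 h j = Delta t (fun l => h l - h (l + 1)) j.
Proof.
elim: t j => [|t IHt] j //; rewrite [LHS]/= -/(Delta t.+1 h j) -/(Delta t.+1 h (j + 1)).
by rewrite !IHt.
Qed.

Lemma Delta_shift t h m j : Delta t (fun l => h (l + m)) j = Delta t h (j + m).
Proof. by elim: t j => [|t IHt] j //=; rewrite !IHt addrAC. Qed.

Lemma Delta0 t j : Delta t (fun=> 0) j = 0.
Proof. by elim: t j => [|t IHt] j //=; rewrite !IHt subrr. Qed.

End Delta.

(** * Cohen-Macaulay modules through linear parameters *)

Section Chain.
Variables (k : fieldType) (n : nat).
Local Notation S := {mpoly k[n]}.

Lemma linform_homog (a : 'I_n -> k) : linform a \is 1.-homog.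
Proof.
rewrite /linform; apply: rpred_sum => i _.
by rewrite mul_mpolyC; apply/dhomogZ/mvar_homog.
Qed.

Lemma linform_max (a : 'I_n -> k) : max_ideal (linform a).
Proof. by exists (fun i => (a i)%:MP). Qed.

Lemma gr_comp_hcomp (M : gradedModule k n) j (x : M) :
  (forall l, l != j -> hcomp l x = 0) -> gr_comp j x.
Proof.
move=> h; pose u := undup (j :: degs x).
have -> : x = hcomp j x; last exact: hcomp_comp.
rewrite {1}(@hcomp_sum _ _ _ u x) ?undup_uniq //; last first.
  by move=> l hl; rewrite mem_undup inE hl orbT.
rewrite (bigD1_seq j) ?undup_uniq ?mem_undup ?mem_head //= big1 ?addr0 //.
Qed.

Definition gr_quotient_by (C C' : gradedModule k n) (a : 'I_n -> k) (g : {linear C -> C'}) : Prop :=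
  [/\ quotient_by (linform a) g, forall j y, gr_comp j y -> gr_comp j (g y)
    & forall j z, gr_comp j z -> exists2 y, gr_comp j y & g y = z].

(** A homogeneous nonzerodivisor reflects degrees, since it acts on the
    components separately. *)
Lemma gr_quotient_exact (C C' : gradedModule k n) a (g : {linear C -> C'}) :
  gr_quotient_by a g -> short_exact (@gr_comp k n C) (@gr_comp k n C) (@gr_comp k n C')
    1 ( *:%R (linform a) : {linear C -> C}) g.
Proof.
move=> [[fi gf gs] g1 g2]; split=> // j x; split=> [h|]; last exact: gr_compZ (linform_homog a).
apply: gr_comp_hcomp => l lj; apply: fi; rewrite scaler0.
rewrite -(hcompZ _ _ (linform_homog a)) (hcomp_id _ h) ifN //.
by apply: contra lj => /eqP/addIr ->.
Qed.

(** A chain of quotients by linear nonzerodivisors ending in a module of finite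
    length, whose Hilbert function is recorded. *)
Inductive cm_chain : nat -> gradedModule k n -> (int -> nat) -> Prop :=
| cm_chain0 (C : gradedModule k n) h :
    (forall (x : C) i, exists N, 'X_i ^+ N *: x = 0) ->
    (forall j, reldim (@gr_comp k n C j) (h j) [set 0]) ->
    (exists j0 : int, forall j : int, j0 < j -> h j = 0%N) -> cm_chain 0 C h
| cm_chainS d a (C C' : gradedModule k n) (g : {linear C -> C'}) h :
    gr_quotient_by a g -> cm_chain d C' h -> cm_chain d.+1 C h.

Lemma loc_torsion0 (C : lmodType S) (F : {set 'I_n}) :
  (forall (x : C) i, exists N, 'X_i ^+ N *: x = 0) -> F != finset.set0 ->
  forall u : loc C (xprod k F), u = 0.
Proof.
move=> tor /set0Pn[i iF]; elim/locW=> x a; have [N hN] := tor x i.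
apply/frac_eq0; exists N; rewrite (xprodD1 k iF) exprMn -scalerA hN.
by rewrite scaler0.
Qed.

Lemma ksub0 (N : lmodType S) : is_ksub [set 0 : N].
Proof. by split=> // c x y -> ->; rewrite scaler0 addr0. Qed.

Lemma gr_comp_ksub (M : gradedModule k n) j : is_ksub (@gr_comp k n M j).
Proof.
split=> [|c x y hx hy]; first exact: gr_comp0.
apply: gr_compD => //; rewrite -[j]addr0.
by apply: (@gr_compZ _ _ M 0) => //; apply: mpolyC_homog.
Qed.

(** For torsion modules all proper localizations vanish, and the Cech complex is
    the module itself in degree zero. *)
Lemma torsion_vanishes (C : lmodType S) p :
  (forall (x : C) i, exists N, 'X_i ^+ N *: x = 0) -> p <> 0%N -> cohom_vanishes C p.
Proof.
move=> tor p0 c [sc dc]; suff -> : c = 0 by apply: coboundary0.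
apply: dprodP => F; have [F0|F0] := eqVneq F finset.set0; last exact: (loc_torsion0 tor F0).
by apply: sc => e; apply: p0; rewrite -e F0 cards0.
Qed.

(** An element of the module is turned into the cochain of its fractions with
    denominator one, which vanishes away from the empty set. *)
Lemma torsion_cohom_dim (C : gradedModule k n) j d :
  (forall (x : C) i, exists N, 'X_i ^+ N *: x = 0) ->
  reldim (@gr_comp k n C j) d [set 0] -> cohom_dim C 0 j d.
Proof.
move=> tor; have x0 : xprod k (finset.set0 : {set 'I_n}) = 1 by rewrite /xprod big_set0.
pose emb (x : C) : cech C := fun F => frac (xprod k F) x 0.
have embD (c : k) x y : emb (c%:MP *: x + y) = c%:MP *: emb x + emb y.
  by apply: dprodP => F; rewrite dprodDZE /emb fracZ fracD !expr0 !scale1r.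
apply: (reldim_rel (R := fun x c => c = emb x)).
- exact: gr_comp_ksub.
- exact/hcocycle_ksub/gr_pregrading.
- by move=> c w w' a a' -> ->; rewrite embD.
- move=> x hx; exists (emb x) => //; split; last first.
    by move=> F; exists x, 0%N; rewrite mul0n addr0.
  split=> [F F0|]; first by apply: loc_torsion0 => //; apply/eqP => e; apply: F0; rewrite e cards0.
  apply: dprodP => G; rewrite /cech_diff big1 // => i iG.
  rewrite (_ : loc_map _ _ _ = 0) ?scaler0 //; apply: (loc_torsion0 tor).
  by apply/set0Pn; exists i.
- move=> c [[sc dc] hc]; have [x [a [hx cx]]] := hc finset.set0.
  exists x; first by rewrite cards0 muln0 addr0 in hx.
  apply: dprodP => F; have [->|F0] := eqVneq F finset.set0; last first.
    by rewrite (loc_torsion0 tor F0 (c F)) (loc_torsion0 tor F0 (emb x F)).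
  rewrite cx /emb; apply/fracP; exists 0%N.
  by rewrite x0 !expr1n.
move=> x _ hx _ ->; split=> [->|[b [sb e]]].
  suff -> : emb 0 = 0 by apply: coboundary0.
  by apply: dprodP => F; apply/frac_eq0; exists 0%N; rewrite scaler0.
have b0 : b = 0 by apply: dprodP => F; apply: sb.
have : emb x finset.set0 = 0 by rewrite e b0 linear0.
by rewrite /emb => /frac_eq0[t]; rewrite x0 expr1n scale1r.
Qed.

Lemma cohom_dim_unique (C : gradedModule k n) p j d d' :
  cohom_dim C p j d -> cohom_dim C p j d' -> d = d'.
Proof. by move=> /cohom_dim_kdim <- /cohom_dim_kdim <-. Qed.

Section ChainStep.
Variables (C C' : gradedModule k n) (a : 'I_n -> k) (g : {linear C -> C'}).
Hypothesis hq : gr_quotient_by a g.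
Variables (d : nat).
Hypothesis van : forall p, p <> d -> cohom_vanishes C' p.

Lemma chain_vanishes p : p <> d.+1 -> cohom_vanishes C p.
Proof.
have [q _ _] := hq; have mf := linform_max a.
case: p => [_|p pd]; first exact: vanishes0_of_regular q mf.
by apply: (vanishes_succ q mf); apply: van => e; apply: pd; rewrite e.
Qed.

Let pre N := @gr_pregrading k n N.
Let str N := @gr_strict k n N.
Let ex := gr_quotient_exact hq.

(** In degrees where the cohomology of [C'] vanishes the linear form acts
    injectively; it is nilpotent on every class. *)
Lemma chain_top (j0 : int) : (forall j : int, j0 < j -> cohom_dim C' d j 0) ->
  forall j : int, j0 <= j -> cohom_dim C d.+1 j 0.
Proof.
move=> top j jj c hc; have [N hN] := cech_torsion (linform_max a) hc.1.
elim: N j jj c hc hN => [|N IHN] j jj c hc; first by rewrite scale1r.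
rewrite exprSr -scalerA => hN.
have : is_coboundary d.+1 (linform a *: c).
  apply: (IHN (j + 1)) => //; first by apply: le_trans jj _; rewrite lerDl.
  rewrite -cech_fun_scale; split; first exact: cocycle_fun hc.1.
  by have := cdeg_f ex hc.2.
rewrite -cech_fun_scale => fc; have [w hw hcon] := connecting_exact (@str C) ex hc fc.
apply: (connecting_image (pre C) (pre C) (pre C') (@str C') ex hw hcon (b := 0)).
  by case: (hcocycle_ksub d (j + 1) (pre C)).
rewrite linear0 subr0; apply: (top (j + 1)) hw.
by apply: le_lt_trans jj _; rewrite ltrDl.
Qed.

(** From the exact sequence [0 -> H^d(C')_(j+1) -> H^(d+1)(C)_j ->
    H^(d+1)(C)_(j+1) -> 0]. *)
Lemma chain_dim j m m' : cohom_dim C' d (j + 1) m -> cohom_dim C d.+1 (j + 1) m' ->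
  cohom_dim C d.+1 j (m + m').
Proof.
move=> h1 h2; pose f := cech_fun ( *:%R (linform a) : {linear C -> C}) : {linear cech C -> cech C}.
have vanC : cohom_vanishes C d by apply: chain_vanishes; lia.
apply: (@reldim_exact _ _ _ _ f) h2.
- exact/hcocycle_ksub/pre.
- exact: coboundary_ksub.
- exact/hcocycle_ksub/pre.
- exact: coboundary_ksub.
- by move=> x [cx dx]; split; [apply: cocycle_fun | have := cdeg_f ex dx].
- by move=> x; apply: coboundary_fun.
- move=> y hy; have hgy : is_coboundary d.+1 (cech_fun g y).
    by apply: van; [lia | apply: cocycle_fun hy.1].
  by have [x hx hxy] := middle_exact (pre C) (pre C) (@str C') ex hy hgy; exists x.
apply: (reldim_rel (R := connecting (@gr_comp k n C) 1 ( *:%R (linform a) : {linear C -> C}) g d j)) h1.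
- exact/hcocycle_ksub/pre.
- split; first by split; [case: (hcocycle_ksub d.+1 j (pre C)) | rewrite /mkset linear0; apply: coboundary0].
  move=> c x y [hx kx] [hy ky]; split; first by apply: (hcocycle_ksub d.+1 j (pre C)).2.
  by rewrite /mkset linearD linearZZ; apply: coboundaryZD.
- move=> c w w' x x' [b [sb hb gb db]] [b' [sb' hb' gb' db']].
  exists (c%:MP *: b + b'); split; first exact: suppP.
  + apply: cdegD => //; rewrite -[j + 1]addr0.
    by apply: (@cdegZ _ _ _ _ (pre C) _ 0) => //; apply: mpolyC_homog.
  + by rewrite (cech_fun_is_linear g c%:MP b b') gb gb'.
  + rewrite (cech_diff_is_linear c%:MP b b') db db'.
    by rewrite (cech_fun_is_linear _ c%:MP x x').
- move=> w hw; have [x hx hcon] := connecting_total (pre C) (pre C) ex hw.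
  exists x => //; split=> //; case: hcon => b [sb hb gb db].
  by rewrite /mkset /f /= -db; exists b; split=> // F Fp; apply: sb => e; apply: Fp; rewrite e.
- move=> x [hx kx]; exact: (connecting_exact (@str C) ex hx kx).
move=> w x hw [hx kx] hcon; split=> [wb|xb].
  apply: (connecting_image (pre C) (pre C) (pre C') (@str C') ex hw hcon (b := 0)).
    by case: (hcocycle_ksub d (j + 1) (pre C)).
  by rewrite linear0 subr0.
have [b [hb _] <-] := connecting_coboundary (pre C) (@str C) ex hx.2 hcon xb.
exact/coboundary_fun/vanC.
Qed.

End ChainStep.

(** Finiteness of the dimensions comes by descending induction on the degree,
    starting where the cohomology vanishes. *)
Theorem cm_chain_cohomology d (C : gradedModule k n) h : cm_chain d C h ->
  (forall p, p <> d -> cohom_vanishes C p) /\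
  exists H : int -> nat, [/\ forall j, cohom_dim C d j (H j),
    forall j, Delta d (fun l => (H l)%:R) j = (h (j + d%:Z))%:R
    & exists j0 : int, forall j : int, j0 < j -> H j = 0%N].
Proof.
elim=> {d C h} [C h tor hdim fin|d a C C' g h hq _ [van [H [dimH DH [j0 topH]]]]].
  split; first by move=> p p0; apply: torsion_vanishes.
  exists h; split=> // j; last by rewrite /= addr0.
  exact: torsion_cohom_dim.
split; first by move=> p; apply: (chain_vanishes hq van).
have top (j : int) : j0 <= j -> cohom_dim C d.+1 j 0.
  by apply: (chain_top hq) => l /topH <-.
have fin (j : int) : exists m, cohom_dim C d.+1 j m.
  have [jj|/ltW jj] := leP j0 j; first by exists 0%N; apply: top.
  have [N ->] : exists N : nat, j = j0 - N%:Z by exists `|j0 - j|%N; lia.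
  elim: N => [|N [m hm]]; first by exists 0%N; rewrite subr0; apply: top.
  exists (H (j0 - N.+1%:Z + 1)%R + m)%N; apply: (chain_dim hq van (dimH _)).
  by have -> : j0 - N.+1%:Z + 1 = j0 - N%:Z by lia.
have [K hK] := choice fin; exists K; split=> //.
  move=> j; rewrite Delta_succ (@Delta_ext _ _ (fun l => (H (l + 1))%:R)) => [|l].
    by rewrite (Delta_shift d (fun l => (H l)%:R)) DH; congr (h _)%:R; lia.
  rewrite (cohom_dim_unique (hK l) (chain_dim hq van (dimH (l + 1)) (hK (l + 1)))).
  by rewrite natrD addrK.
by exists j0 => j /ltW/top; apply: cohom_dim_unique.
Qed.

End Chain.

(** * From depth and dimension to linear parameters *)

Section Kspan.
Variables (k : fieldType) (n : nat).
Local Notation S := {mpoly k[n]}.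

Lemma kspan_ksub (N : lmodType S) (s : seq N) B : is_ksub B -> is_ksub (kspan s B).
Proof. by elim: s B => //= g s IHs B hB; apply/IHs/add_line_ksub. Qed.

Lemma sub_kspan (N : lmodType S) (s : seq N) B : is_ksub B -> B `<=` kspan s B.
Proof.
elim: s B => [|g s IHs] B hB x Bx //=; apply: IHs; first exact: add_line_ksub.
exact: sub_add_line.
Qed.

Lemma mem_kspan (N : lmodType S) (s : seq N) B g : is_ksub B -> g \in s -> kspan s B g.
Proof.
elim: s B => //= h s IHs B hB; rewrite inE => /predU1P[->|hg]; last first.
  by apply: IHs => //; apply: add_line_ksub.
apply: sub_kspan; first exact: add_line_ksub.
by exists 1; rewrite mpolyC1 scale1r subrr; case: hB.
Qed.

Lemma kspan_map (N N' : lmodType S) (f : N -> N') (s : seq N) B B' x :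
  (forall (c : k) x y, f (x - c%:MP *: y) = f x - c%:MP *: f y) ->
  (forall x, B x -> B' (f x)) -> kspan s B x -> kspan (map f s) B' (f x).
Proof.
move=> fl; elim: s B B' => [|g s IHs] B B' fB /=; first exact: fB.
by apply: IHs => y [c /fB]; rewrite fl; exists c.
Qed.

Lemma kspan_zero (N : lmodType S) (s : seq N) : (forall x, x \in s -> x = 0) ->
  kspan s [set 0] `<=` [set 0].
Proof.
elim: s => [|g s IHs] hs //=; rewrite (hs g (mem_head _ _)) (add_line_id (@ksub0 k n N)) //.
by apply: IHs => x hx; apply: hs; rewrite inE hx orbT.
Qed.

End Kspan.

Section FiniteLength.
Variables (k : fieldType) (n : nat) (C : gradedModule k n).
Local Notation S := {mpoly k[n]}.

(** Terms of positive degree move [x] out of the component of degree [j]. *)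
Lemma hcomp_scale (s : S) j (x : C) : gr_comp j x -> hcomp j (s *: x) = (s@_0%MM)%:MP *: x.
Proof.
move=> hx.
have term (m : 'X_{1..n}) : hcomp j ((s@_m)%:MP * 'X_[m] *: x) =
    if m == 0%MM then (s@_0%MM)%:MP *: x else 0.
  have hm : ((s@_m)%:MP * 'X_[m] : S) \is (mdeg m).-homog.
    by rewrite mul_mpolyC; apply: dhomogZ; rewrite dhomogX.
  rewrite (hcomp_id _ (gr_compZ hm hx)); have [->|m0] := eqVneq m 0%MM.
    by rewrite mdeg0 addr0 eqxx mpolyX0 mulr1.
  rewrite ifN // -subr_eq0 opprD addrA subrr sub0r oppr_eq0.
  by rewrite -lt0n lt0n mdeg_eq0.
rewrite {1}[s]mpolyE scaler_suml raddf_sum /=.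
under eq_bigr do rewrite -mul_mpolyC term.
have [s0|s0] := boolP (0%MM \in msupp s).
  rewrite (bigD1_seq _ s0 (msupp_uniq s)) /= eqxx big1 ?addr0 // => m /negbTE ->.
  by [].
rewrite (memN_msupp_eq0 s0) mpolyC0 scale0r big_seq big1 // => m ms.
by case: eqP => // m0; rewrite -m0 ms in s0.
Qed.

(** If [x_i] is not nilpotent modulo the annihilator, then neither is it after
    inverting all polynomials with nonzero constant term, because the
    annihilator is homogeneous. This gives a prime inside the maximal ideal and
    without [x_i], so a chain of length one. *)
Lemma finite_length_torsion :
  (forall e (P : 'I_e.+1 -> prime_idealr S), prime_chain C P -> (e <= 0)%N) ->
  forall i, exists N, forall x : C, 'X_i ^+ N *: x = 0.
Proof.
move=> hdim i; apply: contrapT => hn.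
(* Avoiding [T] means to avoid the powers of [x_i] and to stay inside the
   maximal ideal. *)
pose T : set S := [set f | exists a s, f = 'X_i ^+ a * s /\ s@_0%MM != 0].
have hI : is_subm (annihilator C : set S^o).
  split=> [x|a f g hf hg x]; first by rewrite scale0r.
  by rewrite scalerDl -scalerA hf hg scaler0 addr0.
have [||| P [IP PT]] := @prime_avoiding S (annihilator C) T (@mpoly_noetherian k n) hI.
- by exists 0%N, 1; rewrite mulr1 mcoeff1 eqxx oner_eq0.
- move=> _ _ [a [s [-> s0]]] [b [t [-> t0]]]; exists (a + b)%N, (s * t).
  by rewrite rmorphM mulf_neq0 // exprD; split=> //; ring.
- move=> f hf [a [s [e s0]]]; apply: hn; exists a => x.
  rewrite [x](@hcomp_sum _ _ _ (undup (degs x)) x) ?undup_uniq //; last by move=> l; rewrite mem_undup.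
  rewrite scaler_sumr big1 // => j _.
  have hX : ('X_i ^+ a : S) \is (1 * a).-homog by apply/dhomogMn/mvar_homog.
  have := hf (hcomp j x); rewrite e -scalerA => /(congr1 (hcomp (j + (1 * a)%N))).
  rewrite (hcompZ _ _ hX) raddf0 (hcomp_scale _ (hcomp_comp j x)) => h.
  have := congr1 (fun y => ((s@_0%MM)^-1)%:MP *: y) h; rewrite scaler0 !scalerA.
  by rewrite mulrCA -mpolyCM mulVf // mulr1.
have [||| Q hQ] := @prime_ideal_of S [set s : S | s@_0%MM = 0].
- split=> [|a x y]; rewrite /mkset ?mcoeff0 // => hx hy.
  by rewrite mcoeffD rmorphM /= hx hy mulr0 addr0.
- by rewrite /mkset mcoeff1 eqxx => /eqP; rewrite oner_eq0.
- by move=> u v; rewrite /mkset rmorphM => /eqP; rewrite mulf_eq0 => /orP[] /eqP; [left|right].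
have PQ f : f \in P -> f \in Q.
  move=> fP; apply/hQ; apply: contrapT => /eqP nf; apply: (PT f fP).
  by exists 0%N, f; rewrite mul1r.
have nX : 'X_i \notin P.
  by apply/negP => /PT; apply; exists 1%N, 1; rewrite mulr1 mcoeff1 eqxx oner_eq0.
have XQ : 'X_i \in Q.
  by apply/hQ; rewrite /mkset mcoeffX; case: eqP => // /(congr1 mdeg); rewrite mdeg1 mdeg0.
pose ch (i : 'I_2) : prime_idealr S := if i == ord0 then P else Q.
suff /hdim : prime_chain C ch by [].
split=> [l f /IP fP|[[|[]]// ?] [[|[]]// ?]] //=.
  by rewrite /ch /mkset; case: ifP => // _; apply: PQ.
by move=> _; split; [exact: PQ | move=> /(_ _ XQ); rewrite /mkset /ch /= (negbTE nX)].
Qed.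

Lemma bounded_seq (s : seq int) : exists j0 : int, forall l, l \in s -> l <= j0.
Proof.
elim: s => [|a s [j0 hj]]; first by exists 0.
exists (Num.max a j0) => l; rewrite inE le_max => /predU1P[->|/hj ->].
  by rewrite lexx.
by rewrite orbT.
Qed.

(** Over the field such a module is spanned by the finitely many multiples of
    its generators by monomials with bounded exponents. *)
Lemma finite_length_chain : fin_gen C ->
  (forall i, exists N, forall x : C, 'X_i ^+ N *: x = 0) ->
  exists h, cm_chain 0 C h.
Proof.
move=> [r [g hg]] tor; have [T hT] := choice tor.
(* Monomials of degree [K] have some exponent at least [N]. *)
pose N := (\max_i T i)%N; pose K := (n * N).+1.
have big (m : 'X_{1..n}) (x : C) : (K <= mdeg m)%N -> 'X_[m] *: x = 0.
  move=> hm; have [i hi] : exists i, (N <= m i)%N.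
    apply: contrapT => h; move: hm; apply/negP; rewrite -ltnNge ltnS mdegE.
    rewrite -[n in (n * _)%N]card_ord -sum_nat_const; apply: leq_sum => i _.
    by rewrite leqNgt; apply/negP => /ltnW hi; apply: h; exists i.
  have Ti : (T i <= m i)%N by apply: leq_trans hi; apply: leq_bigmax.
  by rewrite mpolyXE_id (bigD1 i) //= -(subnK Ti) exprD mulrC mulrA -scalerA hT scaler0.
pose L : seq C := [seq 'X_[bmnm p.1] *: g p.2 | p : 'X_{1..n < K} * 'I_r].
have span x : kspan L [set 0] x.
  have hL := kspan_ksub L (@ksub0 k n C).
  have [c ->] := hg x; apply: (ksub_sum _ hL) => t.
  rewrite [c t]mpolyE scaler_suml; apply: (ksub_sum _ hL) => m.
  rewrite -mul_mpolyC -scalerA; apply: (ksubZ _ hL).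
  case: (ltnP (mdeg m) K) => hm; last by rewrite big //; case: hL.
  apply: mem_kspan; first exact: ksub0.
  exact: (map_f (fun p : 'X_{1..n < K} * 'I_r => 'X_[bmnm p.1] *: g p.2)
    (mem_enum _ (BMultinom hm, t))).
have hcompL j x : kspan (map (hcomp j) L) [set 0] (hcomp j x).
  apply: (kspan_map (B := [set 0])) (span x) => [c y z|y ->]; last by rewrite raddf0.
  by rewrite raddfB /= -{1}[j]addr0 -(hcompZ _ _ (mpolyC_homog n c)) addr0.
have dims j : exists d, reldim (@gr_comp k n C j) d [set 0].
  apply: (@reldim_exists _ _ _ _ _ (map (hcomp j) L)); first exact: ksub0.
    by move=> _ /mapP[y _ ->]; apply: hcomp_comp.
  by move=> x hx; have := hcompL j x; rewrite (hcomp_id _ hx) eqxx.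
have [h hh] := choice dims; exists h; apply: cm_chain0 => //.
  by move=> x i; exists (T i).
have [j0 hj0] := bounded_seq (flatten (map (@degs k n C) L)).
exists j0 => j jj; have := hh j; case: (h j) => // d /= [z [hz nz _]]; case: nz.
have := hcompL j z; rewrite (hcomp_id _ hz) eqxx; apply: kspan_zero.
move=> _ /mapP[y yL ->]; apply: hcomp_out; apply/negP => jy.
have /hj0 : j \in flatten (map (@degs k n C) L) by apply/flattenP; exists (degs y) => //; apply: map_f.
by rewrite leNgt jj.
Qed.

End FiniteLength.

Section CohenMacaulayChain.
Variables (k : fieldType) (n : nat).
Local Notation S := {mpoly k[n]}.

(** An element killed by all variables is a cocycle of degree zero. *)
Lemma vanishes_socle (C : lmodType S) (x : C) : cohom_vanishes C 0 ->
  (forall i, 'X_i *: x = 0) -> x = 0.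
Proof.
move=> van hx; have x0 : xprod k (finset.set0 : {set 'I_n}) = 1 by rewrite /xprod big_set0.
pose c : cech C := fun F => frac (xprod k F) x 0.
have c0 F : F != finset.set0 -> c F = 0.
  move=> /set0Pn[i iF]; apply/frac_eq0; exists 1%N.
  by rewrite expr1 (xprodD1 k iF) -scalerA hx scaler0.
have [|b [sb e]] := van c.
  split=> [F F0|]; first by apply: c0; apply/eqP => e; apply: F0; rewrite e cards0.
  apply: dprodP => G; rewrite /cech_diff big1 // => i iG.
  rewrite /c (loc_mapE (xprodD1 k iG)) expr0 scale1r -/(c G) c0 ?scaler0 //.
  by apply/set0Pn; exists i.
have b0 : b = 0 by apply: dprodP => F; apply: sb.
have : c finset.set0 = 0 by rewrite e b0 linear0.
by rewrite /c => /frac_eq0[t]; rewrite x0 expr1n scale1r.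
Qed.

(** A chain of primes over [C / f C] extends below to a chain over [C], because
    a nonzerodivisor avoids the primes minimal over the annihilator. *)
Lemma prime_chain_quotient (C C' : lmodType S) (f : S) (g : {linear C -> C'}) e
    (P : 'I_e.+1 -> prime_idealr S) :
  quotient_by f g -> prime_chain C' P ->
  exists Q : 'I_e.+2 -> prime_idealr S, prime_chain C Q.
Proof.
move=> [fi gf gs] [PI Plt].
(* A prime avoiding [T] lies inside [P ord0] and does not contain [f]. *)
pose T : set S := [set t | exists a s, t = f ^+ a * s /\ s \notin P ord0].
have hI : is_subm (annihilator C : set S^o).
  split=> [x|a u v hu hv x]; first by rewrite scale0r.
  by rewrite scalerDl -scalerA hu hv scaler0 addr0.
have CC' s : annihilator C s -> annihilator C' s.
  by move=> hs z; have [y <-] := gs z; rewrite -linearZZ hs linear0.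
have fC' : annihilator C' f.
  by move=> z; have [y <-] := gs z; rewrite -linearZZ; apply/gf; exists y.
have [||| P' [IP' PT']] := @prime_avoiding S (annihilator C) T (@mpoly_noetherian k n) hI.
- by exists 0%N, 1; rewrite mulr1 idealr1.
- move=> _ _ [a [s [-> hs]]] [b [t [-> ht]]]; exists (a + b)%N, (s * t).
  by rewrite exprD prime_idealrM negb_or hs ht; split=> //; ring.
- move=> t ht [a [s [e' hs]]]; move/negP: hs; apply; apply: (PI ord0); apply: CC' => x.
  have {ht} := ht x; rewrite e' -scalerA; elim: a {e'} => [|a IHa]; first by rewrite scale1r.
  by rewrite exprS -scalerA => h; apply: IHa; apply: fi; rewrite h scaler0.
have sub : [set x | x \in P'] `<` [set x | x \in P ord0].
  split=> [x xP'|]; rewrite /mkset.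
    by apply: contrapT => /negP nx; apply: (PT' x xP'); exists 0%N, x; rewrite mul1r.
  move=> h; apply: (PT' f); last by exists 1%N, 1; rewrite mulr1 idealr1.
  exact: h (PI ord0 _ fC').
exists (fun i => if unlift ord0 i is Some i' then P i' else P').
split=> [i t ht|i j]; first by case: unliftP => [i' _|_]; [apply: PI; apply: CC' | apply: IP'].
case: (unliftP ord0 j) => [j' ->|->]; last by rewrite ltn0.
case: (unliftP ord0 i) => [i' ->|-> _]; first by rewrite ltnS; apply: Plt.
have [->//|j0] := eqVneq j' ord0.
have lt : [set x | x \in P ord0] `<` [set x | x \in P j'].
  by apply: Plt; rewrite lt0n; apply: contra j0 => /eqP h; apply/eqP/val_inj.
split; first exact: subset_trans (proj1 sub) (proj1 lt).
by move=> h; apply: (proj2 sub); apply: subset_trans (proj1 lt) h.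
Qed.

Lemma gr_quotient_exists (C : gradedModule k n) (a : 'I_n -> k) :
  injective ( *:%R (linform a) : C -> C) ->
  exists (C' : gradedModule k n) (g : {linear C -> C'}), gr_quotient_by a g.
Proof.
move=> fi; have hU : submod_closed [pred y : C | `[< exists x, linform a *: x = y >]].
  split=> [|b u v]; first by apply/asboolP; exists 0; rewrite scaler0.
  move=> /asboolP[x <-] /asboolP[y <-]; apply/asboolP; exists (b *: x + y).
  by rewrite scalerDr !scalerA mulrC.
pose U := Submodule hU.
have gU : graded_submod U.
  move=> y /asboolP[x xy]; exists (undup (degs y)), (fun j => hcomp j y).
  split; first exact: undup_uniq; last first.
    by apply: hcomp_sum; [apply: undup_uniq | move=> l; rewrite mem_undup].
  move=> j; split; first exact: hcomp_comp.
  apply/asboolP; exists (hcomp (j - 1) x).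
  by rewrite -(hcompZ _ _ (linform_homog a)) xy subrK.
exists (gquot gU), (qpi U); split; last 2 first.
- by move=> j y hy; exists y.
- by move=> j z [y hy <-]; exists y.
split=> //; last by move=> z; apply: qpi_surj.
by move=> y; rewrite qpi_eq0; split=> [/asboolP|h]; [|apply/asboolP].
Qed.

(** If [C] is nonzero, it has no socle, and [linear_regular] applies; the
    hypotheses pass to the quotient with [d] for [d.+1]. *)
Lemma cm_chain_exists d (C : gradedModule k n) : infinite_set [set: k] -> noetherian C ->
  (forall p, (p < d)%N -> cohom_vanishes C p) ->
  (forall e (P : 'I_e.+1 -> prime_idealr S), prime_chain C P -> (e <= d)%N) ->
  exists h, cm_chain d C h.
Proof.
move=> hk; elim: d C => [|d IHd] C hC van hdim.
  exact: finite_length_chain (noetherian_fin_gen hC) (finite_length_torsion hdim).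
have [a fi] : exists a : 'I_n -> k, injective ( *:%R (linform a) : C -> C).
  have [[x x0]|h] := pselect (exists x : C, x != 0).
    have [|y|a ha] := @linear_regular k n C hk hC; first by exists x.
      by apply: vanishes_socle; apply: van.
    exists a => y z /eqP; rewrite -subr_eq0 -scalerBr => /eqP /ha /eqP.
    by rewrite subr_eq0 => /eqP.
  (* On the zero module every form is injective. *)
  have {}h (x : C) : x = 0 by apply: contrapT => /eqP x0; apply: h; exists x.
  by exists (fun=> 0) => x y _; rewrite (h x) (h y).
have [C' [g hq]] := gr_quotient_exists fi; have [q _ _] := hq.
have mf := linform_max a.
have [|||h hh] := IHd C'.
- by apply: (@noetherian_surj _ _ _ g) => // z; case: q => _ _ /(_ z)[y <-]; exists y.
- by move=> p pd; apply: (vanishes_quotient q); apply: van; rewrite // ltnW.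
- by move=> e P /(prime_chain_quotient q)[Q /hdim].
by exists h; apply: cm_chainS hq hh.
Qed.

Lemma cohen_macaulay_chain (C : gradedModule k n) : infinite_set [set: k] -> noetherian C ->
  cohen_macaulay C -> exists d, has_dim C d /\ exists h, cm_chain d C h.
Proof.
move=> hk hC [d [[hd hdim] [[s [ss sm sr]] _]]]; exists d; split=> //.
apply: cm_chain_exists => // p pd.
by apply: (regular_seq_vanishes sm sr); rewrite ss.
Qed.

End CohenMacaulayChain.

(** * Sequentially Cohen-Macaulay modules *)

Section ExactDimensions.
Variables (k : fieldType) (n : nat).
Local Notation S := {mpoly k[n]}.
Variables (A B C : gradedModule k n) (f : {linear A -> B}) (g : {linear B -> C}).
Hypothesis ex : short_exact (@gr_comp k n A) (@gr_comp k n B) (@gr_comp k n C) 0 f g.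

Let pre N := @gr_pregrading k n N.
Let str N := @gr_strict k n N.

(** [H^p(A)] and [H^p(B)] agree when the neighbouring terms [H^(p-1)(C)] and
    [H^p(C)] vanish. *)
Lemma cohom_dim_left p j d : cohom_vanishes C p -> (forall q, p = q.+1 -> cohom_vanishes C q) ->
  cohom_dim A p j d -> cohom_dim B p j d.
Proof.
move=> vp vq; have ha (a : cech A) : hcocycle (@gr_comp k n A) p j a ->
    hcocycle (@gr_comp k n B) p j (cech_fun f a).
  by move=> [ca da]; split; [apply: cocycle_fun | have := cdeg_f ex da; rewrite addr0].
apply: (reldim_rel (R := fun a b => is_coboundary p (b - cech_fun f a))).
- exact/hcocycle_ksub/pre.
- exact/hcocycle_ksub/pre.
- move=> c w w' x x' h h'; have := coboundaryZD c%:MP h h'; congr (is_coboundary _ _).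
  by rewrite (cech_fun_is_linear f c%:MP w w') scalerBr opprD addrACA.
- by move=> a /ha h; exists (cech_fun f a) => //; rewrite subrr; apply: coboundary0.
- move=> b hb; have hb' : hcocycle (@gr_comp k n B) p (j + 0) b by rewrite addr0.
  have gb : is_coboundary p (cech_fun g b) by apply/vp/cocycle_fun; case: hb.
  by have [a] := middle_exact (pre A) (pre B) (@str C) ex hb' gb; exists a.
move=> a b hA hB hab; split=> [ca|cb].
  rewrite -[b](subrK (cech_fun f a)); apply: coboundaryD => //.
  exact: coboundary_fun.
have cfa : is_coboundary p (cech_fun f a).
  by rewrite -[cech_fun f a](subKr b); apply: coboundaryB.
case: p vp vq {ha hab cb} hA hB cfa => [|q] vp vq hA hB cfa.
  have [b' [sb /eqP]] := cfa; have -> : b' = 0 by apply: dprodP => F; apply: sb.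
  rewrite linear0 => /eqP fa0; suff -> : a = 0 by apply: coboundary0.
  by apply: (cech_fun_inj (f := f)); [case: ex | rewrite fa0 linear0].
have [w hw hcon] := connecting_exact (@str B) ex hA cfa.
apply: (connecting_image (pre A) (pre B) (pre C) (@str C) ex hw hcon (b := 0)).
  by case: (hcocycle_ksub q (j + 0) (pre B)).
by rewrite linear0 subr0; apply: (vq q) => //; case: hw.
Qed.

(** [H^p(B)] and [H^p(C)] agree when the neighbouring terms [H^p(A)] and
    [H^(p+1)(A)] vanish. *)
Lemma cohom_dim_right p j d : cohom_vanishes A p -> cohom_vanishes A p.+1 ->
  cohom_dim C p j d -> cohom_dim B p j d.
Proof.
move=> vp vq; have hg (b : cech B) : hcocycle (@gr_comp k n B) p j b ->
    hcocycle (@gr_comp k n C) p j (cech_fun g b).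
  by move=> [cb db]; split; [apply: cocycle_fun | apply: (cdeg_g ex)].
apply: (reldim_rel (R := fun c b => is_coboundary p (c - cech_fun g b))).
- exact/hcocycle_ksub/pre.
- exact/hcocycle_ksub/pre.
- move=> c w w' x x' h h'; have := coboundaryZD c%:MP h h'; congr (is_coboundary _ _).
  by rewrite (cech_fun_is_linear g c%:MP x x') scalerBr opprD addrACA.
- move=> c hc; have hc' : hcocycle (@gr_comp k n C) p (j + 0) c by rewrite addr0.
  have [a ha hcon] := connecting_total (pre A) (pre B) ex hc'.
  have [b hb gb] := connecting_coboundary (pre B) (@str A) ex ha.2 hcon (vq _ ha.1).
  exists b; first by rewrite addr0 in hb.
  by rewrite gb subrr; apply: coboundary0.
- by move=> b /hg h; exists (cech_fun g b) => //; rewrite subrr; apply: coboundary0.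
move=> c b hC hB hcb; split=> [cc|cb]; last first.
  rewrite -[c](subrK (cech_fun g b)); apply: coboundaryD => //.
  exact: coboundary_fun.
have cgb : is_coboundary p (cech_fun g b).
  by rewrite -[cech_fun g b](subKr c); apply: coboundaryB.
have hb' : hcocycle (@gr_comp k n B) p (j + 0) b by rewrite addr0.
have [a ha hba] := middle_exact (pre A) (pre B) (@str C) ex hb' cgb.
rewrite -[b](subrK (cech_fun f a)); apply: coboundaryD => //.
by apply/coboundary_fun/vp; case: ha.
Qed.

Lemma vanishes_middle p : cohom_vanishes A p -> cohom_vanishes C p -> cohom_vanishes B p.
Proof.
move=> va vc b hb; case: ex => fi fg _ _ gs.
have ex' : short_exact (@ungraded k n A) (@ungraded k n B) (@ungraded k n C) 0 f g.
  split=> // j z _; suff [y hy] : exists y, g y = z by exists y.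
  have [s [c [us hc ->]]] := gr_decomp z.
  have {}hc i : exists y, g y = c i by have [y _ yc] := gs _ _ (hc i); exists y.
  have [y hy] := choice hc; exists (\sum_(i <- s) y i).
  by rewrite linear_sum; apply: eq_bigr.
have cgb : is_coboundary p (cech_fun g b) by apply/vc/cocycle_fun.
have [a ha hba] := middle_exact (@ungraded_pregrading _ _ _) (@ungraded_pregrading _ _ _)
  (@ungraded_strict _ _ _) ex' (hcocycle_ungraded (0 + 0) hb) cgb.
rewrite -[b](subrK (cech_fun f a)); apply: coboundaryD => //.
by apply/coboundary_fun/va; case: ha.
Qed.

End ExactDimensions.

Section Inclusion.
Variables (R : comNzRingType) (M : lmodType R) (U V : submodule M).
Hypothesis UV : {subset submod_pred U <= submod_pred V}.

Definition incl (x : submod U) : submod V := exist _ (val x) (UV (valP x)).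

Lemma incl_is_linear : linear incl.
Proof.
move=> a x y; apply: val_inj; rewrite [RHS]linearP.
by rewrite -[LHS]/(val (a *: x + y)) linearP.
Qed.

HB.instance Definition _ := GRing.isLinear.Build R (submod U) (submod V) _ incl incl_is_linear.

End Inclusion.

Lemma hcomp_morph (k : fieldType) (n : nat) (A B : gradedModule k n) (f : {linear A -> B}) :
  (forall j x, gr_comp j x -> gr_comp j (f x)) -> forall j x, f (hcomp j x) = hcomp j (f x).
Proof.
move=> hf j x; pose u := undup (degs x).
have uu : uniq u by apply: undup_uniq.
have xu : x = \sum_(l <- u) hcomp l x by apply: hcomp_sum => // l; rewrite mem_undup.
rewrite (@hcomp_unique _ _ B (f x) u (fun l => f (hcomp l x))) //.
- by case: ifPn => //; rewrite mem_undup => /hcomp_out ->; rewrite linear0.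
- by move=> l; apply/hf/hcomp_comp.
- by rewrite {1}xu linear_sum.
Qed.

Section SequentiallyCM.
Variables (k : fieldType) (n : nat) (M : gradedModule k n).
Local Notation S := {mpoly k[n]}.

Lemma restr_graded (U V : submodule M) (gU : graded_submod U) (gV : graded_submod V) :
  graded_submod (M := gsub gV) (restr_submod V U).
Proof.
move=> x xU; exists (undup (degs (M := gsub gV) x)), (fun j => hcomp (M := gsub gV) j x).
split; first exact: undup_uniq; last first.
  by apply: hcomp_sum; [apply: undup_uniq | move=> l; rewrite mem_undup].
move=> j; split; first exact: hcomp_comp.
have e := @hcomp_morph k n (gsub gV) M (val : {linear submod V -> M}) (fun _ _ h => h) j x.
by rewrite inE [val _]e; apply: hcomp_sub.
Qed.

Lemma sub_exact (U V : submodule M) (gU : graded_submod U) (gV : graded_submod V)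
    (UV : {subset submod_pred U <= submod_pred V}) :
  short_exact (@gr_comp k n (gsub gU)) (@gr_comp k n (gsub gV))
    (@gr_comp k n (gquot (@restr_graded U V gU gV))) 0 (incl UV) (qpi (restr_submod V U)).
Proof.
split.
- by move=> x y /(congr1 val) /= /val_inj.
- move=> y; rewrite qpi_eq0; split=> [|[x <-]]; last by rewrite inE; exact: (valP x).
  by rewrite inE => hy; exists (exist _ (val y) hy); apply: val_inj.
- by move=> j x; rewrite addr0.
- by move=> j y hy; exists y.
- by move=> j z [y hy <-]; exists y.
Qed.

Lemma whole_exact (U : submodule M) (gU : graded_submod U) :
  short_exact (@gr_comp k n (gsub gU)) (@gr_comp k n M)
    (@gr_comp k n (gquot gU)) 0 (val : {linear submod U -> M}) (qpi U).
Proof.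
split.
- exact: val_inj.
- move=> y; rewrite qpi_eq0; split=> [hy|[x <-]]; last exact: (valP x).
  by exists (exist _ y hy).
- by move=> j x; rewrite addr0.
- by move=> j y hy; exists y.
- by move=> j z [y hy <-]; exists y.
Qed.

Lemma zero_vanishes (C : lmodType S) p : (forall x : C, x = 0) -> cohom_vanishes C p.
Proof.
move=> h c _; suff -> : c = 0 by apply: coboundary0.
apply: dprodP => F; move: (c F) => u; elim/locW: u => x a.
by apply/frac_eq0; exists 0%N; rewrite (h x) scaler0.
Qed.

Lemma vanishes_cohom_dim (C : gradedModule k n) p j : cohom_vanishes C p -> cohom_dim C p j 0.
Proof. by move=> van c [hc _]; apply: van. Qed.

Lemma has_dim_unique (R : comNzRingType) (N : lmodType R) d d' :
  has_dim N d -> has_dim N d' -> d = d'.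
Proof.
move=> [[P hP] hd] [[P' hP'] hd']; apply/eqP; rewrite eqn_leq.
by rewrite (hd' _ _ hP) (hd _ _ hP').
Qed.

Definition Delta_nonneg (N : gradedModule k n) : Prop := forall p,
  exists H : int -> nat, (forall j, cohom_dim N p j (H j)) /\
    forall j, 0 <= Delta p (fun l => (H l)%:R) j.

(** Since the dimensions of the quotients increase, each cohomology module of
    [M] is that of a single quotient of the filtration. *)
Theorem seq_cohen_macaulay_nonneg : infinite_set [set: k] -> fin_gen M ->
  seq_cohen_macaulay M -> Delta_nonneg M.
Proof.
move=> hk fgM [r [U [[U0 Ur] Usub Ugr Ucm Udim]]].
have nM : noetherian M := fin_gen_noetherian (@mpoly_noetherian k n) fgM.
(* [p] lies above the dimensions of the quotients below [U i]. *)
pose Q i p := if i is i'.+1 then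
  forall d, has_dim (subquot (U i'.+1) (U i')) d -> (d < p)%N else True.
have Qstep i d p : (i < r)%N -> has_dim (subquot (U i.+1) (U i)) d -> (d <= p)%N -> Q i p.
  case: i => [|i] hi hd dp //= e he; have [e1 [e2 [h1 h2 lt]]] := Udim i hi.
  by rewrite (has_dim_unique he h1) (leq_trans lt) // -(has_dim_unique hd h2).
have main i (ir : (i <= r)%N) : Delta_nonneg (gsub (Ugr i ir)) /\
    forall p, Q i p -> cohom_vanishes (submod (U i)) p.
  elim: i ir => [|i IHi] ir.
    have z p : cohom_vanishes (submod (U 0%N)) p.
      by apply: zero_vanishes => x; apply: val_inj; apply/U0/valP.
    split=> // p; exists (fun=> 0%N); split=> j; first exact/vanishes_cohom_dim/z.
    by rewrite Delta0.
  have ir' := ltnW ir; have [IHg IHv] := IHi ir'.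
  pose ex := @sub_exact _ _ (Ugr i ir') (Ugr i.+1 ir) (Usub i ir).
  pose C := gquot (@restr_graded _ _ (Ugr i ir') (Ugr i.+1 ir)).
  have nC : noetherian C.
    apply: (@noetherian_surj _ _ _ (qpi (restr_submod (U i.+1) (U i)))).
      by move=> y; have [x <-] := qpi_surj y; exists x.
    by apply: (@noetherian_inj _ _ M (val : {linear submod (U i.+1) -> M})) => //; apply: val_inj.
  have [d [dimC [h /cm_chain_cohomology[vanC [H [dimH DH _]]]]]] :=
    cohen_macaulay_chain hk nC (Ucm i ir : cohen_macaulay C).
  have vanA p : (d <= p)%N -> cohom_vanishes (submod (U i)) p.
    by move=> dp; apply/IHv/(Qstep i d).
  split=> [p|p /(_ d dimC) dp]; last first.
    apply: (vanishes_middle ex); first exact/vanA/ltnW.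
    by apply: vanC => e; rewrite e ltnn in dp.
  have [pd|dp|->] := ltngtP p d.
  - have [K [hK dK]] := IHg p; exists K; split=> // j.
    apply: (cohom_dim_left ex) (hK j); first by apply: vanC; lia.
    by move=> q pq; apply: vanC; lia.
  - exists (fun=> 0%N); split=> j; last by rewrite Delta0.
    apply: (cohom_dim_right ex); [exact/vanA/ltnW | apply: vanA; lia |].
    by apply: vanishes_cohom_dim; apply: vanC; lia.
  exists H; split=> j; last by rewrite DH ler0n.
  by apply: (cohom_dim_right ex) (dimH j); apply: vanA; lia.
have [hg _] := main r (leqnn r) => p; have [H [hH dH]] := hg p.
exists H; split=> // j.
have zero q : cohom_vanishes (quotmod (U r)) q.
  by apply: zero_vanishes => y; have [x <-] := qpi_surj y; apply/qpi_eq0.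
apply: (cohom_dim_left (@whole_exact _ (Ugr r (leqnn r)))) (hH j) => [|q _]; exact: zero.
Qed.

End SequentiallyCM.

(** * The Krull dimension of polynomial rings *)

Section AlgebraicDependence.
Variables (k : fieldType) (n : nat).
Local Notation S := {mpoly k[n]}.

Fixpoint monomial_value (zs : seq S) (u : seq nat) : S :=
  match zs, u with z :: zs', a :: u' => z ^+ a * monomial_value zs' u' | _, _ => 1 end.

(** A formal nonzero polynomial in [l] elements, as the list of its terms; lists
    of exponents can be split at the head, for induction on [l]. *)
Definition is_relation l (L : seq (k * seq nat)) : Prop :=
  [/\ L != [::], uniq (map snd L) & forall p, p \in L -> p.1 != 0 /\ size p.2 = l].

Definition relation_value zs (L : seq (k * seq nat)) : S :=
  \sum_(p <- L) p.1%:MP * monomial_value zs p.2.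

Lemma primeX (P : prime_idealr S) z a : z \notin P -> z ^+ a \notin P.
Proof.
move=> hz; elim: a => [|a IHa]; first by rewrite expr0 idealr1.
by rewrite exprS prime_idealrM negb_or hz.
Qed.

(** Lombardi's argument: along a chain of primes with [z_t] in the step from
    [P_t] to [P_(t+1)], divide by the lowest power of [z_0] modulo [P_0], then set
    [z_0] to zero modulo [P_1], and continue; a constant remains in the end. *)
Lemma no_relation zs (P : nat -> prime_idealr S) L :
  (forall t, (t < size zs)%N -> [/\ {subset P t <= P t.+1}, zs`_t \in P t.+1
     & zs`_t \notin P t]) ->
  is_relation (size zs) L -> relation_value zs L \notin P 0%N.
Proof.
elim: zs P L => [|z zs IHzs] P L hP [L0 Lu Lp].
  case: L L0 Lu Lp => // -[c u] [|[c' u'] L] _ /= Lu Lp; last first.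
    have [_ /size0nil u0] := Lp (c, u) (mem_head _ _).
    have [_ /size0nil u0'] : (c', u').1 != 0 /\ size (c', u').2 = 0%N.
      by apply: Lp; rewrite !inE eqxx orbT.
    by move: Lu; rewrite /= in u0 u0'; rewrite u0 u0' inE eqxx.
  rewrite /relation_value big_seq1 /= mulr1; have [/= c0 _] := Lp (c, u) (mem_head _ _).
  apply/negP => h; have := idealMr c^-1%:MP h.
  by rewrite -mpolyCM mulVf // mpolyC1 idealr1.
have [P01 zP1 zP0] := hP 0%N isT.
have hd p : p \in L -> p.2 = head 0%N p.2 :: behead p.2.
  by case/Lp => _; case: p.2.
have [a [aL amin]] : exists a, a \in [seq head 0%N p.2 | p <- L] /\
    forall p, p \in L -> (a <= head 0%N p.2)%N.
  have ex : exists a, a \in [seq head 0%N p.2 | p <- L].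
    by case: L L0 {Lu Lp hd} => // p L _; exists (head 0%N p.2); rewrite /= mem_head.
  have [a aL amin] := find_ex_minn ex; exists a; split=> // p pL.
  by apply: amin; apply: map_f.
(* The terms of lowest degree in [z], divided by that power of [z]. *)
pose La := [seq (p.1, behead p.2) | p <- L & head 0%N p.2 == a].
pose T := \sum_(p <- L) p.1%:MP * (z ^+ (head 0%N p.2 - a) * monomial_value zs (behead p.2)).
have LT : relation_value (z :: zs) L = z ^+ a * T.
  rewrite /relation_value /T mulr_sumr big_seq [RHS]big_seq; apply: eq_bigr => p pL.
  by rewrite {1}(hd p pL) /= -{1}(subnKC (amin p pL)) exprD; ring.
rewrite LT prime_idealrM negb_or (primeX a zP0) /=; apply/negP => /P01 TP.
have : relation_value zs La \notin P 1%N.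
  apply: (IHzs (fun t => P t.+1)) => [t ts|]; first exact: (hP t.+1).
  split.
  - case/mapP: aL => p pL ha; rewrite -size_eq0 size_map size_filter -lt0n -has_count.
    by apply/hasP; exists p; rewrite // ha eqxx.
  - rewrite /La -map_comp map_inj_in_uniq; first by apply: filter_uniq; apply: map_uniq Lu.
    move=> p q; rewrite !mem_filter => /andP[/eqP pa pL] /andP[/eqP qa qL] /= e.
    apply/eqP; have : p.2 = q.2 by rewrite (hd p pL) (hd q qL) pa qa e.
    move/eqP; case/(nthP p): pL => i iL <-; case/(nthP p): qL => j jL <-.
    have nthE l : (l < size L)%N -> (nth p L l).2 = nth p.2 (map snd L) l.
      by move=> lL; rewrite (nth_map p).
    by rewrite !nthE // nth_uniq ?size_map // => /eqP ->.
  move=> _ /mapP[p + ->]; rewrite mem_filter => /andP[_ pL] /=.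
  by have [p1 p2] := Lp p pL; rewrite size_behead p2.
move/negP; apply; have -> : relation_value zs La = T - (T - relation_value zs La) by rewrite subKr.
rewrite rpredB // /T (bigID (fun p : k * seq nat => head 0%N p.2 == a)) /=.
have -> : \sum_(p <- L | head 0%N p.2 == a)
    p.1%:MP * (z ^+ (head 0%N p.2 - a) * monomial_value zs (behead p.2)) = relation_value zs La.
  rewrite /relation_value big_map big_filter; apply: eq_bigr => p /eqP ->.
  by rewrite subnn mul1r.
rewrite addrAC subrr add0r big_seq_cond; apply: rpred_sum => p /andP[pL pa].
have : (a < head 0%N p.2)%N by rewrite ltn_neqAle eq_sym pa amin.
rewrite -subn_gt0; case: (_ - _)%N => // b _.
have -> : p.1%:MP * (z ^+ b.+1 * monomial_value zs (behead p.2)) =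
    (p.1%:MP * (z ^+ b * monomial_value zs (behead p.2))) * z by rewrite exprS; ring.
exact: idealMr.
Qed.

Definition box i E (f : S) : Prop := forall m : 'X_{1..n}, m \in msupp f ->
  forall j : 'I_n, (m j <= if (j < i)%N then E else 0)%N.

Lemma box1 i E : box i E 1.
Proof. by move=> m; rewrite msupp1 inE => /eqP -> j; rewrite mnmE. Qed.

Lemma boxM i E E' f g : box i E f -> box i E' g -> box i (E + E') (f * g).
Proof.
move=> hf hg m /msuppM_le /allpairsP[[m1 m2] /= [h1 h2 ->]] j.
have := hf _ h1 j; have := hg _ h2 j; rewrite mnmDE.
by case: ifP => _; lia.
Qed.

Lemma boxX i E a f : box i E f -> box i (E * a) (f ^+ a).
Proof.
move=> hf; elim: a => [|a IHa]; first by rewrite muln0; apply: box1.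
by rewrite exprS mulnS; apply: boxM.
Qed.

Lemma box_le i E E' f : (E <= E')%N -> box i E f -> box i E' f.
Proof. by move=> le hf m /hf h j; have := h j; case: ifP => _; lia. Qed.

Lemma box_monomial_value i D N zs u : (forall z, z \in zs -> box i D z) ->
  (forall a, a \in u -> (a <= N)%N) -> box i (size zs * (D * N)) (monomial_value zs u).
Proof.
elim: zs u => [|z zs IHzs] u hz hu; first exact: box1.
case: u hu => [|a u] hu /=; first exact: box1.
rewrite [size _]/= mulSn; apply: (@boxM i (D * N)%N).
  apply: box_le (boxX (a := a) (hz z (mem_head _ _))); rewrite leq_mul2l.
  by rewrite hu ?orbT ?mem_head.
apply: IHzs => [y hy|b hb]; first by apply: hz; rewrite inE hy orbT.
by apply: hu; rewrite inE hb orbT.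
Qed.

(** There are more monomials in [i + 1] polynomials of [i] variables than the
    degrees of these monomials leave room for. *)
Lemma algebraic_dependence i D zs : size zs = i.+1 ->
  (forall z, z \in zs -> box i D z) ->
  exists2 L, is_relation i.+1 L & relation_value zs L = 0.
Proof.
move=> szs hz.
(* Exponents below [N] in the given elements give exponents below [E] in the
   variables, and [N ^ i.+1 > E ^ i]. *)
pose B := (i.+1 * D).+1; pose N := (B ^ i).+1; pose E := (N * B)%N.
pose X := {ffun 'I_i.+1 -> 'I_N}; pose V := {ffun 'I_i -> 'I_E}.
pose ex (r : X) : seq nat := [seq val (r t) | t <- enum 'I_i.+1].
have exI : injective ex.
  move=> r r' e; apply/ffunP => t; apply: val_inj.
  by have /eq_in_map := e => /(_ t); apply; rewrite mem_enum.
have szE r : size (ex r) = i.+1 by rewrite size_map size_enum_ord.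
have bex r : box i (i.+1 * (D * N)) (monomial_value zs (ex r)).
  rewrite -szs; apply: box_monomial_value => // _ /mapP[t _ ->].
  exact/ltnW/ltn_ord.
have ltE : (i.+1 * (D * N) < E)%N by rewrite /E /B mulnA mulnC ltn_pmul2l.
pose mono (v : V) : 'X_{1..n} :=
  [multinom (if insub (val j) is Some t then val (v t) else 0%N) | j < n].
have monoP r m : m \in msupp (monomial_value zs (ex r)) -> exists v, m = mono v.
  move=> hm; have hj := bex r m hm.
  have E0 : (0 < E)%N by apply: leq_trans ltE.
  exists [ffun t : 'I_i => insubd (Ordinal E0) (if insub (val t) is Some j then m j else 0%N)].
  apply/mnmP => j; rewrite mnmE; have := hj j; case: ifP => [ji|ij].
    rewrite (insubT (fun t => (t < i)%N) ji) ffunE SubK valK => le.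
    by rewrite val_insubd (leq_ltn_trans le ltE).
  by rewrite leqn0 => /eqP ->; rewrite insubF.
pose A := \matrix_(r < #|X|, v < #|V|) (monomial_value zs (ex (enum_val r)))@_(mono (enum_val v)).
have : kermx A != 0.
  rewrite kermx_eq0 -row_leq_rank -ltnNge.
  apply: leq_ltn_trans (rank_leq_col _) _; rewrite !card_ffun !card_ord.
  by rewrite /E expnMn expnSr ltn_pmul2l ?expn_gt0 // ltnSn.
case/rowV0Pn => c /sub_kermxP cA c0.
pose L := [seq (c 0 r, ex (enum_val r)) | r <- enum 'I_#|X| & c 0 r != 0].
exists L.
  split.
  - have /rV0Pn[r hr] := c0.
    rewrite -size_eq0 size_map size_filter -lt0n -has_count; apply/hasP.
    by exists r; rewrite ?mem_enum.
  - rewrite -map_comp map_inj_uniq; first by rewrite filter_uniq ?enum_uniq.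
    by move=> r r' /exI/enum_val_inj.
  - by move=> _ /mapP[r + ->]; rewrite mem_filter => /andP[cr _]; split; rewrite ?szE.
apply/mpolyP => m; rewrite mcoeff0 /relation_value big_map big_filter raddf_sum /=.
rewrite big_enum_cond /= big_mkcond /=.
transitivity (\sum_r c 0 r * (monomial_value zs (ex (enum_val r)))@_m).
  apply: eq_bigr => r _; case: ifPn => [_|/negPn/eqP ->]; first by rewrite mcoeffCM.
  by rewrite mul0r.
have [[v ->]|nv] := pselect (exists v, m = mono v).
  have /matrixP/(_ 0 (enum_rank v)) := cA; rewrite !mxE => e; rewrite -[RHS]e.
  by apply: eq_bigr => r _; rewrite mxE enum_rankK.
rewrite big1 // => r _; rewrite memN_msupp_eq0 ?mulr0 //.
by apply/negP => /monoP.
Qed.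

End AlgebraicDependence.

Section KillingVariables.
Variables (k : fieldType) (n : nat).
Local Notation S := {mpoly k[n]}.

(** The endomorphism setting to zero the variables outside [Q]; its kernel is
    the prime ideal generated by them. *)
Definition keep (Q : pred nat) : S -> S :=
  comp_mpoly [tuple (if Q j then 'X_j else 0) | j < n].

HB.instance Definition _ Q := GRing.RMorphism.copy (keep Q)
  (comp_mpoly [tuple (if Q j then 'X_j else 0) | j < n]).

Lemma keepC Q (c : k) : keep Q c%:MP = c%:MP.
Proof. exact: comp_mpolyC. Qed.

Lemma keepX (Q : pred nat) (i : 'I_n) : keep Q 'X_i = if Q i then 'X_i else 0.
Proof. by rewrite /keep comp_mpolyXU -tnth_nth tnth_mktuple. Qed.

Lemma mpoly_gen_ind (A : S -> Prop) : (forall c : k, A c%:MP) -> (forall i : 'I_n, A 'X_i) ->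
  (forall f g, A f -> A g -> A (f + g)) -> (forall f g, A f -> A g -> A (f * g)) ->
  forall f, A f.
Proof.
move=> hC hX hD hM f; rewrite [f]mpolyE; apply: (big_ind A); [|exact: hD|move=> m _].
  by rewrite -(mpolyC0 n); apply: hC.
rewrite -mul_mpolyC; apply: (hM) => //; rewrite mpolyXE_id.
apply: (big_ind A); [by rewrite -mpolyC1; apply: hC | exact: (hM) | move=> i _].
by elim: (m i) => [|a IHa]; [rewrite expr0 -mpolyC1; apply: hC | rewrite exprS; apply: (hM)].
Qed.

Lemma keep_keep (Q Q' Q'' : pred nat) f : (forall j, Q'' j = Q j && Q' j) ->
  keep Q (keep Q' f) = keep Q'' f.
Proof.
move=> e; apply: (@mpoly_gen_ind (fun f => keep Q (keep Q' f) = keep Q'' f)) => [c|i|g h|g h].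
- by rewrite !keepC.
- by rewrite !keepX e; case: (Q' i); rewrite ?andbF ?rmorph0 ?keepX ?andbT.
- by rewrite !rmorphD /= => -> ->.
- by rewrite !rmorphM /= => -> ->.
Qed.

Lemma keep_homog Q e f : f \is e.-homog -> keep Q f \is e.-homog.
Proof.
move=> hf; rewrite /keep comp_mpolyEX big_seq; apply: rpred_sum => m hm.
have em : mdeg m = e := dhomogP _ _ _ hf m hm.
apply: dhomogZ; rewrite comp_mpolyX -em mdegE.
pose H (d : nat) (g : S) : Prop := g \is d.-homog.
suff : H (\sum_(i < n) m i)%N
  (\prod_(i < n) tnth [tuple (if Q j then 'X_j else 0) | j < n] i ^+ m i) by [].
apply: (big_ind2 H) => [|a g b h|j _]; rewrite /H.
- exact: dhomog1.
- exact: dhomogM.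
rewrite tnth_mktuple; have h : (if Q j then 'X_j else 0 : S) \is 1.-homog.
  by case: ifP => _; [apply: mvar_homog | apply: dhomog0].
by have := dhomogMn (m j) h; rewrite mul1n.
Qed.

(** The polynomials satisfying this form a subalgebra, so variables and
    constants suffice. *)
Lemma sub_keep (Q : pred nat) (U : set S^o) f : is_subm U ->
  (forall j : 'I_n, ~~ Q j -> U 'X_j) -> U (f - keep Q f).
Proof.
move=> hU hX; apply: (@mpoly_gen_ind (fun f => U (f - keep Q f))) => [c|i|g h hg hh|g h hg hh].
- by rewrite keepC subrr; case: hU.
- rewrite keepX; case: ifPn => [_|/hX]; first by rewrite subrr; case: hU.
  by rewrite subr0.
- by rewrite rmorphD opprD addrACA; exact: (submD hU hg hh).
rewrite rmorphM /= (_ : g * h - _ = h * (g - keep Q g) + keep Q g * (h - keep Q h)); last by ring.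
exact: (submD hU (submZ h hU hg) (submZ (keep Q g) hU hh)).
Qed.

Lemma keep_box i f : exists E, box i E (keep (fun j => (j < i)%N) f).
Proof.
apply: (@mpoly_gen_ind (fun f => exists E, box i E (keep (fun j => (j < i)%N) f))) =>
  [c|j|g h [E hE] [E' hE']|g h [E hE] [E' hE']].
- by exists 0%N => m; rewrite keepC msuppC; case: ifP => // _; rewrite inE => /eqP -> j; rewrite mnmE.
- exists 1%N => m; rewrite keepX; case: ifPn => ji; last by rewrite msupp0.
  rewrite msuppX inE => /eqP -> l; rewrite mnm1E.
  by have [<-|] := eqVneq j l; rewrite ?ji //; case: ifP.
- exists (maxn E E') => m; rewrite rmorphD => /msuppD_le; rewrite mem_cat => /orP[/hE|/hE'] h' l;
    by have := h' l; case: ifP => // _; lia.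
by exists (E + E')%N; rewrite rmorphM; apply: boxM.
Qed.

(** Choose one element in each step of a chain longer than [i]. Modulo the last
    variables, which lie in all the primes, these are too many polynomials in
    [i] variables to be algebraically independent, against [no_relation]. *)
Lemma prime_chain_bound i e (P : 'I_e.+1 -> prime_idealr S) :
  (forall j : 'I_n, (i <= j)%N -> 'X_j \in P ord0) ->
  (forall s t : 'I_e.+1, (s < t)%N -> [set f | f \in P s] `<` [set f | f \in P t]) ->
  (e <= i)%N.
Proof.
move=> hX lt; rewrite leqNgt; apply/negP => ie.
pose Pn t := P (inord t).
have le0 t : {subset P ord0 <= P t}.
  have [->//|t0] := eqVneq t ord0 => x xP.
  have /lt[+ _] : ((ord0 : 'I_e.+1) < t)%N.
    by rewrite lt0n; apply: contra t0 => /eqP h; apply/eqP/val_inj.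
  by apply.
have ltn (t : nat) : (t < i.+1)%N -> [set f | f \in Pn t] `<` [set f | f \in Pn t.+1].
  move=> ti; apply: lt; rewrite !inordK ?ltnS //; lia.
have ex (t : nat) : exists y : S, (t < i.+1)%N -> y \in Pn t.+1 /\ y \notin Pn t.
  have [ti|_] := ltnP t i.+1; last by exists 0.
  have [_ h] := ltn t ti; apply: contrapT => hn; apply: h => y yP.
  apply: contrapT => /negP ny; apply: hn; exists y => _; split; last exact: ny.
  exact: yP.
have [y hy] := choice ex; pose z t := keep (fun j => (j < i)%N) (y t).
have yz t (Q : prime_idealr S) : {subset P ord0 <= Q} -> (z t \in Q) = (y t \in Q).
  move=> PQ; rewrite -[y t](subrK (z t)) rpredDl // PQ //.
  apply: (@sub_keep (fun j => (j < i)%N) [set f : S^o | f \in P ord0]).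
    split=> [|a u v uP vP]; rewrite /mkset ?rpred0 // rpredD //.
    exact: idealMr.
  by move=> j; rewrite -leqNgt => /hX.
pose zs := mkseq z i.+1.
have [E hE] := choice (fun t => keep_box i (y t)).
have [||L hL L0] := @algebraic_dependence k n i (\max_(t < i.+1) E t) zs.
- by rewrite size_mkseq.
- move=> _ /mapP[t + ->]; rewrite mem_iota => /= ti.
  exact: (box_le (leq_bigmax (Ordinal ti)) (hE t)).
suff /negP : relation_value zs L \notin Pn 0%N by apply; rewrite L0 rpred0.
apply: no_relation; last by rewrite size_mkseq.
move=> t; rewrite size_mkseq => ti; rewrite nth_mkseq //.
have [h1 h2] := hy t ti; rewrite !yz; [split=> // x xP|exact: le0|exact: le0].
by have [h _] := ltn t ti; apply: (h x xP).
Qed.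

End KillingVariables.

(** * Shifted polynomial rings in fewer variables *)

Section FreeModule.
Variables (k : fieldType) (n : nat) (b : int).
Local Notation S := {mpoly k[n]}.

(** The grading of the free module of rank one with generator in degree [b]. *)
Definition free_comp (j : int) : set S^o :=
  [set f | f = 0 \/ exists e : nat, j = b + e%:Z /\ (f : S) \is e.-homog].

Lemma free_comp0 j : free_comp j 0.
Proof. by left. Qed.

Lemma free_compD j f g : free_comp j f -> free_comp j g -> free_comp j (f + g).
Proof.
move=> [->|[e [je hf]]]; first by rewrite add0r.
move=> [->|[e' [je' hg]]]; first by rewrite addr0; right; exists e.
right; exists e; split=> //; apply: dhomogD => //.
by have -> : e = e' by lia.
Qed.

Lemma free_compZ (d : nat) j (f : S) g : f \is d.-homog -> free_comp j g -> free_comp (j + d%:Z) (f *: g).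
Proof.
move=> hf [->|[e [je hg]]]; first by left; rewrite scaler0.
right; exists (d + e)%N; split; first by rewrite je; lia.
exact: dhomogM hf hg.
Qed.

Lemma free_decomp f : exists (s : seq int) (c : int -> S^o),
  [/\ uniq s, forall j, free_comp j (c j) & f = \sum_(j <- s) c j].
Proof.
exists [seq b + d%:Z | d <- index_iota 0 (msize (f : S))],
  (fun j => if b <= j then pihomog mdeg `|j - b|%N (f : S) else 0); split.
- by rewrite map_inj_uniq ?iota_uniq // => d d'; lia.
- move=> j; case: ifP => bj; last by left.
  by right; exists `|j - b|%N; split; [lia | apply: pihomogP].
rewrite big_map big_mkord {1}(@pihomog_partitionE n k mdeg (msize (f : S)) f) //.
apply: eq_bigr => d _; rewrite lerDl le0z_nat; congr (pihomog _ _ _); lia.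
Qed.

Lemma free_indep (s : seq int) (c : int -> S^o) : uniq s ->
  (forall j, free_comp j (c j)) -> \sum_(j <- s) c j = 0 ->
  forall j, j \in s -> c j = 0.
Proof.
move=> us hc h j js; have [//|[e [je he]]] := hc j.
have := congr1 (pihomog mdeg e : S -> S) h; rewrite raddf0 raddf_sum /= (bigD1_seq j) //=.
rewrite pihomog_dE // big1 ?addr0 // => l lj.
have [->|[e' [le' he']]] := hc l; first exact: raddf0.
apply: (pihomog_ne0 _ he'); apply: contra lj => /eqP ee; apply/eqP; lia.
Qed.

Definition gfree : gradedModule k n := @GradedModule k n (S^o : lmodType S) free_comp free_comp0
  free_compD free_compZ free_decomp free_indep.

Section Kernel.
Variable i : nat.
Local Notation sg := (keep (fun j => (j < i)%N) : S -> S).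

Lemma kill_closed : submod_closed [pred f : S^o | sg f == 0].
Proof.
split=> [|a f g]; rewrite !inE; first by rewrite rmorph0.
move=> /eqP hf /eqP hg.
by rewrite rmorphD rmorphM /= hf hg mulr0 addr0.
Qed.

Definition kill : submodule (gfree : lmodType S) := Submodule kill_closed.

Lemma in_kill (f : S) : (f \in submod_pred kill) = (sg f == 0).
Proof. by []. Qed.

Lemma kill_graded : graded_submod kill.
Proof.
move=> f hf; exists (undup (degs (M := gfree) f)), (fun j => hcomp (M := gfree) j f).
have us := undup_uniq (degs (M := gfree) f).
have fs : f = \sum_(j <- undup (degs (M := gfree) f)) hcomp (M := gfree) j f.
  by apply: hcomp_sum => // l; rewrite mem_undup.
split=> // j; split; first exact: hcomp_comp.
rewrite in_kill; apply/eqP.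
have [ju|ju] := boolP (j \in undup (degs (M := gfree) f)); last first.
  by rewrite hcomp_out ?rmorph0 // -mem_undup.
apply: (@free_indep _ (fun l => sg (hcomp (M := gfree) l f)) us _ _ j ju).
  move=> l; have [->|[e [le he]]] := hcomp_comp (M := gfree) l f; first by left; rewrite rmorph0.
  by right; exists e; split=> //; apply: keep_homog.
by move: hf; rewrite in_kill {1}fs rmorph_sum => /eqP.
Qed.

End Kernel.

(** [Y] is a copy of the quotient of the free module by the variables of index
    at least [i]. The copies that occur are the quotient itself and the
    subquotient of the filtration with one step. *)
Definition presents i (Y : gradedModule k n) (g : {linear S^o -> Y}) : Prop :=
  [/\ forall y, exists f, g f = y,
      forall f : S, g f = 0 <-> keep (fun j => (j < i)%N) f = 0,
      forall j f, free_comp j f -> gr_comp j (g f)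
    & forall j y, gr_comp j y -> exists2 f, free_comp j f & g f = y].

Lemma gquot_presents i : @presents i (gquot (@kill_graded i)) (qpi (kill i)).
Proof.
split=> [y|f|j f hf|j y [f hf <-]]; first exact: qpi_surj.
- by rewrite qpi_eq0 in_kill; split=> /eqP.
- by exists f.
- by exists f.
Qed.

Lemma factor_linear (R : comNzRingType) (M N P : lmodType R) (g : {linear M -> N}) (q : {linear M -> P}) :
  (forall y, exists x, g x = y) -> (forall x, g x = 0 -> q x = 0) ->
  exists phi : {linear N -> P}, forall x, phi (g x) = q x.
Proof.
move=> gs gq; have [u hu] := choice gs.
have uE x : q (u (g x)) = q x.
  by apply/eqP; rewrite -subr_eq0 -linearB; apply/eqP/gq; rewrite linearB hu subrr.
have lin : linear (q \o u).
  move=> a y z; have [x <-] := gs y; have [x' <-] := gs z.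
  by rewrite -linearP /= !uE linearP.
pose c := GRing.isLinear.Build R N P _ (q \o u) lin.
pose phi : {linear N -> P} := HB.pack (q \o u) c.
by exists phi.
Qed.

(** Setting one more variable to zero changes a polynomial by a multiple of that
    variable. *)
Lemma mul_var_kill (i : 'I_n) (f : S) : keep (fun j => (j < i)%N) f = 0 ->
  exists h, keep (fun j => (j < i.+1)%N) (f - 'X_i * h) = 0.
Proof.
move=> f0; pose f' := keep (fun j => (j < i.+1)%N) f.
have [h hh] : exists h, f' = 'X_i * h.
  pose U : set S^o := [set g | exists h : S, g = 'X_i * h].
  have hU : is_subm U.
    split=> [|a _ _ [x ->] [y ->]]; first by exists 0; rewrite mulr0.
    by exists (a * x + y); rewrite /GRing.scale /=; ring.
  have := @sub_keep k n (fun j => j != i) U f' hU.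
  rewrite (@keep_keep _ _ _ _ (fun j => (j < i)%N)) => [|j]; last first.
    by rewrite ltnS ltn_neqAle.
  rewrite f0 subr0; apply=> j /negPn/eqP ji; exists 1; rewrite mulr1.
  by congr ('X_ _); apply: val_inj.
exists h; rewrite -hh rmorphB /= (@keep_keep _ _ _ _ (fun j => (j < i.+1)%N)) ?subrr // => j.
by rewrite andbb.
Qed.

Lemma presents_step (i : 'I_n) (Y Y' : gradedModule k n) (g : {linear S^o -> Y}) (g' : {linear S^o -> Y'}) :
  presents i.+1 g -> presents i g' ->
  exists phi : {linear Y -> Y'}, gr_quotient_by (fun j => (j == i)%:R) phi.
Proof.
move=> [gs g0 gc gl] [gs' g0' gc' gl'].
have sub f : g f = 0 -> g' f = 0.
  move=> /g0 h; apply/g0'; rewrite -(@keep_keep _ _ (fun j => (j < i)%N) (fun j => (j < i.+1)%N)) ?h ?rmorph0 //.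
  by move=> j; rewrite andb_idr // => /ltnW.
have [phi hphi] := factor_linear gs sub; exists phi.
have Xi : linform (fun j => (j == i)%:R) = 'X_i :> S.
  rewrite /linform (bigD1 i) //= eqxx mul1r big1 ?addr0 // => j /negbTE ->.
  by rewrite mul0r.
split; last 2 first.
- by move=> j y /gl[f hf <-]; rewrite hphi; apply: gc'.
- by move=> j z /gl'[f hf <-]; exists (g f); [apply: gc | apply: hphi].
rewrite Xi; split.
- move=> y y' /eqP; rewrite -subr_eq0 -scalerBr; have [f fy] := gs (y - y').
  rewrite -fy -linearZZ => /eqP/g0; rewrite rmorphM /= keepX ltnSn => /eqP.
  rewrite mulf_eq0 => /orP[|/eqP/g0 gf].
    by rewrite -mleadc_eq0 mleadXm mcoeffX eqxx oner_eq0.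
  by apply/eqP; rewrite -subr_eq0 -fy gf.
- move=> y; have [f <-] := gs y; rewrite hphi; split.
    move=> /g0' /mul_var_kill[h /g0]; rewrite linearB => /eqP; rewrite subr_eq0 => /eqP ->.
    by exists (g h); rewrite -linearZZ.
  move=> [x]; have [h <-] := gs x; rewrite -linearZZ => /eqP.
  rewrite eq_sym -subr_eq0 -linearB => /eqP/sub; rewrite linearB => /eqP.
  rewrite subr_eq0 => /eqP ->; apply/g0'.
  by rewrite rmorphM /= keepX ltnn mul0r.
by move=> z; have [f <-] := gs' z; exists (g f).
Qed.

End FreeModule.

Section PresentedModules.
Variables (k : fieldType) (n : nat) (b : int).
Local Notation S := {mpoly k[n]}.

Lemma keep_none (f : S) : keep (fun j => (j < 0)%N) f = (f@_0%MM)%:MP.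
Proof.
apply: (@mpoly_gen_ind k n (fun f => keep (fun j => (j < 0)%N) f = (f@_0%MM)%:MP)) => [c|i|g h|g h].
- by rewrite keepC mcoeffC eqxx mulr1.
- by rewrite keepX mcoeffX -mdeg_eq0 mdeg1 mpolyC0.
- by rewrite !rmorphD /= => -> ->.
- by rewrite !rmorphM /= => -> ->.
Qed.

Lemma presents_one_neq0 i (Y : gradedModule k n) (g : {linear S^o -> Y}) :
  presents b i g -> g 1 <> 0.
Proof. by move=> [_ g0 _ _] /g0; rewrite rmorph1 => /eqP; rewrite oner_eq0. Qed.

Lemma presents_residue (Y : gradedModule k n) (g : {linear S^o -> Y}) :
  presents b 0 g -> cm_chain 0 Y (fun j => (j == b : nat)).
Proof.
move=> pg; have g1 := presents_one_neq0 pg; have [gs g0 gc gl] := pg.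
have gE (f : S) : g f = (f@_0%MM)%:MP *: g 1.
  rewrite -linearZZ; apply/eqP; rewrite -subr_eq0 -linearB; apply/eqP/g0.
  rewrite rmorphB /= keep_none.
  have -> : ((f@_0%MM)%:MP *: (1 : S^o) : S) = (f@_0%MM)%:MP by exact: mulr1.
  by rewrite keepC subrr.
apply: cm_chain0.
- move=> y i; have [f <-] := gs y; exists 1%N; rewrite -linearZZ; apply/g0.
  by rewrite rmorphM /= keepX mul0r.
- move=> j; case: eqP => [->|jb] /=.
    exists (g 1); split=> [|//|y /gl[f _ <-]].
      by apply: gc; right; exists 0%N; rewrite addr0; split=> //; apply: dhomog1.
    by exists (f@_0%MM); rewrite gE subrr.
  move=> y /gl[f hf <-]; rewrite gE; case: hf => [->|[e [je hf]]].
    by rewrite mcoeff0 mpolyC0 scale0r.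
  rewrite (dhomog_nemf_coeff hf) ?mpolyC0 ?scale0r //.
  by rewrite /= mdeg0; apply/eqP => e0; apply: jb; rewrite je -e0 addr0.
by exists b => j; case: eqP => // ->; rewrite ltxx.
Qed.

Lemma presents_chain i (Y : gradedModule k n) (g : {linear S^o -> Y}) : (i <= n)%N ->
  presents b i g -> cm_chain i Y (fun j => (j == b : nat)) /\
  exists s, [/\ size s = i, forall f : S, f \in s -> max_ideal f & regular_seq Y s].
Proof.
elim: i Y g => [|i IHi] Y g hi pg.
  split; first exact: presents_residue pg.
  exists [::]; split=> //; split=> //; exists (g 1) => -[y]; rewrite big_ord0.
  exact: presents_one_neq0 pg.
have pg' := @gquot_presents k n b i.
have [h1 [s [ss sm sr]]] := IHi _ _ (ltnW hi) pg'.
have [phi hphi] := presents_step (i := Ordinal hi) pg pg'.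
split; first exact: cm_chainS hphi h1.
exists (linform (fun j => (j == Ordinal hi)%:R) :: s); split; first by rewrite /= ss.
  by move=> f; rewrite inE => /predU1P[->|/sm //]; apply: linform_max.
by case: hphi => hq _ _; apply/(regular_seq_cons _ hq).
Qed.

Lemma presents_ann i (Y : gradedModule k n) (g : {linear S^o -> Y}) : presents b i g ->
  forall f, annihilator Y f <-> keep (fun j => (j < i)%N) f = 0.
Proof.
move=> [gs g0 _ _] f; split=> [h|h y].
  apply/g0; have := h (g 1); rewrite -linearZZ.
  by have -> : f *: (1 : S^o) = f by exact: mulr1.
by have [x <-] := gs y; rewrite -linearZZ; apply/g0; rewrite rmorphM /= h mul0r.
Qed.

(** The kernels of the maps keeping fewer and fewer variables form a chain of
    length [i]. *)
Lemma presents_dim i (Y : gradedModule k n) (g : {linear S^o -> Y}) : (i <= n)%N ->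
  presents b i g -> has_dim Y i.
Proof.
move=> hi pg; have annE := presents_ann pg; split; last first.
  move=> e P [PI Plt]; apply: (@prime_chain_bound k n i e P) => // j ij.
  by apply: PI; apply/annE; rewrite keepX ltnNge ij.
pose K c : S -> S := keep (fun j => (j < c)%N).
have KK c c' f : (c <= c')%N -> K c (K c' f) = K c f.
  move=> cc; apply: keep_keep => j; rewrite andb_idr // => jc.
  exact: leq_trans jc cc.
have ex c : exists P : prime_idealr S, forall f, (f \in P) <-> K c f = 0.
  apply: (@prime_ideal_of S [set f | K c f = 0]).
  - split=> [|a x y]; first exact: rmorph0.
    by rewrite /mkset /K rmorphD rmorphM /= => -> ->; rewrite mulr0 addr0.
  - by rewrite /mkset /K rmorph1 => /eqP; rewrite oner_eq0.
  - by move=> u v; rewrite /mkset /K rmorphM => /eqP; rewrite mulf_eq0 => /orP[] /eqP; [left|right].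
have [P hP] := choice ex; exists (fun t : 'I_i.+1 => P (i - t)%N); split.
  move=> t f /annE hf; apply/hP; rewrite -(KK _ i); last exact: leq_subr.
  by rewrite {2}/K hf /K rmorph0.
move=> s t st; have tn : (i - t < n)%N.
  have := ltn_ord t; have := ltn_ord s; lia.
split=> [f /hP hf|/(_ 'X_(Ordinal tn))].
  apply/hP; rewrite -(KK _ (i - s)%N); last by apply: leq_sub2l; apply: ltnW.
  by rewrite hf /K rmorph0.
rewrite /mkset => h; have : K (i - s)%N 'X_(Ordinal tn) = 0.
  by apply/hP; apply: h; apply/hP; rewrite /K keepX ltnn.
rewrite /K keepX /= ltn_sub2l //; last by have := ltn_ord t; lia.
by move/eqP; rewrite -mleadc_eq0 mleadXm mcoeffX eqxx oner_eq0.
Qed.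

(** When the chain ends in the residue field in degree [b], the last Hilbert
    function is the indicator of [b]. *)
Lemma chain_table i (Y : gradedModule k n) p j : cm_chain i Y (fun j => (j == b : nat)) ->
  Delta p (fun l => (kdim (@loc_cohomology_comp k n Y p l))%:R) j =
  ((p == i) && (j + i%:Z == b))%:R.
Proof.
move=> /cm_chain_cohomology[van [H [dimH DH _]]]; have [->|/eqP pi] := eqVneq p i.
  by rewrite -DH; apply: Delta_ext => l; rewrite (cohom_dim_kdim (dimH l)).
rewrite -[RHS](Delta0 p j); apply: Delta_ext => l.
by rewrite (cohom_dim_kdim (vanishes_cohom_dim (j := l) (van p pi))).
Qed.

Lemma presents_cm i (Y : gradedModule k n) (g : {linear S^o -> Y}) : (i <= n)%N ->
  presents b i g -> cohen_macaulay Y.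
Proof.
move=> hi pg; have [chain [s [ss sm sr]]] := presents_chain hi pg.
exists i; split; first exact: presents_dim hi pg.
split; first by exists s.
(* A longer regular sequence would make the nonzero cohomology in degree [i] vanish. *)
move=> s' sm' sr'; rewrite leqNgt; apply/negP => lt.
have van : cohom_vanishes Y i := regular_seq_vanishes sm' sr' lt.
have := chain_table i (b - i%:Z) chain; rewrite eqxx subrK eqxx /=.
rewrite (@Delta_ext _ _ (fun=> 0)) => [|l]; last first.
  by rewrite (cohom_dim_kdim (vanishes_cohom_dim (j := l) van)).
by rewrite Delta0 => /eqP; rewrite eq_sym oner_eq0.
Qed.

End PresentedModules.

Section UnitTable.
Variables (k : fieldType) (n : nat).
Local Notation S := {mpoly k[n]}.

(** The polynomial ring in the first [i] variables, generated in degree [j + i]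
    because its top cohomology starts [i] degrees below its generator. *)
Lemma unit_table (i : 'I_n.+1) (j : int) : exists M : gradedModule k n,
  [/\ fin_gen M, seq_cohen_macaulay M
    & Delta_table M = fun i' j' => ((i' == i) && (j' == j))%:R].
Proof.
have hi : (i <= n)%N by rewrite -ltnS.
pose b : int := j + (i : nat)%:Z; pose M := gquot (@kill_graded k n b i).
have pg := @gquot_presents k n b i; exists M; split.
- exists 1%N, (fun=> qpi (kill k n b i) 1) => y; have [f <-] := qpi_surj y.
  exists (fun=> f); rewrite big_ord1 -linearZZ; congr (qpi _ _).
  by rewrite -[LHS]mulr1.
- have c0 : submod_closed [pred x : M | x == 0].
    by split=> [|a x y]; rewrite !inE ?eqxx // => /eqP -> /eqP ->; rewrite scaler0 addr0.
  have c1 : submod_closed [pred x : M | true] by [].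
  pose U (t : nat) : submodule M := if t is 0 then Submodule c0 else Submodule c1.
  have gU t : graded_submod (U t).
    case: t => [|t] x hx.
      exists [::], (fun=> 0); split=> // [l|]; last by rewrite big_nil; apply/eqP.
      by split; [apply: gr_comp0 | rewrite inE eqxx].
    exists (undup (degs x)), (fun l => hcomp l x); split; first exact: undup_uniq.
      by move=> l; split=> //; apply: hcomp_comp.
    by apply: hcomp_sum; [apply: undup_uniq | move=> l; rewrite mem_undup].
  exists 1%N, U; split=> //.
  + by split=> // x; split=> /eqP.
  case=> // _.
  pose Y := gquot (@restr_graded k n M (U 0%N) (U 1%N) (@gU 0%N) (@gU 1%N)).
  pose full (x : M) : submod (U 1%N) := exist _ x isT.
  have full_lin : linear full by move=> a x y; apply: val_inj.
  pose fc := GRing.isLinear.Build S M (submod (U 1%N)) _ full full_lin.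
  pose fullL : {linear M -> submod (U 1%N)} := HB.pack full fc.
  pose g : {linear S^o -> Y} := qpi (restr_submod (U 1%N) (U 0%N)) \o (fullL \o qpi (kill k n b i)).
  apply: (@presents_cm k n b i Y g hi); case: pg => [gs g0 gc gl].
  have gE f : g f = qpi (restr_submod (U 1%N) (U 0%N)) (full (qpi (kill k n b i) f)) by [].
  split.
  + move=> y; have [x <-] := qpi_surj y; have [f hf] := gs (val x).
    by exists f; rewrite gE hf; congr (qpi _ _); apply: val_inj.
  + by move=> f; rewrite gE qpi_eq0 inE; split=> [/eqP/g0//|/g0 h]; apply/eqP.
  + by move=> l f hf; rewrite gE; exists (full (qpi (kill k n b i) f)) => //; apply: gc.
  move=> l y [x hx <-]; have [f hf fx] := gl _ _ hx; exists f => //.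
  by rewrite gE fx; congr (qpi _ _); apply: val_inj.
apply: functional_extensionality_dep => i'; apply: functional_extensionality_dep => j'.
have [chain _] := presents_chain hi pg.
rewrite /Delta_table (chain_table _ _ chain) /b; congr (_ && _)%:R.
by apply/eqP/eqP => [e|->//]; exact: addIr e.
Qed.
End UnitTable.

(** * The cone of sequentially Cohen-Macaulay modules *)

Lemma Delta_table_ge0 (k : fieldType) (n : nat) (M : gradedModule k n) :
  infinite_set [set: k] -> fin_gen M -> seq_cohen_macaulay M ->
  forall i j, 0 <= Delta_table M i j.
Proof.
move=> hk fgM cmM i j; have [H [hH dH]] := seq_cohen_macaulay_nonneg hk fgM cmM i.
by rewrite /Delta_table (Delta_ext _ (fun l => congr1 _ (cohom_dim_kdim (hH l)))).
Qed.

Theorem theorem3 (k : fieldType) (n : nat) (A : 'I_n.+1 -> int -> rat)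
    (hk : infinite_set [set: k]) (hA : finite_table A) :
  Cseq k A <-> forall (i : 'I_n.+1) (j : int), 0 <= A i j.
Proof.
split=> [[r [q [B [q0 hB AE]]]] i j|A0].
  rewrite AE; apply: sumr_ge0 => t _; apply: mulr_ge0 => //.
  by have [M [fgM cmM ->]] := hB t; apply: Delta_table_ge0.
have [s sE] : exists s : seq ('I_n.+1 * int), [set p | A p.1 p.2 <> 0] = [set` s].
  exact/finite_seqP.
pose u := undup s; pose p (t : 'I_(size u)) := tnth (in_tuple u) t.
exists (size u), (fun t => A (p t).1 (p t).2),
  (fun t i j => ((i == (p t).1) && (j == (p t).2))%:R); split=> [t|t|i j] //.
  by have [M [fgM cmM tM]] := unit_table k (p t).1 (p t).2; exists M.
have -> : \sum_t A (p t).1 (p t).2 * ((i == (p t).1) && (j == (p t).2))%:R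
    = \sum_(x <- u) A x.1 x.2 * ((i == x.1) && (j == x.2))%:R.
  by rewrite [RHS]big_tnth.
have [Aij|/eqP Aij] := eqVneq (A i j) 0.
  rewrite Aij big1 // => x _; case: eqP => [<-|_]; last by rewrite mulr0.
  by case: eqP => [<-|_]; rewrite ?Aij ?mul0r ?mulr0.
have ij : (i, j) \in u.
  by rewrite mem_undup; have : [set` s] (i, j) by rewrite -sE.
rewrite (bigD1_seq (i, j)) ?undup_uniq //= !eqxx mulr1 big1 ?addr0 // => -[i' j'] ne /=.
case: eqP => [ii|_]; last by rewrite mulr0.
case: eqP => [jj|_]; last by rewrite mulr0.
by rewrite ii jj eqxx in ne.
Qed.
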